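(* Given generators $a_1,\dots,a_k\in T_n$, there are $\mathsf{NL}$ algorithms to check each of the following properties of $S=\langle a_1,\dots,a_k\rangle$: (1) all elements in $S$ are idempotent; (2) all idempotents are central in $S$; (3) all idempotents of $S$ commute (with each other); (4) the product of any two idempotents of $S$ is idempotent. That is, for each of these four properties, the problem of deciding from input $a_1,\dots,a_k\in T_n$ whether $S$ has the property is in $\mathsf{NL}$.
   Context: $T_n$ is the full transformation semigroup on $[n]=\{1,\dots,n\}$: all maps $[n]\to[n]$, acting on the right, under composition. $\langle a_1,\dots,a_k\rangle$ is the subsemigroup of $T_n$ generated by $a_1,\dots,a_k$ ($k,n\ge 1$). In the input each transformation is given by its table of values, and $k,n$ are part of the input. An element $s$ is idempotent if $s^2=s$; an element of $S$ is central if it commutes with every element of $S$. $\mathsf{NL}$ is the class of sets decidable in nondeterministic logarithmic space. *)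

(* Defs.v *)
From HB Require Import structures.
From Stdlib Require Import Relation_Operators.
From mathcomp Require Import all_boot.

Set Implicit Arguments.
Unset Strict Implicit.
Unset Printing Implicit Defensive.

(* Nondeterministic space-bounded Turing machines: a two-way read-only input
   tape between end markers, and finitely many one-way infinite read-write work
   tapes.  Only the work tapes count towards the space used. *)

Inductive move := MLeft | MStay | MRight.

(* A head in cell 0 stays there when told to move left. *)
Definition shift (m : move) (p : nat) : nat :=
  match m with MLeft => p.-1 | MStay => p | MRight => p.+1 end.

Inductive scanned (Sigma : Type) :=
  | LeftEnd
  | RightEnd
  | Letter of Sigma.
Arguments LeftEnd {Sigma}.
Arguments RightEnd {Sigma}.

Record machine (Sigma : finType) := Machine {
  state : finType;
  work_symbol : finType;
  blank : work_symbol;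
  tapes : nat;
  start : state;
  accepting : pred state;
  (* [trans q x r q' m u]: in state [q], scanning [x] on the input tape and
     [r j] on work tape [j], the machine may enter state [q'], move its input
     head by [m], and on each work tape [j] write [(u j).1] and then move the
     head by [(u j).2]. *)
  trans : state -> scanned Sigma -> {ffun 'I_tapes -> work_symbol} ->
          state -> move -> {ffun 'I_tapes -> work_symbol * move} -> bool
}.

Section Semantics.

Variables (Sigma : finType) (M : machine Sigma).

(* On input [w], input cell 0 holds the left end marker, cells [1] to [size w]
   hold [w], and cell [(size w).+1] holds the right end marker. *)
Record config := Config {
  cstate : state M;
  cinput : nat;
  ctape : 'I_(tapes M) -> nat -> work_symbol M;
  chead : 'I_(tapes M) -> nat
}.

Definition scan (w : seq Sigma) (p : nat) : scanned Sigma :=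
  if p is p'.+1 then
    if onth w p' is Some x then Letter x else RightEnd
  else LeftEnd.

Definition init : config :=
  Config (start M) 0 (fun _ _ => blank M) (fun _ => 0).

(* [minn] keeps the input head from leaving the right end marker; an
   unconfined input head would be a free counter. *)
Definition step (w : seq Sigma) (c c' : config) : Prop :=
  exists q m (u : {ffun 'I_(tapes M) -> work_symbol M * move}),
    trans (cstate c) (scan w (cinput c))
          [ffun j => ctape c j (chead c j)] q m u /\
    c' = Config q (minn (shift m (cinput c)) (size w).+1)
           (fun j p => if p == chead c j then (u j).1 else ctape c j p)
           (fun j => shift (u j).2 (chead c j)).

Definition reachable (w : seq Sigma) (c : config) : Prop :=
  clos_refl_trans config (step w) init c.

Definition accepts (w : seq Sigma) : Prop :=
  exists2 c, reachable w c & accepting (cstate c).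

(* The bound is imposed on every computation, accepting or not. *)
Definition uses_space (w : seq Sigma) (s : nat) : Prop :=
  forall c, reachable w c -> forall j, chead c j < s.

End Semantics.

(* [trunc_log 2 n] is the floor of the binary logarithm, and 0 for [n = 0]. *)
Definition NL (Sigma : finType) (L : seq Sigma -> Prop) : Prop :=
  exists (M : machine Sigma) (c : nat),
    (forall w, uses_space M w (c * (trunc_log 2 (size w)).+1)) /\
    (forall w, L w <-> accepts M w).

(* The full transformation semigroup on ['I_n]; the element [i] of ['I_n]
   stands for the point [i.+1] of {1, ..., n}. *)
Definition transf (n : nat) : Type := {ffun 'I_n -> 'I_n}.

HB.instance Definition _ n := Finite.on (transf n).

(* Transformations act on the right. *)
Definition transf_mul n (s t : transf n) : transf n := [ffun x => t (s x)].

Fact transf_mulA n : associative (@transf_mul n).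
Proof. by move=> s t u; apply/ffunP=> x; rewrite !ffunE. Qed.

HB.instance Definition _ n := isSemigroup.Build (transf n) (@transf_mulA n).

Inductive generated (G : semigroupType) (a : seq G) : G -> Prop :=
  | generated_gen s : s \in a -> generated a s
  | generated_mul s t : generated a s -> generated a t -> generated a (s * t)%g.

Section Properties.

Variables (G : semigroupType) (S : G -> Prop).

Definition idem (s : G) : Prop := (s * s)%g = s.

Definition central (s : G) : Prop := S s /\ forall t, S t -> commute s t.

Definition all_idempotent : Prop := forall s, S s -> idem s.

Definition idempotents_central : Prop :=
  forall e, S e -> idem e -> central e.

Definition idempotents_commute : Prop :=
  forall e f, S e -> idem e -> S f -> idem f -> commute e f.

Definition idempotent_products : Prop :=
  forall e f, S e -> idem e -> S f -> idem f -> idem (e * f)%g.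

End Properties.

Inductive symbol := Bit of bool | Comma | Semicolon.

Definition symbol_code (x : symbol) : option (option bool) :=
  match x with Bit b => Some (Some b) | Comma => Some None | Semicolon => None end.

Definition symbol_decode (y : option (option bool)) : symbol :=
  match y with Some (Some b) => Bit b | Some None => Comma | None => Semicolon end.

Fact symbol_codeK : cancel symbol_code symbol_decode.
Proof. by case. Qed.

HB.instance Definition _ := Finite.copy symbol (can_type symbol_codeK).

(* Most significant digit first, without leading zeros, for [m > 0]. *)
Definition binary (m : nat) : seq bool :=
  rev [seq odd (m %/ 2 ^ j) | j <- iota 0 (trunc_log 2 m).+1].

Definition encode_value n (i : 'I_n) : seq symbol :=
  rcons (map Bit (binary i.+1)) Comma.

Definition encode_table n (s : transf n) : seq symbol :=
  rcons (flatten [seq encode_value (s x) | x <- enum 'I_n]) Semicolon.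

(* [n] and [k] can be read off the code, as the number of commas before each
   semicolon and the number of semicolons. *)
Definition encode n k (a : k.-tuple (transf n)) : seq symbol :=
  flatten (map (@encode_table n) a).

Definition generators_problem
    (P : forall G : semigroupType, (G -> Prop) -> Prop) (w : seq symbol) : Prop :=
  exists (n k : nat) (a : k.-tuple (transf n)),
    [/\ 0 < n, 0 < k, w = encode a & P (transf n) (generated a)].

(* Main.v *)
(** Each of the four properties fails exactly when two elements of S carry
certain quadruples of points to certain quadruples, since an element with
x s = y and y s = y has an idempotent power sending x to y.  Existence of such
an element is reachability in the graph of the action of the generators on
quadruples, so the properties themselves are statements of non-reachability,
and the Immerman-Szelepcsenyi inductive counting puts them in NL.

Machines are handled through logic.  Over the numbers below 2^m, with m
logarithmic in the input length, the predicates that a nondeterministic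
log-space machine can verify contain zero, successor and the letters of the
input, and are closed under conjunction, disjunction, bounded existential
quantification and reflexive transitive closure.  Parsing, inductive counting
and the four properties are then written with these connectives only. *)

From HB Require Import structures.
From Stdlib Require Import Relation_Operators.
Require Import Defs.
From mathcomp Require Import all_boot zify boolp.

Set Implicit Arguments.
Unset Strict Implicit.
Unset Printing Implicit Defensive.

(** The table of an element of S has n entries and does not fit into logarithmic space, so an
    element is never stored: a program follows the images of boundedly many points while a word in
    the generators is guessed. Idempotency cannot be seen in this way, and the test x s = y, y s = y
    replaces it. The largest case is the product: x e f e f = x e f involves the five points x, y,
    z, u, v met on the way, with e prescribed at x, y, z, u and f at y, z, u, v. Hence quintuples of
    points, and quadruples for the action; the other properties fit into the same format by
    repetition.

    Negation is not among the connectives, since a failed search certifies nothing. Every complement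
    is therefore given positively: inequality through the order, the absence of an edge by
    exhibiting the image under each generator, unreachability by counting. A universal quantifier is
    a degenerate count.

    The space bound concerns every computation, so the length of the registers is fixed before any
    program starts. *)

Notation rtc := (clos_refl_trans _).

(** * Reflexive transitive closure *)

Lemma rtc_trans T (R : T -> T -> Prop) x y z :
  rtc R x y -> rtc R y z -> rtc R x z.
Proof. exact: rt_trans. Qed.

Lemma rtc_rcons T (R : T -> T -> Prop) x y z : rtc R x y -> R y z -> rtc R x z.
Proof. by move=> xy yz; apply: rtc_trans xy (rt_step _ _ _ _ yz). Qed.

Lemma rtc_cons T (R : T -> T -> Prop) x y z : R x y -> rtc R y z -> rtc R x z.
Proof. by move=> xy; apply: rtc_trans (rt_step _ _ _ _ xy). Qed.

Lemma rtc_inv T (R : T -> T -> Prop) (P : T -> Prop) x y :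
  (forall a b, P a -> R a b -> P b) -> P x -> rtc R x y -> P y.
Proof.
move=> stepP Px xy; elim: xy Px => [a b ab /stepP|//|a b c _ ab _ bc Pa].
  exact.
exact: bc (ab Pa).
Qed.

Lemma rtc_map T U (f : T -> U) (R : T -> T -> Prop) (S : U -> U -> Prop) x y :
  (forall a b, R a b -> rtc S (f a) (f b)) -> rtc R x y -> rtc S (f x) (f y).
Proof.
move=> RS; elim=> [a b /RS//|a|a b c _ ab _ bc]; first exact: rt_refl.
exact: rtc_trans ab bc.
Qed.

(** * Binary digits *)

Definition bit (x i : nat) : bool := odd (x %/ 2 ^ i).

Lemma bit0 x : bit x 0 = odd x.
Proof. by rewrite /bit expn0 divn1. Qed.

Lemma bitS x i : bit x i.+1 = bit x./2 i.
Proof. by rewrite /bit expnS divnMA divn2. Qed.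

Lemma half_lt_exp m x : x < 2 ^ m.+1 -> x./2 < 2 ^ m.
Proof. by rewrite expnS; lia. Qed.

Lemma bit_ext m x y : x < 2 ^ m -> y < 2 ^ m ->
  (forall i, i < m -> bit x i = bit y i) -> x = y.
Proof.
elim: m x y => [|m IH] x y; first by rewrite expn0; lia.
move=> /half_lt_exp xm /half_lt_exp ym xy.
rewrite -[x]odd_double_half -[y]odd_double_half -!bit0 xy //; congr (_ + _.*2).
by apply: IH => // i im; rewrite -!bitS xy.
Qed.

Lemma bit_surj m (f : nat -> bool) :
  exists2 x, x < 2 ^ m & forall i, i < m -> bit x i = f i.
Proof.
elim: m f => [|m IH] f; first by exists 0.
have [x xm xf] := IH (fun i => f i.+1).
exists (f 0 + x.*2); first by rewrite expnS; case: (f 0); lia.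
case=> [|i] im; first by rewrite bit0 oddD odd_double addbF oddb.
by rewrite bitS half_bit_double xf.
Qed.

Lemma bit_zero i : bit 0 i = false.
Proof. by rewrite /bit div0n. Qed.

Lemma bit_ones m i : i < m -> bit (2 ^ m).-1 i.
Proof.
elim: m i => // m IH [|i] im.
  by rewrite bit0 expnS; have := expn_gt0 2 m; lia.
rewrite bitS; have -> : (2 ^ m.+1).-1./2 = (2 ^ m).-1 by rewrite expnS; lia.
exact: IH.
Qed.

(** Adding one clears the trailing ones and sets the zero after them at position [j]. This shape,
    one rule below [j], one at [j] and one above, is what a single sweep of the tape can test;
    [j < m] excludes overflow. *)
Lemma bit_succ m x y : x < 2 ^ m -> y < 2 ^ m ->
  y = x.+1 <-> exists2 j, j < m & forall i, i < m ->
    if i < j then bit x i && ~~ bit y i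
    else if i == j then ~~ bit x i && bit y i else bit x i == bit y i.
Proof.
elim: m x y => [|m IH] x y xm ym.
  split; first by move: xm ym; rewrite expn0; lia.
  by case.
have {}IH := IH _ _ (half_lt_exp xm) (half_lt_exp ym).
split=> [yx|[[|j] jm xyj]].
- case xo: (odd x).
    have /IH[j jm H] : y./2 = x./2.+1 by rewrite yx; lia.
    exists j.+1 => // -[_|i im]; first by rewrite !bit0 xo yx /= xo.
    by rewrite !bitS ltnS eqSS; apply: H.
  exists 0 => // -[_|i im] /=; first by rewrite !bit0 yx /= xo.
  by rewrite !bitS; have -> : y./2 = x./2 by lia.
- have /= := xyj 0 isT; rewrite !bit0 => /andP[xo yo].
  have : x./2 = y./2.
    apply: (bit_ext (half_lt_exp xm) (half_lt_exp ym)) => i im.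
    by have /= /eqP := xyj i.+1 im; rewrite !bitS.
  by move: xo yo; lia.
- have /= := xyj 0 isT; rewrite !bit0 => /andP[xo yo].
  have : y./2 = x./2.+1.
    by apply/IH; exists j => // i im; have := xyj i.+1 im; rewrite !bitS.
  by move: xo yo; lia.
Qed.

(** * Control graphs over logarithmic-length registers *)

(** The bit length is a parameter and not a function of the word: a program works for every length
    with room for all head positions, and the machine uses the one that its own count produces. *)
Record env := Env {
  word : seq symbol;
  bits : nat;
  word_small : (size word).+1 < 2 ^ bits
}.

Definition dom (e : env) : Type := 'I_(2 ^ bits e).
HB.instance Definition _ e := Finite.on (dom e).

Definition regs (e : env) (I : finType) : Type := {ffun I -> dom e}.

Definition column_type (I : finType) : Type := {ffun I -> bool}.
HB.instance Definition _ I := Finite.on (column_type I).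

Definition column e I (v : regs e I) (i : nat) : column_type I :=
  [ffun r => bit (v r) i].

(* [Sweep a b c] rewrites the columns from bit 0 upwards: columns below some
   freely chosen position are related by [a], that one by [b], later ones by [c]. *)
Inductive op (I : finType) :=
  | Input of pred (scanned symbol) & move
  | Sweep of rel (column_type I) & rel (column_type I) & rel (column_type I).

Definition fits I (a b c : rel (column_type I)) j i : rel (column_type I) :=
  if i < j then a else if i == j then b else c.

Arguments fits : simpl never.

Definition move_in (w : seq symbol) (m : move) (p : nat) :=
  minn (shift m p) (size w).+1.

Definition op_sem e I (o : op I) (x y : nat * regs e I) : Prop :=
  match o with
  | Input s m => s (scan (word e) x.1) /\ y = (move_in (word e) m x.1, x.2)
  | Sweep a b c => y.1 = x.1 /\ exists2 j, j < bits e &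
      forall i, i < bits e -> fits a b c j i (column x.2 i) (column y.2 i)
  end.

Definition run_step Q I (lab : Q -> Q -> op I) e (x y : Q * (nat * regs e I)) :=
  op_sem (lab x.1 y.1) x.2 y.2.

Definition run Q I (lab : Q -> Q -> op I) e := rtc (run_step lab (e := e)).

Lemma column_surj e I (k : nat -> column_type I) :
  exists v : regs e I, forall i, i < bits e -> column v i = k i.
Proof.
have /(_ _)/cid2 H r := bit_surj (bits e) (fun i => k i r).
exists [ffun r => Ordinal (s2valP (H r))] => i im.
by apply/ffunP=> r; rewrite !ffunE /= (s2valP' (H r)).
Qed.

Lemma column_inj e I (v v' : regs e I) :
  (forall i, i < bits e -> column v i = column v' i) -> v = v'.
Proof.
move=> vv'; apply/ffunP=> r; apply/val_inj/(@bit_ext (bits e)) => //= i im.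
by have /ffunP/(_ r) := vv' i im; rewrite !ffunE.
Qed.

(* One work tape holds all registers: a left mark in cell 0, the column of the
   [i]th bits in cell [i.+1], and a right mark in cell [m.+1].  The marks are laid
   by first counting the length of the input in binary, every register holding
   the counter.  In [Pass q r b] the bit [b] tells whether the chosen position of
   the sweep from [q] to [r] has been passed. *)
Inductive mstate (Q : Type) :=
  | Boot | CountRewind | CountCarry | CountDone
  | Node of Q | Pass of Q & Q & bool.
Arguments Boot {Q}.
Arguments CountRewind {Q}.
Arguments CountCarry {Q}.
Arguments CountDone {Q}.

Definition mstate_code Q (s : mstate Q) : bool * bool + (Q + Q * Q * bool) :=
  match s with
  | Boot => inl (true, true) | CountRewind => inl (true, false)
  | CountCarry => inl (false, true) | CountDone => inl (false, false)
  | Node q => inr (inl q) | Pass q r b => inr (inr (q, r, b))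
  end.

Definition mstate_decode Q (s : bool * bool + (Q + Q * Q * bool)) : mstate Q :=
  match s with
  | inl (true, true) => Boot | inl (true, false) => CountRewind
  | inl (false, true) => CountCarry | inl (false, false) => CountDone
  | inr (inl q) => Node q | inr (inr (q, r, b)) => Pass q r b
  end.

Fact mstate_codeK Q : cancel (@mstate_code Q) (@mstate_decode Q).
Proof. by case. Qed.

HB.instance Definition _ (Q : finType) :=
  Finite.copy (mstate Q) (can_type (@mstate_codeK Q)).

(** * Compilation of a control graph into a machine with one work tape *)

Section Compile.

Variables (I Q : finType) (start_node end_node : Q) (lab : Q -> Q -> op I).
(* Without a register, the columns for the bits 0 and 1 of the counter coincide. *)
Variable (r0 : I).

Definition cell : Type := option (option (option (column_type I))).
HB.instance Definition _ := Finite.on cell.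
Notation Blank := (@None (option (option (column_type I)))).
Notation LMark := (Some (@None (option (column_type I)))).
Notation RMark := (Some (Some (@None (column_type I)))).
Notation Col c := (Some (Some (Some c))).

Definition const (b : bool) : column_type I := [ffun=> b].

Lemma const_inj b b' : const b = const b' -> b = b'.
Proof. by move/ffunP/(_ r0); rewrite !ffunE. Qed.

(** A node may be entered with the work head anywhere; [rule_rewind] takes it to the left mark,
    where alone the next operation can begin. Since [rule_pass_end] requires the bit to be set, a
    completed sweep applies [rule_pass2] exactly once. *)
Inductive rule : mstate Q -> scanned symbol -> cell ->
                 mstate Q -> move -> cell -> move -> Prop :=
  | rule_boot x : rule Boot x Blank CountRewind MStay LMark MStay
  | rule_count_rewind x c :
      rule CountRewind x (Col c) CountRewind MStay (Col c) MLeft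
  | rule_count_next x : x <> RightEnd ->
      rule CountRewind x LMark CountCarry MRight LMark MRight
  | rule_count_end : rule CountRewind RightEnd LMark CountDone MStay LMark MRight
  | rule_carry x :
      rule CountCarry x (Col (const true)) CountCarry MStay (Col (const false)) MRight
  | rule_set x : rule CountCarry x (Col (const false)) CountRewind
                   MStay (Col (const true)) MLeft
  | rule_extend x : rule CountCarry x Blank CountRewind
                   MStay (Col (const true)) MLeft
  | rule_done x c : rule CountDone x (Col c) CountDone MStay (Col c) MRight
  | rule_mark x : rule CountDone x Blank (Node start_node) MStay RMark MLeft
  | rule_rewind q x g : g <> LMark -> rule (Node q) x g (Node q) MStay g MLeft
  | rule_input q q' x s m : lab q q' = Input I s m -> s x ->
      rule (Node q) x LMark (Node q') m LMark MStay
  | rule_pass q q' x a b c : lab q q' = Sweep a b c ->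
      rule (Node q) x LMark (Pass q q' false) MStay LMark MRight
  | rule_pass1 q q' x a b c k k' : lab q q' = Sweep a b c -> a k k' ->
      rule (Pass q q' false) x (Col k) (Pass q q' false) MStay (Col k') MRight
  | rule_pass2 q q' x a b c k k' : lab q q' = Sweep a b c -> b k k' ->
      rule (Pass q q' false) x (Col k) (Pass q q' true) MStay (Col k') MRight
  | rule_pass3 q q' x a b c k k' : lab q q' = Sweep a b c -> c k k' ->
      rule (Pass q q' true) x (Col k) (Pass q q' true) MStay (Col k') MRight
  | rule_pass_end q q' x :
      rule (Pass q q' true) x RMark (Node q') MStay RMark MLeft.

Definition compiled : machine symbol :=
  @Machine symbol (mstate Q) cell Blank 1 Boot (pred1 (Node end_node))
    (fun q x r q' m u =>
       `[< rule q x (r ord0) q' m (u ord0).1 (u ord0).2 >]).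

Notation conf := (config compiled).
Definition tape (c : conf) := ctape c ord0.
Definition head (c : conf) := chead c ord0.

Lemma stepP w (c c' : conf) : step w c c' -> exists q m g h,
  [/\ rule (cstate c) (scan w (cinput c)) (tape c (head c)) q m g h,
      cstate c' = q, cinput c' = move_in w m (cinput c),
      forall i, tape c' i = if i == head c then g else tape c i
    & head c' = shift h (head c)].
Proof.
move=> [q [m [u [/asboolP]]]]; rewrite ffunE => R ->.
by exists q, m, (u ord0).1, (u ord0).2; split.
Qed.

Lemma step_rule w (c : conf) q m g h :
  rule (cstate c) (scan w (cinput c)) (tape c (head c)) q m g h ->
  exists c', [/\ step w c c',
      cstate c' = q, cinput c' = move_in w m (cinput c),
      forall i, tape c' i = if i == head c then g else tape c i
    & head c' = shift h (head c)].
Proof.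
move=> R; eexists; split.
  exists q, m, [ffun=> (g, h)]; split; last reflexivity.
  by apply/asboolP; rewrite !ffunE.
all: by rewrite ?ffunE // /tape /head /= ?ffunE // => i; rewrite ffunE.
Qed.

(** The cell [g] after the columns is blank while the counter may still grow, and holds the right
    mark afterwards. *)
Definition tape_is (T : nat -> cell) m (k : nat -> column_type I) (g : cell) :=
  [/\ T 0 = LMark, forall i, i < m -> T i.+1 = Col (k i), T m.+1 = g
    & forall i, m.+1 < i -> T i = Blank].

Lemma tape_is_ext T T' m k k' g : tape_is T m k g ->
  T =1 T' -> (forall i, i < m -> k i = k' i) -> tape_is T' m k' g.
Proof.
move=> [T0 Tm Tg TB] TT kk; split; rewrite -?TT // => i im; rewrite -TT.
  by rewrite Tm // kk.
exact: TB.
Qed.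

Lemma tape_is_set T T' m k g j c : tape_is T m k g -> j < m ->
  (forall i, T' i = if i == j.+1 then Col c else T i) ->
  tape_is T' m (fun i => if i == j then c else k i) g.
Proof.
move=> [T0 Tm Tg TB] jm TT; split; rewrite ?TT //=.
- by move=> i im; rewrite TT eqSS; case: eqP => // _; apply: Tm.
- by rewrite eqSS gtn_eqF.
- by move=> i im; rewrite TT gtn_eqF ?TB //; lia.
Qed.

(* The upper bound on [2 ^ m] keeps the tape logarithmic. *)
Definition wide m t := t < 2 ^ m <= t.*2.+1.

Definition count_column t i := const (bit t i).

(** Besides the shape of the tape, the invariant holds the soundness of the simulation: at a node
    there is a run of the control graph leading to the present contents. In [CountCarry] the counter
    shows [t] with its lowest [j] ones already cleared; in [Pass] the columns below [j] are new and
    the others still those of [v]. *)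
Definition inv w (c : conf) : Prop :=
  match cstate c with
  | Boot => [/\ cinput c = 0, head c = 0 & forall i, tape c i = Blank]
  | CountRewind => exists m,
      [/\ tape_is (tape c) m (count_column (cinput c)) Blank,
          wide m (cinput c), head c <= m & cinput c <= (size w).+1]
  | CountCarry => exists m t j,
      [/\ tape_is (tape c) m
            (fun i => const (if i < j then false else bit t i)) Blank,
          wide m t, [/\ cinput c = t.+1 & t <= size w],
          [/\ head c = j.+1 & j <= m] & forall i, i < j -> bit t i]
  | CountDone => exists m,
      [/\ tape_is (tape c) m (count_column (cinput c)) Blank,
          wide m (cinput c), 0 < head c <= m.+1 & cinput c = (size w).+1]
  | Node q => exists e v0 (v : regs e I),
      [/\ word e = w, wide (bits e) (size w).+1,
          [/\ head c <= (bits e).+1 & cinput c <= (size w).+1],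
          run lab (start_node, ((size w).+1, v0)) (q, (cinput c, v))
        & tape_is (tape c) (bits e) (column v) RMark]
  | Pass q q' b => exists e v0 (v : regs e I) a1 a2 a3 k j,
      [/\ word e = w /\ lab q q' = Sweep a1 a2 a3,
          wide (bits e) (size w).+1,
          [/\ head c = j.+1, j <= bits e & cinput c <= (size w).+1],
          run lab (start_node, ((size w).+1, v0)) (q, (cinput c, v))
        & [/\ tape_is (tape c) (bits e) k RMark,
              forall i, j <= i < bits e -> k i = column v i
            & if b then exists2 l, l < j & forall i, i < j ->
                              fits a1 a2 a3 l i (column v i) (k i)
              else forall i, i < j -> a1 (column v i) (k i)]]
  end.

(** From 2^m <= 2t + 1 <= 2|w| + 3 the length [m] exceeds the rounded logarithm of |w| by at most
    two; with the two marks this gives the factor 4. The empty word is separate, its logarithm being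
    0 by convention. *)
Lemma wide_bound (w : seq symbol) m t : wide m t -> t <= (size w).+1 ->
  m.+1 < 4 * (trunc_log 2 (size w)).+1.
Proof.
move=> /andP[_ mt] tw.
suff : m <= (trunc_log 2 (size w)).+2 by lia.
case: (posnP (size w)) => [w0|w_gt0].
  rewrite w0 trunc_log0 -(@leq_exp2l 2) // (leq_trans mt) //; move: tw; rewrite w0 expnS expn1; lia.
have /andP[_ wl] := trunc_log_bounds (isT : 1 < 2) w_gt0.
rewrite -ltnS -(@ltn_exp2l 2) // (leq_ltn_trans mt) //.
by move: wl; rewrite !expnS; lia.
Qed.

Lemma inv_space w c : inv w c -> forall j, chead c j < 4 * (trunc_log 2 (size w)).+1.
Proof.
move=> + j; rewrite [j]ord1 -/(head c) /inv.
case: (cstate c) => [[_ -> _]|[m [_ wm]]|[m [t [j' [_ wm [_ tw] [-> jm] _]]]]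
  |[m [_ wm hm pe]]|q [e [? [? [ew wm [hm _] _ _]]]]
  |q q' b [e [? [? [? [? [? [? [k [_ wm [-> km _] _ _]]]]]]]]]] => //.
- by move=> hm pw; have := wide_bound wm pw; lia.
- by have := wide_bound wm (leqW tw); lia.
- by rewrite pe in wm; have := wide_bound wm (leqnn _); lia.
- by have := wide_bound wm (leqnn _); lia.
- by have := wide_bound wm (leqnn _); lia.
Qed.

Lemma move_in_stay (w : seq symbol) p : p <= (size w).+1 -> move_in w MStay p = p.
Proof. by move=> pw; rewrite /move_in /=; apply/minn_idPl. Qed.

Lemma move_in_le (w : seq symbol) m p : move_in w m p <= (size w).+1.
Proof. exact: geq_minr. Qed.

Lemma scan_lt (w : seq symbol) p : p <= (size w).+1 -> scan w p <> RightEnd -> p <= size w.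
Proof.
case: p => // p /=; rewrite ltnS leq_eqVlt => /orP[/eqP->|//].
by rewrite onth_default.
Qed.

Lemma scan_end (w : seq symbol) p : p <= (size w).+1 -> scan w p = RightEnd -> p = (size w).+1.
Proof.
case: p => // p /=; rewrite ltnS leq_eqVlt => /orP[/eqP->//|pw].
by case E: (onth w p) => // _; move: pw; rewrite -onthTE E.
Qed.

Lemma tape_is_cell T m k g i : tape_is T m k g -> i <= m.+1 ->
  T i = if i is i'.+1 then if i' < m then Col (k i') else g else LMark.
Proof.
move=> [T0 Tm Tg _]; case: i => // i; rewrite ltnS leq_eqVlt => /orP[/eqP->|im].
  by rewrite ltnn.
by rewrite im Tm.
Qed.

(** In each case the symbol under the head reveals, through [tape_is_cell], where the head stands,
    so a rule can fire only at its intended position. *)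
Lemma inv_step w c c' : inv w c -> step w c c' -> inv w c'.
Proof.
move=> + /stepP[q [m [g [h [R sc pc tc hc]]]]]; rewrite /inv sc {sc}.
move: R; move es: (cstate c) => s; move ex: (scan w (cinput c)) => x.
move eg: (tape c (head c)) => g0 R.
case: R es ex eg tc hc pc => {q m g h s x g0}.
(* The count starts with no column at all: zero on zero bits, matching input cell 0. *)
- move=> x _ _ _ tc hc pc [p0 h0 T]; exists 0; rewrite pc hc p0 h0 /=; split=> //.
  by split; rewrite ?tc ?h0 ?T // => i i0; rewrite tc h0 T; case: i i0.
- move=> x k _ _ ck tc hc pc [m [T wm hm pw]]; exists m.
  rewrite pc hc move_in_stay //=; split=> //; last by lia.
  by apply: tape_is_ext T _ _ => // i; rewrite tc; case: eqP => // ->.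
- move=> x xe _ sx ck tc hc pc [m [T wm hm pw]].
  have pw' : cinput c <= size w by apply: scan_lt => //; rewrite sx.
  have h0 : head c = 0.
    by move: ck; rewrite (tape_is_cell T) ?leqW //; case: (head c) hm => // i ->.
  exists m, (cinput c), 0; rewrite pc hc h0 /move_in /=.
  split=> //; last by split=> //; apply/minn_idPl.
  by apply: tape_is_ext T _ _ => // i; rewrite tc; case: eqP => // ->.
- move=> _ sx ck tc hc pc [m [T wm hm pw]]; exists m.
  have h0 : head c = 0.
    by move: ck; rewrite (tape_is_cell T) ?leqW //; case: (head c) hm => // i ->.
  rewrite pc hc move_in_stay // h0; split=> //; last exact: scan_end.
  by apply: tape_is_ext T _ _ => // i; rewrite tc; case: eqP => // ->.
- move=> x _ sx ck tc hc pc [m [t [j [T wm [pt tw] [hj jm] tj]]]].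
  have jm' : j < m.
    by move: ck; rewrite hj (tape_is_cell T) ?ltnS //; case: ltnP.
  have tj' : bit t j.
    by move: ck; rewrite hj (tape_is_cell T) // jm' ltnn => -[] /const_inj->.
  exists m, t, j.+1; rewrite pc hc hj /= move_in_stay pt ?ltnS //; split=> //.
    rewrite hj in tc; apply: tape_is_ext (tape_is_set T jm' tc) _ _ => // i im /=.
    by case: eqP => [->|/eqP ij]; rewrite ?leqnn // ltn_neqAle ij.
  by move=> i; rewrite ltnS leq_eqVlt => /orP[/eqP->//|/tj].
- move=> x _ sx ck tc hc pc [m [t [j [T wm [pt tw] [hj jm] tj]]]].
  have jm' : j < m.
    by move: ck; rewrite hj (tape_is_cell T) ?ltnS //; case: ltnP.
  have tj' : bit t j = false.
    by move: ck; rewrite hj (tape_is_cell T) // jm' ltnn => -[] /const_inj->.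
  exists m; rewrite pc hc hj /= move_in_stay pt ?ltnS //.
  (* [b] is the number now on the tape, given by its digits; [bit_succ] recognises it as [t.+1]. *)
  have [b bm bE] := bit_surj m (fun i => if i < j then false else if i == j then true else bit t i).
  have /andP[tm mt] := wm.
  have eb : b = t.+1.
    apply/(bit_succ tm bm); exists j => // i im; rewrite bE //.
    by case: ltnP => [/tj->//|ji]; case: eqP => [->|]; rewrite ?tj'.
  split; [|by rewrite /wide -eb bm eb; lia|by lia|by []].
  rewrite hj in tc; apply: tape_is_ext (tape_is_set T jm' tc) _ _ => // i im /=.
  by rewrite /count_column -eb bE //; case: eqP => [->|_]; case: ltnP => //; rewrite ltnn.
- move=> x _ sx ck tc hc pc [m [t [j [T wm [pt tw] [hj jm] tj]]]].
  have /eqP {jm} jm' : j == m.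
    by move: ck; rewrite eqn_leq jm hj (tape_is_cell T) ?ltnS //; case: ltnP.
  subst j; have /andP[tm mt] := wm.
  (* The carry runs past the last column only if all digits of [t] are ones. A column is thus added
     exactly at a power of two, which keeps the upper bound in [wide]. *)
  have et : t.+1 = 2 ^ m.
    have -> : t = (2 ^ m).-1.
      apply: (bit_ext tm) => [|i im]; first by have := expn_gt0 2 m; lia.
      by rewrite tj // bit_ones.
    by rewrite prednK // expn_gt0.
  exists m.+1; rewrite pc hc hj /= move_in_stay pt ?ltnS //.
  split=> //; last by rewrite /wide et expnS; lia.
  case: T => T0 Tm Tg TB; split; rewrite ?tc ?hj ?T0 //.
  + move=> i; rewrite tc hj eqSS ltnS leq_eqVlt; case: eqP => [-> _|_ /= im].
      congr (Col _); rewrite /count_column et; congr (const _).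
      by rewrite /bit divnn expn_gt0.
    rewrite Tm // im /count_column; congr (Col (const _)).
    rewrite et /bit -(subnKC (ltnW im)) expnD mulKn ?expn_gt0 //.
    by case: (m - i) (subn_gt0 i m) => [|d]; rewrite ?im // expnS oddM.
  + by rewrite eqSS gtn_eqF // TB.
  + by move=> i im; rewrite tc hj gtn_eqF ?TB //; lia.
- move=> x k _ sx ck tc hc pc [m [T wm /andP[h0 hm] pw]]; exists m.
  rewrite pc hc move_in_stay ?pw //= -pw; split=> //.
    by apply: tape_is_ext T _ _ => // i; rewrite tc; case: eqP => // ->.
  move: hm; rewrite leq_eqVlt ltnS => /orP[/eqP hm|//].
  by move: ck; rewrite hm (tape_is_cell T) // ltnn.
- move=> x _ sx ck tc hc pc [m [T wm /andP[h0 hm] pw]].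
  have hm' : head c = m.+1.
    apply/eqP; rewrite eqn_leq hm /=; move: ck; rewrite (tape_is_cell T) //.
    by case: (head c) h0 => // i _; case: ltnP.
  rewrite pw in wm T; have /andP[wm' _] := wm.
  (* The environment is fixed here: its bit length is the number of columns laid by the count, and
     [wide] provides the room that [Env] asks for. *)
  pose e := Env wm'; exists e, [ffun=> Ordinal wm'], [ffun=> Ordinal wm'].
  split=> //.
  + by rewrite pc hc hm' pw move_in_stay //=.
  + by rewrite pc pw move_in_stay //; apply: rt_refl.
  + case: T => T0 Tm Tg TB; split; rewrite ?tc ?hm' ?eqxx //= => i im.
      rewrite tc hm' eqSS ltn_eqF // Tm //; congr (Col _).
      by apply/ffunP=> r; rewrite !ffunE.
    by rewrite tc hm' gtn_eqF // TB.
- move=> q x g gl _ sx ck tc hc pc [e [v0 [v [ew wm [hm pw] rv T]]]].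
  exists e, v0, v; rewrite pc hc move_in_stay //=; split=> //; first by split=> //; lia.
  by apply: tape_is_ext T _ _ => // i; rewrite tc; case: eqP => // ->.
- move=> q q' x a m lq ax _ sx ck tc hc pc [e [v0 [v [ew wm [hm pw] rv T]]]].
  exists e, v0, v; rewrite pc hc /=; split=> //; first by rewrite move_in_le.
    by apply: rtc_rcons rv _; rewrite /run_step /= lq /= ew sx.
  by apply: tape_is_ext T _ _ => // i; rewrite tc; case: eqP => // ->.
- move=> q q' x a1 a2 a3 lq _ sx ck tc hc pc [e [v0 [v [ew wm [hm pw] rv T]]]].
  have h0 : head c = 0.
    move: ck; rewrite (tape_is_cell T) //; case: (head c) hm => // i.
    by rewrite ltnS leq_eqVlt => /orP[/eqP->|->] //; rewrite ltnn.
  exists e, v0, v, a1, a2, a3, (column v), 0; rewrite pc hc h0 move_in_stay //=.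
  split=> //; split=> //.
  by apply: tape_is_ext T _ _ => // i; rewrite tc; case: eqP => // ->.
- move=> q q' x a1 a2 a3 k k' lq akk _ sx ck tc hc pc
    [e [v0 [v [b1 [b2 [b3 [l [j [[ew lq'] wm [hj jm pw] rv [T lv1 lv2]]]]]]]]]].
  case: (etrans (esym lq) lq') => e1 e2 e3; subst b1 b2 b3.
  have jm' : j < bits e.
    by move: ck; rewrite hj (tape_is_cell T) ?ltnS //; case: ltnP.
  have lk : l j = k by move: ck; rewrite hj (tape_is_cell T) // jm' => -[].
  rewrite hj in tc; have T' := tape_is_set T jm' tc.
  exists e, v0, v, a1, a2, a3, (fun i => if i == j then k' else l i), j.+1.
  rewrite pc hc hj move_in_stay //=; split=> //; split=> //.
    by move=> i im; rewrite gtn_eqF ?lv1 //; lia.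
  move=> i; rewrite ltnS leq_eqVlt; case: eqP => [-> _|_ /lv2//].
  by rewrite -lv1 ?lk // leqnn.
- move=> q q' x a1 a2 a3 k k' lq akk _ sx ck tc hc pc
    [e [v0 [v [b1 [b2 [b3 [l [j [[ew lq'] wm [hj jm pw] rv [T lv1 lv2]]]]]]]]]].
  case: (etrans (esym lq) lq') => e1 e2 e3; subst b1 b2 b3.
  have jm' : j < bits e.
    by move: ck; rewrite hj (tape_is_cell T) ?ltnS //; case: ltnP.
  have lk : l j = k by move: ck; rewrite hj (tape_is_cell T) // jm' => -[].
  rewrite hj in tc; have T' := tape_is_set T jm' tc.
  exists e, v0, v, a1, a2, a3, (fun i => if i == j then k' else l i), j.+1.
  rewrite pc hc hj move_in_stay //=; split=> //; split=> //.
    by move=> i im; rewrite gtn_eqF ?lv1 //; lia.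
  exists j => // i; rewrite /fits ltnS leq_eqVlt; case: eqP => [-> _|_ /= ij].
    by rewrite ltnn -lv1 ?lk // leqnn.
  by rewrite ij lv2.
- move=> q q' x a1 a2 a3 k k' lq akk _ sx ck tc hc pc
    [e [v0 [v [b1 [b2 [b3 [l [j [[ew lq'] wm [hj jm pw] rv [T lv1 [n nj lv2]]]]]]]]]]].
  case: (etrans (esym lq) lq') => e1 e2 e3; subst b1 b2 b3.
  have jm' : j < bits e.
    by move: ck; rewrite hj (tape_is_cell T) ?ltnS //; case: ltnP.
  have lk : l j = k by move: ck; rewrite hj (tape_is_cell T) // jm' => -[].
  rewrite hj in tc; have T' := tape_is_set T jm' tc.
  exists e, v0, v, a1, a2, a3, (fun i => if i == j then k' else l i), j.+1.
  rewrite pc hc hj move_in_stay //=; split=> //; split=> //.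
    by move=> i im; rewrite gtn_eqF ?lv1 //; lia.
  exists n => [|i]; first exact: leqW.
  rewrite ltnS leq_eqVlt; case: eqP => [-> _|_ /lv2//].
  by rewrite /fits ltnNge ltnW //= gtn_eqF // -lv1 ?lk // leqnn.
- move=> q q' x _ sx ck tc hc pc
    [e [v0 [v [b1 [b2 [b3 [l [j [[ew lq] wm [hj jm pw] rv [T lv1 [n nj lv2]]]]]]]]]]].
  have /eqP {}jm : j == bits e.
    by move: ck; rewrite eqn_leq jm hj (tape_is_cell T) ?ltnS //; case: ltnP.
  (* At the right mark all columns have been rewritten and are those of registers [v'], so the whole
     pass amounts to one [Sweep] step of the graph. *)
  subst j; have [v' v'l] := column_surj e l.
  exists e, v0, v'; rewrite pc hc hj move_in_stay //=; split=> //.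
    apply: rtc_rcons rv _; rewrite /run_step /= lq /=; split=> //; exists n => // i im.
    by rewrite v'l // lv2.
  apply: tape_is_ext T _ _ => // [i|i im]; last by rewrite v'l.
  by rewrite tc; case: eqP => // ->.
Qed.

Lemma inv_init w : inv w (init compiled).
Proof. by split. Qed.

Lemma inv_reachable w c : reachable w c -> inv w c.
Proof. by apply: rtc_inv (@inv_step w) (inv_init w). Qed.

Lemma reachable_step w (c c' : conf) : reachable w c -> step w c c' -> reachable w c'.
Proof. exact: rtc_rcons. Qed.

Lemma reachable_head w (c : conf) :
  reachable w c -> head c < 4 * (trunc_log 2 (size w)).+1.
Proof. by move=> /inv_reachable/inv_space/(_ ord0). Qed.

Lemma reach_rewound w (c : conf) : reachable w c -> cstate c = CountRewind ->
  exists c' : conf, [/\ reachable w c', cstate c' = CountRewind,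
                 cinput c' = cinput c & head c' = 0].
Proof.
move hn : (head c) => n; elim: n c hn => [|n IH] c hn rc sc; first by exists c.
have := inv_reachable rc; rewrite /inv sc => -[m [T _ hm pw]].
have := tape_is_cell T (leqW hm); rewrite hn -hn hm => ck.
have := rule_count_rewind (scan w (cinput c)) (count_column (cinput c) n).
rewrite -ck -{1}sc => /step_rule[c' [st sc' pc' _ hc']].
have [|c2 [rc2 sc2 pc2 hc2]] := IH c' _ (reachable_step rc st) sc'.
  by rewrite hc' hn.
by exists c2; rewrite pc2 pc' move_in_stay.
Qed.

(** The head only moves right until the carry is absorbed, and the space bound already proved for
    reachable configurations serves as the termination measure. *)
Lemma reach_carried w (c : conf) : reachable w c -> cstate c = CountCarry ->
  exists c' : conf, [/\ reachable w c', cstate c' = CountRewind & cinput c' = cinput c].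
Proof.
move hn : (4 * (trunc_log 2 (size w)).+1 - head c) => n.
elim: n c hn => [|n IH] c hn rc sc.
  by have := reachable_head rc; lia.
have hs := reachable_head rc.
have := inv_reachable rc; rewrite /inv sc => -[m [t [j [T _ [pt tw] [hj jm] _]]]].
have pw : cinput c <= (size w).+1 by rewrite pt.
have := tape_is_cell T (jm : j.+1 <= m.+1); rewrite ltnn; case: ltnP => [jm'|mj]; rewrite -hj => ck.
  case b: (bit t j) ck => ck.
    have := rule_carry (scan w (cinput c)).
    rewrite -ck -{1}sc => /step_rule[c' [st sc' pc' _ hc']].
    have [|c2 [rc2 sc2 pc2]] := IH c' _ (reachable_step rc st) sc'.
      by rewrite hc' subnS hn.
    by exists c2; rewrite pc2 pc' move_in_stay.
  have := rule_set (scan w (cinput c)).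
  rewrite -ck -{1}sc => /step_rule[c' [st sc' pc' _ hc']].
  by exists c'; rewrite sc' pc' move_in_stay //; split=> //; apply: reachable_step st.
have := rule_extend (scan w (cinput c)).
rewrite -ck -{1}sc => /step_rule[c' [st sc' pc' _ hc']].
by exists c'; rewrite sc' pc' move_in_stay //; split=> //; apply: reachable_step st.
Qed.

Lemma reach_counted w p : p <= (size w).+1 -> exists c : conf,
  [/\ reachable w c, cstate c = CountRewind, cinput c = p & head c = 0].
Proof.
elim: p => [_|p IH pw].
  have ri : reachable w (init compiled) by apply: rt_refl.
  have [c' [st sc' pc' _ hc']] := step_rule (rule_boot (scan w 0) : rule (cstate (init compiled))
     (scan w (cinput (init compiled))) (tape (init compiled) (head (init compiled))) _ _ _ _).
  exists c'; rewrite sc' pc' hc'; split=> //; exact: reachable_step st.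
have [c [rc sc pc hc]] := IH (ltnW pw).
have := inv_reachable rc; rewrite /inv sc => -[m [[T0 _ _ _] _ _ _]].
have xe : scan w (cinput c) <> RightEnd.
  by move=> /scan_end; rewrite pc => /(_ (ltnW pw)) pe; rewrite pe ltnn in pw.
have := rule_count_next xe.
rewrite -T0 -{1}hc -{1}sc => /step_rule[c1 [st sc1 pc1 _ _]].
have [c2 [rc2 sc2 pc2]] := reach_carried (reachable_step rc st) sc1.
have [c3 [rc3 sc3 pc3 hc3]] := reach_rewound rc2 sc2.
exists c3; split=> //; rewrite pc3 pc2 pc1 pc /move_in /=; exact/minn_idPl.
Qed.

Lemma reach_start w : exists2 c : conf, reachable w c & cstate c = Node start_node.
Proof.
have [c [rc sc pc hc]] := reach_counted (leqnn (size w).+1).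
have := inv_reachable rc; rewrite /inv sc => -[m [[T0 _ _ _] _ _ _]].
have sE : scan w (cinput c) = RightEnd by rewrite pc /= onth_default.
have := rule_count_end; rewrite -T0 -{1}hc -sE -{1}sc.
move=> /step_rule[c1 [/(reachable_step rc) {}rc sc1 _ _ _]].
move: c1 rc sc1 {c sc pc hc sE T0 m} => c rc sc.
move hn : (4 * (trunc_log 2 (size w)).+1 - head c) => n.
elim: n c hn rc sc => [|n IH] c hn rc sc.
  by have := reachable_head rc; lia.
have hs := reachable_head rc.
have := inv_reachable rc; rewrite /inv sc => -[m [T _ /andP[h0 hm] pw]].
have [j hj] : exists j, head c = j.+1 by case: (head c) h0 => // j; exists j.
have := tape_is_cell T hm; rewrite {2}hj; case: ltnP => [jm|mj] ck.
  have := rule_done (scan w (cinput c)) (count_column (cinput c) j).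
  rewrite -ck -{1}sc => /step_rule[c' [st sc' _ _ hc']].
  apply: (IH c' _ (reachable_step rc st) sc').
  by rewrite hc' subnS hn.
have := rule_mark (scan w (cinput c)).
rewrite -ck -{1}sc => /step_rule[c' [st sc' _ _ hc']].
by exists c' => //; apply: reachable_step st.
Qed.

Definition at_node e (q : Q) (x : nat * regs e I) (c : conf) :=
  [/\ cstate c = Node q, cinput c = x.1 /\ x.1 <= (size (word e)).+1,
      tape_is (tape c) (bits e) (column x.2) RMark & head c <= (bits e).+1].

Lemma node_rewound e q (x : nat * regs e I) (c : conf) :
  reachable (word e) c -> at_node q x c ->
  exists c' : conf, [/\ reachable (word e) c', at_node q x c' & head c' = 0].
Proof.
move hn : (head c) => n; elim: n c hn => [|n IH] c hn rc ac; first by exists c.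
have [sc [pc pw] T hm] := ac.
have gl : tape c (head c) <> LMark.
  by rewrite (tape_is_cell T hm) hn; case: ltnP.
have := rule_rewind q (scan (word e) (cinput c)) gl.
rewrite -sc => /step_rule[c' [st sc' pc' tc' hc']].
apply: (IH c' _ (reachable_step rc st)); first by rewrite hc' hn.
split; rewrite ?sc' ?pc' ?hc' ?pc ?move_in_stay //=; last lia.
by apply: tape_is_ext T _ _ => // i; rewrite tc'; case: eqP => // ->.
Qed.

(** Once the target [v'] and the position [l] are known, no choice is left: at column [j] the
    comparison of [j] with [l] selects the rule. The induction is on the number of columns still to
    be rewritten. *)
Lemma pass_done e q q' a1 a2 a3 (v v' : regs e I) l (c : conf) j k :
  reachable (word e) c -> lab q q' = Sweep a1 a2 a3 -> l < bits e ->
  (forall i, i < bits e -> fits a1 a2 a3 l i (column v i) (column v' i)) ->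
  j <= bits e -> cstate c = Pass q q' (l < j) ->
  cinput c <= (size (word e)).+1 -> head c = j.+1 ->
  tape_is (tape c) (bits e) k RMark ->
  (forall i, i < bits e -> k i = column (if i < j then v' else v) i) ->
  exists2 c' : conf, reachable (word e) c' & at_node q' (cinput c, v') c'.
Proof.
move=> + lq lm vv'; move hd : (bits e - j) => d.
elim: d j c k hd => [|d IH] j c k hd rc jm sc pw hj T kv.
  have jE : j = bits e by lia.
  subst j; rewrite lm in sc; have := rule_pass_end q q' (scan (word e) (cinput c)).
  have -> : RMark = tape c (head c) by rewrite (tape_is_cell T) hj // ltnn.
  rewrite -sc => /step_rule[c' [st sc' pc' tc' hc']].
  exists c'; first exact: reachable_step st.
  split; rewrite ?sc' ?pc' ?hc' ?hj ?move_in_stay //=.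
  apply: tape_is_ext T _ _ => // [i|i im]; last by rewrite kv // im.
  by rewrite tc'; case: eqP => // ->.
have jm' : j < bits e by lia.
have ck : tape c (head c) = Col (column v j).
  by rewrite (tape_is_cell T) hj // jm' kv // ltnn.
have vj := vv' j jm'.
have next b : rule (cstate c) (scan (word e) (cinput c)) (tape c (head c))
    (Pass q q' b) MStay (Col (column v' j)) MRight -> b = (l < j.+1) ->
  exists2 c' : conf, reachable (word e) c' & at_node q' (cinput c, v') c'.
  move=> /step_rule[c' [st sc' pc' tc' hc']] bE; rewrite hj in tc' hc'.
  have pE : cinput c' = cinput c by rewrite pc' move_in_stay.
  rewrite -pE; apply: (IH j.+1 c' _ _ (reachable_step rc st) jm').
  - by lia.
  - by rewrite sc' bE.
  - by rewrite pE.
  - by rewrite hc'.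
  - exact: tape_is_set T jm' tc'.
  move=> i im /=; case: eqP => [->|/eqP ij]; first by rewrite ltnSn.
  by rewrite kv // ltnS [i <= j]leq_eqVlt (negbTE ij).
rewrite sc ck in next; move: vj; rewrite /fits; case: ltngtP => [jl|lj|jl] a.
- by rewrite ltnNge (ltnW jl) in next; apply: next (rule_pass1 _ lq a) _; lia.
- by rewrite lj in next; apply: next (rule_pass3 _ lq a) _; lia.
- by rewrite jl ltnn in next; rewrite -jl in a next; apply: next (rule_pass2 _ lq a) _; lia.
Qed.

Lemma node_step e q q' (x y : nat * regs e I) (c : conf) :
  reachable (word e) c -> at_node q x c -> op_sem (lab q q') x y ->
  exists2 c' : conf, reachable (word e) c' & at_node q' y c'.
Proof.
move=> rc0 ac0; have [{c rc0 ac0}c [rc ac hc]] := node_rewound rc0 ac0.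
have [sc [pc pw] T _] := ac.
have ck : tape c (head c) = LMark by rewrite hc; case: T.
case lq: (lab q q') => [s m|a1 a2 a3] /=.
  move=> [sx ->]; have := rule_input lq sx; rewrite -pc -ck -sc.
  move=> /step_rule[c' [st sc' pc' tc' hc']].
  exists c'; first exact: reachable_step st.
  split; rewrite ?sc' ?pc' ?hc' ?hc //=; first by rewrite pc move_in_le.
  by apply: tape_is_ext T _ _ => // i; rewrite tc'; case: eqP => // ->.
case: y => p v' /= [-> [l lm vv']].
have := rule_pass (scan (word e) (cinput c)) lq; rewrite -{1}ck -sc.
move=> /step_rule[c' [st sc' pc' tc' hc']].
have pE : cinput c' = x.1 by rewrite pc' pc move_in_stay.
rewrite -pE; apply: (pass_done (j := 0) (reachable_step rc st) lq lm vv') => //.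
- by rewrite pE.
- by rewrite hc' hc.
- by apply: tape_is_ext T _ _ => // i; rewrite tc'; case: eqP => // ->.
Qed.

Lemma node_run e (a b : Q * (nat * regs e I)) (c : conf) :
  reachable (word e) c -> at_node a.1 a.2 c -> run lab a b ->
  exists2 c' : conf, reachable (word e) c' & at_node b.1 b.2 c'.
Proof.
move=> rc ac ab.
pose I' (a : Q * (nat * regs e I)) :=
  exists2 c' : conf, reachable (word e) c' & at_node a.1 a.2 c'.
apply: (rtc_inv (P := I') _ _ ab).
  by move=> a' b' [c' rc' ac'] ab'; apply: node_step rc' ac' ab'.
by exists c.
Qed.

(** Asking for the equivalence at every head position and all register contents frees programs from
    knowing what the counting phase leaves behind. *)
Theorem NL_of_program (L : seq symbol -> Prop) :
  (forall e p v, p <= (size (word e)).+1 ->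
     L (word e) <-> exists y, run lab (e := e) (start_node, (p, v)) (end_node, y)) ->
  NL L.
Proof.
move=> HL; exists compiled, 4; split=> w.
  by move=> c /inv_reachable/inv_space.
split=> [Lw|[c rc /eqP sc]].
  have [c rc sc] := reach_start w.
  have := inv_reachable rc; rewrite /inv sc => -[e [_ [v [we _ [hm pw] _ T]]]].
  subst w; have [y ry] := (HL e (cinput c) v pw).1 Lw.
  have [|c' rc' [sc' _ _ _]] := node_run rc _ ry; first by split.
  by exists c' => //; apply/eqP.
have := inv_reachable rc; rewrite /inv sc => -[e [v0 [v [we _ _ rv _]]]].
by subst w; apply/(HL e _ v0 (leqnn _)); exists (cinput c, v).
Qed.

End Compile.

Notation mem e I := (nat * regs e I)%type.

Lemma bits_gt0 e : 0 < bits e.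
Proof. by case: e => w [|m] //=; rewrite expn0. Qed.

(** * Relations and predicates verifiable in nondeterministic log space *)

(** The graph is chosen before the environment: one program serves all inputs and all register
    lengths. *)
Definition impl I (R : forall e, mem e I -> mem e I -> Prop) : Prop :=
  exists (Q : finType) (s f : Q) (lab : Q -> Q -> op I),
    forall e (x y : mem e I), R e x y <-> run lab (s, x) (f, y).

Lemma impl_ext I (R R' : forall e, mem e I -> mem e I -> Prop) :
  impl R -> (forall e x y, R e x y <-> R' e x y) -> impl R'.
Proof.
move=> [Q [s [f [lab RE]]]] RR; exists Q, s, f, lab => e x y.
by rewrite -RR; apply: RE.
Qed.

Lemma impl_in_range I R e x y : @impl I R -> R e x y ->
  x.1 <= (size (word e)).+1 -> y.1 <= (size (word e)).+1.
Proof.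
move=> [Q [s [f [lab RE]]]] /RE rxy xw.
apply: (rtc_inv (P := fun z => z.2.1 <= (size (word e)).+1) _ _ rxy) => //.
move=> [q [p v]] [q' [p' v']]; rewrite /run_step /=; case: (lab q q') => /= [sc m|a b c].
  by move=> _ [_ [-> _]]; rewrite move_in_le.
by move=> pw [-> _].
Qed.

Lemma fits_same I (a : rel (column_type I)) j i : fits a a a j i = a.
Proof. by rewrite /fits; case: ifP => //; case: ifP. Qed.

Definition fail I : op I := Input I pred0 MStay.

(* An input stay would not do: it clips out-of-range positions of the input head. *)
Definition skip I : op I :=
  let same : rel (column_type I) := fun c c' => c == c' in Sweep same same same.

Lemma skipE e I (x y : mem e I) : op_sem (skip I) x y <-> y = x.
Proof.
split=> [[/= p [j jm H]]|->].
  case: x y p H => [p v] [p' v'] /= -> H; congr pair; apply: column_inj => i im.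
  by have := H i im; rewrite fits_same => /eqP.
split=> //; exists 0; first exact: bits_gt0.
by move=> i im; rewrite fits_same.
Qed.

Lemma impl_op I (o : op I) : impl (fun e => @op_sem e I o).
Proof.
exists bool, false, true, (fun a b => if ~~ a && b then o else fail I) => e x y.
split=> [xy|]; first exact: rt_step.
pose P (z : bool * mem e I) := if z.1 then op_sem o x z.2 else z.2 = x.
move=> rxy; apply: (rtc_inv (P := P) _ _ rxy) => //.
by move=> [[] a] [[] b]; rewrite /P /run_step /=; try (by move=> _ []); move=> ->.
Qed.

Definition comp_rel I (R1 R2 : forall e, mem e I -> mem e I -> Prop) e x y :=
  exists2 z, R1 e x z & R2 e z y.

Lemma impl_seq I (R1 R2 : forall e, mem e I -> mem e I -> Prop) :
  impl R1 -> impl R2 -> impl (comp_rel R1 R2).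
Proof.
move=> [Q1 [s1 [f1 [lab1 E1]]]] [Q2 [s2 [f2 [lab2 E2]]]].
pose lab (a b : Q1 + Q2) : op I := match a, b with
  | inl a, inl b => lab1 a b | inr a, inr b => lab2 a b
  | inl a, inr b => if (a == f1) && (b == s2) then skip I else fail I
  | inr _, inl _ => fail I end.
exists (Q1 + Q2)%type, (inl s1), (inr f2), lab => e x y; split=> [[z /E1 xz /E2 zy]|].
  apply: rtc_trans (_ : rtc _ (inl f1, z) _).
    apply: (rtc_map (f := fun q : Q1 * mem e I => (inl q.1, q.2) : (Q1 + Q2) * _) _ xz) => a b ab.
    exact: rt_step.
  apply: rtc_cons (_ : rtc _ (inr s2, z) _).
    by rewrite /run_step /= !eqxx; apply/skipE.
  apply: (rtc_map (f := fun q : Q2 * mem e I => (inr q.1, q.2) : (Q1 + Q2) * _) _ zy) => a b ab.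
  exact: rt_step.
pose P (z : (Q1 + Q2) * mem e I) := match z.1 with
  | inl q => run lab1 (s1, x) (q, z.2)
  | inr q => exists2 u, R1 e x u & run lab2 (s2, u) (q, z.2) end.
move=> rxy; suff: P (inr f2, y) by move=> [z xz /E2 zy]; exists z.
apply: (rtc_inv (P := P) _ _ rxy); last exact: rt_refl.
move=> [[q|q] a] [[q'|q'] b]; rewrite /P /run_step //=.
- by move=> r ab; apply: rtc_rcons r _.
- case: andP => [[/eqP-> /eqP->]|_] r //; last by case.
  by move=> /skipE->; exists a; [apply/E1|apply: rt_refl].
- by move=> _ [].
- by move=> [u xu r] ab; exists u => //; apply: rtc_rcons r _.
Qed.

Lemma impl_alt I (R1 R2 : forall e, mem e I -> mem e I -> Prop) :
  impl R1 -> impl R2 -> impl (fun e x y => R1 e x y \/ R2 e x y).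
Proof.
move=> [Q1 [s1 [f1 [lab1 E1]]]] [Q2 [s2 [f2 [lab2 E2]]]].
pose lab (a b : bool + (Q1 + Q2)) : op I := match a, b with
  | inr (inl a), inr (inl b) => lab1 a b | inr (inr a), inr (inr b) => lab2 a b
  | inl false, inr (inl b) => if b == s1 then skip I else fail I
  | inl false, inr (inr b) => if b == s2 then skip I else fail I
  | inr (inl a), inl true => if a == f1 then skip I else fail I
  | inr (inr a), inl true => if a == f2 then skip I else fail I
  | _, _ => fail I end.
exists (bool + (Q1 + Q2))%type, (inl false), (inl true), lab => e x y; split.
  case=> [/E1 xy|/E2 xy].
    apply: rtc_cons (_ : rtc _ (inr (inl s1), x) _).
      by rewrite /run_step /= eqxx; apply/skipE.
    apply: rtc_trans (_ : rtc _ (inr (inl f1), y) _); last first.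
      by apply: rt_step; rewrite /run_step /= eqxx; apply/skipE.
    apply: (rtc_map (f := fun q : Q1 * mem e I => (inr (inl q.1), q.2) : (bool + (Q1 + Q2)) * _) _ xy) => a b ab.
    exact: rt_step.
  apply: rtc_cons (_ : rtc _ (inr (inr s2), x) _).
    by rewrite /run_step /= eqxx; apply/skipE.
  apply: rtc_trans (_ : rtc _ (inr (inr f2), y) _); last first.
    by apply: rt_step; rewrite /run_step /= eqxx; apply/skipE.
  apply: (rtc_map (f := fun q : Q2 * mem e I => (inr (inr q.1), q.2) : (bool + (Q1 + Q2)) * _) _ xy) => a b ab.
  exact: rt_step.
pose P (z : (bool + (Q1 + Q2)) * mem e I) := match z.1 with
  | inr (inl q) => run lab1 (s1, x) (q, z.2)
  | inr (inr q) => run lab2 (s2, x) (q, z.2)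
  | inl false => z.2 = x
  | inl true => R1 e x z.2 \/ R2 e x z.2 end.
move=> rxy; apply: (rtc_inv (P := P) _ _ rxy) => //.
move=> [[[]|[q|q]] a] [[[]|[q'|q']] b]; rewrite /P /run_step //=; try by move=> _ [].
- by move=> ->; case: eqP => [->|_ []//] /skipE->; apply: rt_refl.
- by move=> ->; case: eqP => [->|_ []//] /skipE->; apply: rt_refl.
- by case: eqP => [->|_ _ []//] r /skipE->; left; apply/E1.
- by move=> r ab; apply: rtc_rcons r _.
- by case: eqP => [->|_ _ []//] r /skipE->; right; apply/E2.
- by move=> r ab; apply: rtc_rcons r _.
Qed.

(** The added node [None] is both entry and exit, so a run consists of complete iterations and
    possibly an unfinished one; [P] records exactly this. *)
Lemma impl_star I (R : forall e, mem e I -> mem e I -> Prop) :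
  impl R -> impl (fun e => rtc (R e)).
Proof.
move=> [Q [s [f [lab RE]]]].
pose lab' (a b : option Q) : op I := match a, b with
  | Some a, Some b => lab a b
  | None, Some b => if b == s then skip I else fail I
  | Some a, None => if a == f then skip I else fail I
  | None, None => fail I end.
exists (option Q), None, None, lab' => e x y; split.
  apply: rtc_map => {x y} x y /RE xy.
  apply: rtc_cons (_ : rtc _ (Some s, x) _).
    by rewrite /run_step /= eqxx; apply/skipE.
  apply: rtc_trans (_ : rtc _ (Some f, y) _); last first.
    by apply: rt_step; rewrite /run_step /= eqxx; apply/skipE.
  apply: (rtc_map (f := fun q : Q * mem e I => (Some q.1, q.2)) _ xy) => a b ab.
  exact: rt_step.
pose P (z : option Q * mem e I) := match z.1 with
  | Some q => exists2 u, rtc (R e) x u & run lab (s, u) (q, z.2)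
  | None => rtc (R e) x z.2 end.
move=> rxy; apply: (rtc_inv (P := P) _ _ rxy); last exact: rt_refl.
move=> [[q|] a] [[q'|] b]; rewrite /P /run_step //=.
- by move=> [u xu r] ab; exists u => //; apply: rtc_rcons r _.
- case: eqP => [->|_ _ []//] [u xu r] /skipE->.
  by apply: rtc_rcons xu _; apply/RE.
- by case: eqP => [->|_ _ []//] r /skipE->; exists a => //; apply: rt_refl.
- by move=> _ [].
Qed.

(** * Running a program on some of the registers *)

Section Rename.

Variables (I J : finType) (f : I -> J).

Definition restrict e (v : regs e J) : regs e I := [ffun i => v (f i)].

Definition rel_ren (a : rel (column_type I)) : rel (column_type J) := fun c c' =>
  a [ffun i => c (f i)] [ffun i => c' (f i)] &&
  [forall j, (j \notin codom f) ==> (c' j == c j)].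

Definition op_ren (o : op I) : op J := match o with
  | Input s m => Input J s m
  | Sweep a b c => Sweep (rel_ren a) (rel_ren b) (rel_ren c) end.

Definition framed e (R : mem e I -> mem e I -> Prop) (x y : mem e J) :=
  R (x.1, restrict x.2) (y.1, restrict y.2) /\
  forall j, j \notin codom f -> y.2 j = x.2 j.

Lemma column_restrict e (v : regs e J) i :
  column (restrict v) i = [ffun r => column v i (f r)].
Proof. by apply/ffunP=> r; rewrite !ffunE. Qed.

Lemma restrict_inj e (v v' : regs e J) : restrict v = restrict v' ->
  (forall j, j \notin codom f -> v j = v' j) -> v = v'.
Proof.
move=> /ffunP vv fr; apply/ffunP=> j; case: (boolP (j \in codom f)) => [|/fr//].
by case/codomP=> i ->; have := vv i; rewrite !ffunE.
Qed.

Lemma op_renE e o (x y : mem e J) :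
  op_sem (op_ren o) x y <-> framed (@op_sem e I o) x y.
Proof.
case: x y => [p v] [p' v']; case: o => [s m|a b c]; rewrite /framed /=.
  split=> [[sx [-> ->]]|[[sx [-> vv]] fr]]; first by split.
  by split=> //; congr pair; apply: restrict_inj.
have fitsE j i : fits (rel_ren a) (rel_ren b) (rel_ren c) j i
    = rel_ren (fits a b c j i).
  by rewrite /fits; case: ifP => _ //; case: ifP.
split=> [[-> [j jm H]]|[[-> [j jm H]] fr]].
  split=> [|r rf].
    split=> //; exists j => // i im.
    by have := H i im; rewrite fitsE => /andP[]; rewrite -!column_restrict.
  apply/val_inj/(@bit_ext (bits e)) => //= i im.
  have := H i im; rewrite fitsE => /andP[_ /forallP/(_ r)].
  by rewrite rf !ffunE => /eqP.
split=> //; exists j => // i im; rewrite fitsE; apply/andP; split.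
  by rewrite -!column_restrict; apply: H.
by apply/forallP=> r; apply/implyP=> /fr vr; rewrite !ffunE vr.
Qed.

Definition extend e (v : regs e J) (u : regs e I) : regs e J :=
  [ffun j => if [pick i | f i == j] is Some i then u i else v j].

Hypothesis f_inj : injective f.

Lemma restrict_extend e (v : regs e J) u : restrict (extend v u) = u.
Proof.
apply/ffunP=> i; rewrite !ffunE; case: pickP => [i' /eqP/f_inj->//|/(_ i)].
by rewrite eqxx.
Qed.

Lemma extend_frame e (v : regs e J) u j : j \notin codom f -> extend v u j = v j.
Proof.
move=> jf; rewrite ffunE; case: pickP => // i /eqP fi.
by rewrite -fi codom_f in jf.
Qed.

(** A run on the small register set is lifted by writing its registers over those of [x];
    injectivity of [f] makes [restrict] recover them. *)
Lemma impl_ren (R : forall e, mem e I -> mem e I -> Prop) :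
  impl R -> impl (fun e => framed (R e)).
Proof.
move=> [Q [s [q [lab RE]]]].
exists Q, s, q, (fun a b => op_ren (lab a b)) => e x y; split.
  move=> [/RE rxy fr].
  pose g (z : Q * mem e I) : Q * mem e J := (z.1, (z.2.1, extend x.2 z.2.2)).
  have {1}-> : (s, x) = g (s, (x.1, restrict x.2)).
    rewrite /g /=; congr pair; case: (x) => p v; congr pair.
    by apply: restrict_inj => [|j jf]; rewrite ?restrict_extend ?extend_frame.
  have -> : (q, y) = g (q, (y.1, restrict y.2)).
    rewrite /g /=; congr pair; case: (y) fr => p v /= fr; congr pair.
    by apply: restrict_inj => [|j jf]; rewrite ?restrict_extend ?extend_frame ?fr.
  apply: rtc_map rxy => a b ab; apply: rt_step.
  apply/op_renE; split; rewrite /= ?restrict_extend; last first.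
    by move=> j jf; rewrite !extend_frame.
  by move: ab; rewrite /run_step; case: (a.2) (b.2) => [? ?] [? ?].
pose P (z : Q * mem e J) :=
  run lab (s, (x.1, restrict x.2)) (z.1, (z.2.1, restrict z.2.2)) /\
  forall j, j \notin codom f -> z.2.2 j = x.2 j.
move=> rxy; suff: P (q, y) by case=> /= r fr; split=> //; apply/RE.
apply: (rtc_inv (P := P) _ _ rxy); last by split=> //; apply: rt_refl.
move=> [a u] [b v] [r fr] /op_renE [/= ab fr']; split=> [|j jf]; last first.
  by rewrite -fr // -fr'.
by apply: rtc_rcons r _.
Qed.

End Rename.

(** * Elementary register operations *)

Section Ops.

Variable I : finType.

(** A register with [g i = None] receives an arbitrary value, so the same operation copies and
    guesses. *)
Definition assign (g : I -> option I) : op I :=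
  let r : rel (column_type I) :=
    fun c c' => [forall i, if g i is Some j then c' i == c j else true] in
  Sweep r r r.

Lemma assignE e g (x y : mem e I) : op_sem (assign g) x y <->
  y.1 = x.1 /\ forall i j, g i = Some j -> y.2 i = x.2 j.
Proof.
split=> [[/= p [l lm H]]|[p H]].
  split=> // i j gij; apply/val_inj/(@bit_ext (bits e)) => //= k km.
  have := H k km; rewrite fits_same => /forallP/(_ i).
  by rewrite gij !ffunE => /eqP.
split=> //; exists 0; first exact: bits_gt0.
move=> k km; rewrite fits_same; apply/forallP=> i.
by case gi: (g i) => [j|//]; rewrite !ffunE (H _ _ gi).
Qed.

Definition test (a b c : pred (column_type I)) : op I :=
  let keep (d : pred _) : rel (column_type I) := fun k k' => (k' == k) && d k in
  Sweep (keep a) (keep b) (keep c).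

Lemma testE e a b c (x y : mem e I) : op_sem (test a b c) x y <->
  y = x /\ exists2 j, j < bits e & forall i, i < bits e ->
    (if i < j then a else if i == j then b else c) (column x.2 i).
Proof.
rewrite /= /fits; split=> [[p [j jm H]]|[-> [j jm H]]].
  split; last first.
    exists j => // i im; have := H i im.
    by case: ifP => _; [|case: ifP => _] => /andP[].
  case: x y p H => [p v] [p' v'] /= -> H; congr pair; apply: column_inj => i im.
  by have := H i im; case: ifP => _; [|case: ifP => _] => /andP[/eqP].
split=> //; exists j => // i im; have := H i im.
by case: ifP => _; [|case: ifP => _] => ->; rewrite eqxx.
Qed.

Definition check a := test a a a.

Lemma checkE e a (x y : mem e I) : op_sem (check a) x y <->
  y = x /\ forall i, i < bits e -> a (column x.2 i).
Proof.
rewrite testE; split=> [[-> [j _ H]]|[-> H]]; split=> //.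
  by move=> i /H; case: ifP => //; case: ifP.
exists 0; first exact: bits_gt0.
by move=> i /H; case: ifP => //; case: ifP.
Qed.

Lemma check_eqE e i j (x y : mem e I) :
  op_sem (check (fun c => c i == c j)) x y <-> y = x /\ x.2 i = x.2 j.
Proof.
rewrite checkE; split=> -[-> H]; (split; first by []); last first.
  by move=> k km; rewrite !ffunE H.
apply/val_inj/(@bit_ext (bits e)) => //= k km.
by have := H k km; rewrite !ffunE => /eqP.
Qed.

Lemma check_zeroE e i (x y : mem e I) :
  op_sem (check (fun c => ~~ c i)) x y <-> y = x /\ x.2 i = 0 :> nat.
Proof.
rewrite checkE; split=> -[-> H]; (split; first by []); last first.
  by move=> k km; rewrite !ffunE H bit_zero.
apply/(@bit_ext (bits e)) => //= [|k km]; first by rewrite expn_gt0.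
by have := H k km; rewrite !ffunE bit_zero => /negbTE.
Qed.

Lemma check_lastE e i (x y : mem e I) :
  op_sem (check (fun c => c i)) x y <-> y = x /\ (x.2 i).+1 = 2 ^ bits e.
Proof.
rewrite checkE; split=> -[-> H]; (split; first by []); last first.
  have {}H : x.2 i = (2 ^ bits e).-1 :> nat by apply: (congr1 predn H).
  by move=> k km; rewrite ffunE H bit_ones.
suff -> : x.2 i = (2 ^ bits e).-1 :> nat by rewrite prednK // expn_gt0.
apply/(@bit_ext (bits e)) => //= [|k km]; first by rewrite prednK // expn_gt0.
by have := H k km; rewrite !ffunE bit_ones.
Qed.

(** The three predicates are the three cases of [bit_succ]. *)
Definition test_succ i j : op I :=
  test (fun c => c i && ~~ c j) (fun c => ~~ c i && c j) (fun c => c i == c j).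

Lemma test_succE e i j (x y : mem e I) :
  op_sem (test_succ i j) x y <-> y = x /\ x.2 j = (x.2 i).+1 :> nat.
Proof.
rewrite testE; split=> -[-> H]; (split; first by []).
  apply/(@bit_succ (bits e)) => //; case: H => l lm H; exists l => // k km.
  by have := H k km; case: ifP => _; [|case: ifP => _]; rewrite !ffunE.
have [||/(_ H)[l lm {}H] _] := @bit_succ (bits e) (x.2 i) (x.2 j) => //.
exists l => // k km; have := H k km.
by case: ifP => _; [|case: ifP => _]; rewrite !ffunE.
Qed.

End Ops.

(* The tuples over which predicates range: each leaf is one register. *)
Inductive ty := Reg | Pair of ty & ty.

Fixpoint den (e : env) (t : ty) : finType :=
  match t with Reg => dom e | Pair a b => (den e a * den e b)%type end.

Fixpoint idx (t : ty) : finType :=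
  match t with Reg => unit | Pair a b => (idx a + idx b)%type end.

Definition p1 e a b (x : den e (Pair a b)) : den e a := x.1.
Definition p2 e a b (x : den e (Pair a b)) : den e b := x.2.
Definition pr e a b (x : den e a) (y : den e b) : den e (Pair a b) := (x, y).

Fixpoint reg e t : den e t -> idx t -> dom e :=
  match t with
  | Reg => fun x _ => x
  | Pair a b => fun x i => match i with
      | inl i => reg x.1 i
      | inr i => reg x.2 i end
  end.

Fixpoint unreg e t : (idx t -> dom e) -> den e t :=
  match t with
  | Reg => fun u => u tt
  | Pair a b => fun u => (unreg (fun i => u (inl i)), unreg (fun i => u (inr i)))
  end.

Lemma unregK e t (u : idx t -> dom e) : reg (unreg u) =1 u.
Proof. by elim: t u => [|a IHa b IHb] u; [case|case=> i /=; rewrite ?IHa ?IHb]. Qed.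

Lemma eq_unreg e t (u u' : idx t -> dom e) : u =1 u' -> unreg u = unreg u'.
Proof.
elim: t u u' => [|a IHa b IHb] u u' uu /=; first exact: uu.
by congr pair; [apply: IHa|apply: IHb] => i; apply: uu.
Qed.

Lemma regK e t (x : den e t) : unreg (reg x) = x.
Proof.
elim: t x => [//|a IHa b IHb] [x y] /=.
by rewrite -[x in RHS]IHa -[y in RHS]IHb.
Qed.

Definition read e t I (v : regs e I) (f : idx t -> I) : den e t :=
  unreg (fun i => v (f i)).

Lemma eq_read e t I J (v : regs e I) (v' : regs e J) (f : idx t -> I) (g : idx t -> J) :
  (forall i, v (f i) = v' (g i)) -> read v f = read v' g.
Proof. exact: eq_unreg. Qed.

Definition in_range e I (x : mem e I) := x.1 <= (size (word e)).+1.

(* [J] indexes scratch registers, whose initial contents, like the initial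
   position of the input head, are arbitrary. *)
Definition definable t (Q : forall e, den e t -> Prop) : Prop :=
  exists (J : finType) (R : forall e, mem e (idx t + J)%type -> mem e (idx t + J)%type -> Prop),
  [/\ impl R,
      forall e x y, R e x y -> forall i, y.2 (inl i) = x.2 (inl i)
    & forall e x, in_range x -> Q e (read x.2 inl) <-> exists y, R e x y].

Lemma def_ext t (Q Q' : forall e, den e t -> Prop) :
  definable Q -> (forall e x, Q e x <-> Q' e x) -> definable Q'.
Proof.
move=> [J [R [iR fR sR]]] QQ; exists J, R; split=> // e x xr.
by rewrite -QQ; apply: sR.
Qed.

Lemma def_op t (Q : forall e, den e t -> Prop) (o : op (idx t + void)%type) :
  (forall e (x y : mem e (idx t + void)%type),
     op_sem o x y <-> y = x /\ Q e (read x.2 inl)) -> definable Q.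
Proof.
move=> oE; exists void, (fun e => @op_sem e _ o); split; first exact: impl_op.
  by move=> e x y /oE[->].
move=> e x xr; split=> [q|[y /oE[]//]]; by exists x; apply/oE.
Qed.

Definition nat_of e (x : den e Reg) : nat := nat_of_ord x.

Lemma def_eq0 : @definable (Pair Reg Reg) (fun e x => p1 x = p2 x).
Proof.
apply: (def_op (t := Pair Reg Reg) (o := check (fun c => c (inl (inl tt)) == c (inl (inr tt))))) => e x y.
exact: check_eqE.
Qed.

Lemma def_zero0 : @definable Reg (fun e x => nat_of x = 0).
Proof. apply: (def_op (t := Reg) (o := check (fun c => ~~ c (inl tt)))) => e x y.
exact: check_zeroE. Qed.

Lemma def_last0 : @definable Reg (fun e x => (nat_of x).+1 = 2 ^ bits e).
Proof. apply: (def_op (t := Reg) (o := check (fun c => c (inl tt)))) => e x y.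
exact: check_lastE. Qed.

Lemma def_succ0 : @definable (Pair Reg Reg) (fun e x => nat_of (p2 x) = (nat_of (p1 x)).+1).
Proof.
apply: (def_op (t := Pair Reg Reg) (o := test_succ (inl (inl tt)) (inl (inr tt)))) => e x y.
exact: test_succE.
Qed.

(** * Subroutine calls and closure under the connectives *)

Section Call.

Variables (t : ty) (J K : finType) (Q : forall e, den e t -> Prop).
Variable R : forall e, mem e (idx t + J)%type -> mem e (idx t + J)%type -> Prop.
Hypothesis frameR : forall e x y, @R e x y -> forall i, y.2 (inl i) = x.2 (inl i).
Hypothesis specR : forall e x, in_range x -> @Q e (read x.2 inl) <-> exists y, @R e x y.
Variable h : (idx t + J)%type -> K.
Hypothesis h_inj : injective h.

(** A definable predicate tolerates any scratch contents and any head position in range, so its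
    program can be called in the middle of another one without preparation. *)
Lemma call_spec e (x : mem e K) : in_range x ->
  @Q e (read x.2 (h \o inl)) <-> exists y, framed h (@R e) x y.
Proof.
move=> xr; have := @specR e (x.1, restrict h x.2) xr.
have -> : read (restrict h x.2) inl = read x.2 (h \o inl) :> den e t.
  by apply: eq_read => i; rewrite ffunE.
move=> ->; split=> [[[p v] rxy]|[y [rxy _]]]; last by eexists; exact: rxy.
exists (p, extend h x.2 v); split=> [|j jf] /=; last exact: extend_frame.
by rewrite restrict_extend.
Qed.

Lemma call_frame e (x y : mem e K) : framed h (@R e) x y ->
  forall j, (forall k, h (inr k) <> j) -> y.2 j = x.2 j.
Proof.
move=> [rxy fr] j jh; case: (boolP (j \in codom h)) => [|/fr//].
case/codomP=> -[i|k] jE; last by case: (jh k).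
by have := frameR rxy i; rewrite !ffunE -jE.
Qed.

End Call.

Definition sum_map A B C D' (f : A -> C) (g : B -> D') (x : A + B) : C + D' :=
  match x with inl a => inl (f a) | inr b => inr (g b) end.

Lemma sum_map_inj A B C D' (f : A -> C) (g : B -> D') :
  injective f -> injective g -> injective (sum_map f g).
Proof. by move=> fi gi [a|b] [a'|b'] //= [] => [/fi->|/gi->]. Qed.

(** The programs run in succession with separate scratch registers. The first preserves the argument
    and keeps the head in range, so the specification of the second applies. *)
Lemma def_and t (Q1 Q2 : forall e, den e t -> Prop) :
  definable Q1 -> definable Q2 -> definable (fun e x => Q1 e x /\ Q2 e x).
Proof.
move=> [J1 [R1 [iR1 fR1 sR1]]] [J2 [R2 [iR2 fR2 sR2]]].
pose h1 : (idx t + J1)%type -> (idx t + (J1 + J2))%type := sum_map id inl.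
pose h2 : (idx t + J2)%type -> (idx t + (J1 + J2))%type := sum_map id inr.
have i1 : injective h1 by apply: sum_map_inj => // ? ? [].
have i2 : injective h2 by apply: sum_map_inj => // ? ? [].
exists (J1 + J2)%type, (comp_rel (fun e => framed h1 (R1 e)) (fun e => framed h2 (R2 e))).
have F1 e x y : framed h1 (R1 e) x y -> forall i, y.2 (inl i) = x.2 (inl i).
  by move=> r i; apply: (call_frame fR1 r).
have F2 e x y : framed h2 (R2 e) x y -> forall i, y.2 (inl i) = x.2 (inl i).
  by move=> r i; apply: (call_frame fR2 r).
split; first by apply: impl_seq; apply: impl_ren.
  by move=> e x y [z /F1 xz /F2 zy] i; rewrite zy xz.
move=> e x xr.
have S1 := call_spec sR1 i1; have S2 := call_spec sR2 i2.
have rd z : framed h1 (R1 e) x z -> in_range z /\ read z.2 inl = read x.2 inl :> den e t.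
  move=> r; split; first exact: impl_in_range (impl_ren i1 iR1) r xr.
  by apply: eq_read => i; apply: F1 r i.
split=> [[/S1 q1 q2]|[y [z r1 r2]]].
  have [z r1] := q1 xr; have [zr zE] := rd z r1.
  have /(S2 e z zr)[y r2] : Q2 e (read z.2 inl) by rewrite zE.
  by exists y, z.
have [zr zE] := rd z r1; split; first by apply/(S1 e x xr); exists z.
by rewrite -zE; apply/(S2 e z zr); exists y.
Qed.

Lemma def_or t (Q1 Q2 : forall e, den e t -> Prop) :
  definable Q1 -> definable Q2 -> definable (fun e x => Q1 e x \/ Q2 e x).
Proof.
move=> [J1 [R1 [iR1 fR1 sR1]]] [J2 [R2 [iR2 fR2 sR2]]].
pose h1 : (idx t + J1)%type -> (idx t + (J1 + J2))%type := sum_map id inl.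
pose h2 : (idx t + J2)%type -> (idx t + (J1 + J2))%type := sum_map id inr.
have i1 : injective h1 by apply: sum_map_inj => // ? ? [].
have i2 : injective h2 by apply: sum_map_inj => // ? ? [].
exists (J1 + J2)%type, (fun e x y => framed h1 (R1 e) x y \/ framed h2 (R2 e) x y).
split; first by apply: impl_alt; apply: impl_ren.
  by move=> e x y [r|r] i; [apply: (call_frame fR1 r)|apply: (call_frame fR2 r)].
move=> e x xr.
have S1 := call_spec sR1 i1 xr; have S2 := call_spec sR2 i2 xr.
split=> [[/S1[y r]|/S2[y r]]|[y [r|r]]]; try by exists y; tauto.
  by left; apply/S1; exists y.
by right; apply/S2; exists y.
Qed.

(* The projections and tuplings: each register of [f e x] is a register of [x]. *)
Definition term t s (f : forall e, den e t -> den e s) : Prop :=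
  exists g : idx s -> idx t, forall e x i, reg (f e x) i = reg x (g i).

Lemma term_id t : @term t t (fun e x => x).
Proof. by exists id. Qed.

Lemma term_p1 t a b (f : forall e, den e t -> den e (Pair a b)) :
  term f -> term (fun e x => p1 (f e x)).
Proof. by move=> [g gE]; exists (g \o inl) => e x i; rewrite -gE. Qed.

Lemma term_p2 t a b (f : forall e, den e t -> den e (Pair a b)) :
  term f -> term (fun e x => p2 (f e x)).
Proof. by move=> [g gE]; exists (g \o inr) => e x i; rewrite -gE. Qed.

Lemma term_pr t a b (f : forall e, den e t -> den e a) (f' : forall e, den e t -> den e b) :
  term f -> term f' -> term (fun e x => pr (f e x) (f' e x)).
Proof.
move=> [g gE] [g' gE'].
by exists (fun i => match i with inl i => g i | inr i => g' i end) => e x [] i /=.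
Qed.

Lemma impl_assign (I : finType) (g : I -> option I) :
  impl (fun e (x y : mem e I) =>
    y.1 = x.1 /\ forall i j, g i = Some j -> y.2 i = x.2 j).
Proof. by apply: impl_ext (impl_op (assign g)) _ => e x y; apply: assignE. Qed.

(** A term may use a register twice, so renaming along it need not be injective; the argument of [Q]
    is first copied into fresh registers. *)
Lemma def_comp t s (Q : forall e, den e s -> Prop) (f : forall e, den e t -> den e s) :
  definable Q -> term f -> definable (fun e x => Q e (f e x)).
Proof.
move=> [J [R [iR fR sR]]] [g gE].
pose K : finType := (idx t + (idx s + J))%type.
pose G (k : K) : option K := match k with
  | inl i => Some (inl i) | inr (inl i) => Some (inl (g i)) | inr (inr _) => None end.
pose h : (idx s + J)%type -> K := inr.
have ih : injective h by move=> ? ? [].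
exists (idx s + J)%type, (comp_rel
  (fun e (x y : mem e K) => y.1 = x.1 /\ forall i j, G i = Some j -> y.2 i = x.2 j)
  (fun e => framed h (R e))).
split; first by apply: impl_seq; [apply: impl_assign|apply: impl_ren].
  move=> e x y [z [_ xz] [_ zy]] i; rewrite zy ?(xz _ (inl i)) //.
  by apply/negP=> /codomP[].
move=> e x xr.
have fE (v : regs e K) : (forall i j, G i = Some j -> v i = x.2 j) ->
    read v (h \o inl) = f e (read x.2 inl).
  move=> vx; rewrite -[RHS]regK; apply: eq_unreg => i.
  by rewrite gE unregK /= (vx _ (inl (g i))).
split=> [q|[y [z [z1 z2] r]]].
  pose z : mem e K := (x.1, [ffun k => x.2 (odflt k (G k))]).
  have zx i j : G i = Some j -> z.2 i = x.2 j by move=> Gi; rewrite ffunE Gi.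
  have [|y r] := (call_spec sR ih (x := z) xr).1; first by rewrite fE.
  by exists y, z.
rewrite -(fE _ z2); apply/(call_spec sR ih); last by exists y.
by rewrite /in_range z1.
Qed.

(** The witness is guessed by an assignment that leaves its registers undetermined; they become
    scratch registers of the new program. *)
Lemma def_ex t s (Q : forall e, den e (Pair t s) -> Prop) :
  definable Q -> definable (fun e x => exists u, Q e (pr x u)).
Proof.
move=> [J [R [iR fR sR]]].
pose K : finType := (idx t + (idx s + J))%type.
pose G (k : K) : option K := if k is inl i then Some (inl i) else None.
pose h (k : idx (Pair t s) + J) : K := match k with
  | inl (inl i) => inl i | inl (inr i) => inr (inl i) | inr j => inr (inr j) end.
have ih : injective h by move=> [[?|?]|?] [[?|?]|?] // [->].
exists (idx s + J)%type, (comp_rel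
  (fun e (x y : mem e K) => y.1 = x.1 /\ forall i j, G i = Some j -> y.2 i = x.2 j)
  (fun e => framed h (R e))).
split; first by apply: impl_seq; [apply: impl_assign|apply: impl_ren].
  move=> e x y [z [_ xz] r] i; rewrite -(xz (inl i) (inl i)) //.
  by apply: (call_frame fR r).
move=> e x xr; split=> [[u q]|[y [z [z1 z2] r]]]; last first.
  exists (read z.2 (inr \o inl)).
  have -> : read x.2 inl = read z.2 inl :> den e t.
    by apply: eq_read => i; rewrite (z2 _ (inl i)).
  have zr : in_range z by rewrite /in_range z1.
  by apply/(call_spec sR ih zr); exists y.
pose z : mem e K := (x.1, [ffun k => match k with
  | inr (inl i) => reg u i | _ => x.2 k end]).
have zx i j : G i = Some j -> z.2 i = x.2 j.
  by rewrite ffunE; case: i => [i|[i|i]] //= [<-].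
have [|y r] := (call_spec sR ih (x := z) xr).1; last by exists y, z.
rewrite (_ : read _ _ = pr (read x.2 inl) u) //; congr pair.
  by apply: eq_read => i; rewrite ffunE.
by rewrite -[RHS]regK; apply: eq_unreg => i; rewrite ffunE.
Qed.

(** Only the current vertex and a guessed next one are stored. [G1] initialises [cur] with the
    source, [G2] keeps [cur] and guesses [nxt], the program for [Q] checks the pair, and [G3] moves
    [nxt] to [cur]; after the loop [C] compares [cur] with the target. *)
Lemma def_tc t s (Q : forall e, den e (Pair t (Pair s s)) -> Prop) : definable Q ->
  @definable (Pair t (Pair s s)) (fun e x =>
    rtc (fun a b => Q e (pr (p1 x) (pr a b))) (p1 (p2 x)) (p2 (p2 x))).
Proof.
move=> [J [R [iR fR sR]]].
set T := Pair t (Pair s s).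
pose K : finType := (idx T + ((idx s + idx s) + J))%type.
pose cur (k : idx s) : K := inr (inl (inl k)).
pose nxt (k : idx s) : K := inr (inl (inr k)).
pose src (k : idx s) : K := inl (inr (inl k)).
pose tgt (k : idx s) : K := inl (inr (inr k)).
pose G1 (k : K) : option K := match k with
  | inl i => Some (inl i) | inr (inl (inl k)) => Some (src k) | _ => None end.
pose G2 (k : K) : option K := match k with
  | inl i => Some (inl i) | inr (inl (inl k)) => Some (cur k) | _ => None end.
pose G3 (k : K) : option K := match k with
  | inl i => Some (inl i) | inr (inl (inl k)) => Some (nxt k) | _ => None end.
pose A (g : K -> option K) e (x y : mem e K) :=
  y.1 = x.1 /\ forall i j, g i = Some j -> y.2 i = x.2 j.
pose h (k : idx T + J) : K := match k with
  | inl (inl i) => inl (inl i) | inl (inr (inl k)) => cur k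
  | inl (inr (inr k)) => nxt k | inr j => inr (inr j) end.
have ih : injective h by move=> [[?|[?|?]]|?] [[?|[?|?]]|?] // [->].
pose B := comp_rel (A G2) (comp_rel (fun e => framed h (R e)) (A G3)).
pose C (e : env) (x y : mem e K) := y = x /\ forall k, x.2 (cur k) = x.2 (tgt k).
pose F := comp_rel (A G1) (comp_rel (fun e => rtc (B e)) C).
have iA g : impl (A g) by apply: impl_assign.
have iB : impl B by apply: impl_seq => //; apply: impl_seq => //; apply: impl_ren.
have iC : impl C.
  apply: impl_ext (impl_op (check (fun c => [forall k, c (cur k) == c (tgt k)]))) _.
  move=> e x y; rewrite checkE; split=> -[-> H]; (split; first by []); last first.
    by move=> i im; apply/forallP=> k; rewrite !ffunE H.
  move=> k; apply/val_inj/(@bit_ext (bits e)) => //= i im.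
  by have /forallP/(_ k) := H i im; rewrite !ffunE => /eqP.
have RC e (x : mem e K) : read x.2 (h \o inl) =
    pr (read x.2 (inl \o inl)) (pr (read x.2 cur) (read x.2 nxt)) by [].
have keepB e x y : B e x y -> forall i, y.2 (inl i) = x.2 (inl i).
  move=> [z [_ z2] [u r [_ u2]]] i; rewrite (u2 (inl i) (inl i)) //.
  by rewrite (call_frame fR r) ?(z2 (inl i) (inl i)).
have curB e (x y : mem e K) : in_range x -> B e x y -> in_range y /\
    Q e (pr (read x.2 (inl \o inl)) (pr (read x.2 cur) (read y.2 cur))).
  move=> xr b; split; first exact: impl_in_range iB b xr.
  case: b => z [z1 z2] [u r [_ u2]].
  have zr : in_range z by rewrite /in_range z1.
  have : Q e (read z.2 (h \o inl)) by apply/(call_spec sR ih zr); exists u.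
  rewrite RC; congr (Q e (pr _ (pr _ _))); apply: eq_read => i.
  - exact: z2.
  - exact: z2.
  - by rewrite (u2 _ (nxt i)) // (call_frame fR r).
have stepB e (x : mem e K) b : in_range x ->
    Q e (pr (read x.2 (inl \o inl)) (pr (read x.2 cur) b)) ->
    exists2 y, B e x y & read y.2 cur = b.
  move=> xr q; pose z : mem e K := (x.1, [ffun k => match k with
    | inr (inl (inr k)) => reg b k | _ => x.2 k end]).
  have zx i j : G2 i = Some j -> z.2 i = x.2 j.
    by rewrite ffunE; case: i => [i|[[i|i]|i]] //= [<-].
  have nz : read z.2 nxt = b.
    by rewrite -[RHS]regK; apply: eq_unreg => i; rewrite ffunE.
  have [|u r] := (call_spec sR ih (x := z) xr).1.
    rewrite RC nz; congr (Q e (pr _ (pr _ _))): q; apply: eq_read => i; symmetry; exact: zx.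
  pose y : mem e K := (u.1, [ffun k => u.2 (odflt k (G3 k))]).
  have yu i j : G3 i = Some j -> y.2 i = u.2 j by move=> Gi; rewrite ffunE Gi.
  exists y; first by exists z => //; exists u.
  by rewrite -nz; apply: eq_read => i; rewrite (yu _ (nxt i)) // (call_frame fR r).
pose S e (x : mem e K) a b := Q e (pr (read x.2 (inl \o inl)) (pr a b)).
have loop_sound e (x y : mem e K) : in_range x -> rtc (B e) x y ->
    rtc (S e x) (read x.2 cur) (read y.2 cur) /\ forall i, y.2 (inl i) = x.2 (inl i).
  move=> xr xy; pose I z := in_range z /\
    (rtc (S e x) (read x.2 cur) (read z.2 cur) /\ forall i, z.2 (inl i) = x.2 (inl i)).
  suff [] : I y by [].
  apply: (rtc_inv (P := I) _ _ xy); last by split=> //; split=> //; apply: rt_refl.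
  move=> a b [ar [xa ax]] ab; have [br q] := curB e a b ar ab.
  split=> //; split=> [|i]; last by rewrite (keepB _ _ _ ab) ax.
  apply: rtc_rcons xa _; rewrite /S (_ : read x.2 _ = read a.2 (inl \o inl)) //.
  by apply: eq_read => i; rewrite /= ax.
have loop_complete e (x : mem e K) b : in_range x -> rtc (S e x) (read x.2 cur) b ->
    exists2 y, rtc (B e) x y & read y.2 cur = b.
  move=> xr xb; pose I b := exists2 y, rtc (B e) x y & read y.2 cur = b.
  apply: (rtc_inv (P := I) _ _ xb); last by exists x => //; apply: rt_refl.
  move=> a c [y xy ya] q; have [_ yx] := loop_sound e x y xr xy.
  have [||z yz zc] := stepB e y c; last by exists z => //; apply: rtc_rcons xy yz.
    exact: impl_in_range (impl_star iB) xy xr.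
  rewrite ya (_ : read y.2 _ = read x.2 (inl \o inl)) //.
  by apply: eq_read => i; rewrite /= yx.
exists ((idx s + idx s) + J)%type, F; split.
- by apply: impl_seq => //; apply: impl_seq => //; apply: impl_star.
- move=> e x y [z [z1 z2] [u zu [-> _]]] i; rewrite -(z2 (inl i) (inl i)) //.
  pose I (a : mem e K) := a.2 (inl i) = z.2 (inl i).
  by apply: (rtc_inv (P := I) _ _ zu) => // a b ab /keepB; rewrite /I => ->.
move=> e x xr.
have tE (z : mem e K) : (forall i j, G1 i = Some j -> z.2 i = x.2 j) ->
    [/\ read z.2 (inl \o inl) = p1 (read x.2 inl : den e T),
        read z.2 cur = p1 (p2 (read x.2 inl : den e T))
      & forall u : mem e K, (forall i, u.2 (inl i) = z.2 (inl i)) ->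
          read u.2 tgt = p2 (p2 (read x.2 inl : den e T))].
  move=> zx; split=> [||u uz]; apply: eq_read => i; try exact: zx.
  by rewrite uz (zx _ (tgt i)).
split=> [q|[y [z [z1 z2] [u zu [_ ub]]]]].
  pose z : mem e K := (x.1, [ffun k => x.2 (odflt k (G1 k))]).
  have zx i j : G1 i = Some j -> z.2 i = x.2 j by move=> Gi; rewrite ffunE Gi.
  have [zT zc zt] := tE z zx; rewrite -zc -zT in q.
  have [y zy yb] := loop_complete e z _ xr q.
  have [_ /zt yt] := loop_sound e z y xr zy.
  exists y; exists z => //; exists y => //; split=> // k.
  rewrite -yt in yb; have := congr1 (fun a => reg a k) yb.
  by rewrite /read !unregK.
have zr : in_range z by rewrite /in_range z1.
have [zT zc zt] := tE z z2; have [zu' /zt ut] := loop_sound e z u zr zu.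
rewrite -zc -zT -ut (_ : read u.2 tgt = read u.2 cur) //.
by apply: eq_read => i; rewrite ub.
Qed.

(** The head position cannot be copied into a register, so the head is taken back to the left marker
    and then advanced in step with a counter [y0] until the counter agrees with the argument.
    Letters start in cell 1, whence [z.1 = (z.2 y0).+1]. Moving right only off cells other than the
    right marker avoids the clipping that would break this equation. *)
Lemma def_scan0 (c : scanned symbol) : @definable Reg (fun e x =>
  nat_of x <= size (word e) /\ scan (word e) (nat_of x).+1 = c).
Proof.
pose K : finType := (idx Reg + bool)%type.
pose x0 : K := inl tt; pose y0 : K := inr true; pose y1 : K := inr false.
pose A (g : K -> option K) e (x y : mem e K) :=
  y.1 = x.1 /\ forall i j, g i = Some j -> y.2 i = x.2 j.
pose G1 (k : K) : option K := if k is inl i then Some (inl i) else None.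
pose G2 (k : K) : option K := if k is inr false then None else Some k.
pose G3 (k : K) : option K := if k is inr true then Some y1 else Some k.
pose inp (s : pred (scanned symbol)) m e := @op_sem e K (Input K s m).
pose isL (s : scanned symbol) := if s is LeftEnd then true else false.
pose notR (s : scanned symbol) := if s is RightEnd then false else true.
pose Z e (x y : mem e K) := y = x /\ x.2 y0 = 0 :> nat.
pose S e (x y : mem e K) := y = x /\ x.2 y1 = (x.2 y0).+1 :> nat.
pose E e (x y : mem e K) := y = x /\ x.2 x0 = x.2 y0.
pose B := comp_rel (inp notR MRight) (comp_rel (A G2) (comp_rel S (A G3))).
pose F := comp_rel (fun e => rtc (inp predT MLeft e)) (comp_rel (inp isL MRight)
  (comp_rel (A G1) (comp_rel Z (comp_rel (fun e => rtc (B e))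
    (comp_rel E (inp (fun s => `[< s = c >]) MStay)))))).
have iA g : impl (A g) by apply: impl_assign.
have iS : impl S.
  by apply: impl_ext (impl_op (test_succ y0 y1)) _ => e x y; rewrite test_succE.
have iZ : impl Z.
  by apply: impl_ext (impl_op (check (fun c => ~~ c y0))) _ => e x y; rewrite check_zeroE.
have iE : impl E.
  by apply: impl_ext (impl_op (check (fun c => c x0 == c y0))) _ => e x y; rewrite check_eqE.
have iI s m : impl (inp s m) by apply: impl_op.
have iB : impl B by apply: impl_seq => //; apply: impl_seq => //; apply: impl_seq.
have iF : impl F.
  by do 4?[apply: impl_seq => //]; try apply: impl_star => //;
     do 4?[apply: impl_seq => //]; try apply: impl_star.
pose W e := size (word e).
pose I e (x z : mem e K) := [/\ z.1 = (z.2 y0).+1, z.1 <= (W e).+1 & z.2 x0 = x.2 x0].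
have stepB e (x a b : mem e K) : I e x a -> B e a b -> I e x b.
  move=> [a1 ar ax] [a' [nr ->] [d [d1 d2] [_ [-> dS] [b1 b2]]]].
  have a1W : a.1 <= W e.
    by apply: scan_lt => // sE; move: nr; rewrite sE.
  have da : d.2 y0 = a.2 y0 by rewrite (d2 y0 y0).
  split; rewrite ?(b2 y0 y1) ?(b2 x0 x0) // ?(d2 x0 x0) // ?b1 ?d1 ?dS ?da /=.
    by rewrite /move_in /= -a1; apply/minn_idPl.
  exact: move_in_le.
have initF e (x z : mem e K) : rtc (inp predT MLeft e) x z -> z.2 = x.2.
  by move=> r; apply: (rtc_inv (P := fun z => z.2 = x.2) _ _ r) => // a b ax [_ ->].
have startF e (x a b d u : mem e K) : rtc (inp predT MLeft e) x a ->
    inp isL MRight e a b -> A G1 e b d -> Z e d u -> I e x u.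
  move=> /initF ax [aL ->] [d1 d2] [-> d0]; split; rewrite ?d1 ?d0 /=.
  - by move: aL; rewrite /scan; case: (a.1) => [_|n];
      [rewrite /move_in /= minnSS min0n|case: (onth (word e) n)].
  - exact: move_in_le.
  - by rewrite (d2 x0 x0) //= ax.
exists bool, F; split=> //.
  move=> e x y [a r1 [b r2 [d r3 [u r4 [v r5 [_ [-> _] [_ ->]]]]]]] [] /=.
  have Iv := startF e x a b d u r1 r2 r3 r4.
  by have [] := rtc_inv (P := I e x) (stepB e x) Iv r5.
move=> e x xr; rewrite /= -/x0 -/(W e); split=> [[xW xc]|]; last first.
  move=> [y [a r1 [b r2 [d r3 [u r4 [v r5 [_ [-> vxy] [/asboolP vc _]]]]]]]].
  have Iv := startF e x a b d u r1 r2 r3 r4.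
  have [v1 vW vx] := rtc_inv (P := I e x) (stepB e x) Iv r5.
  rewrite /nat_of /read /= -/x0 -vx vxy; rewrite v1 in vW vc.
  by split=> //; apply: vc.
have [a [a0 a2] r1] : exists2 a, a.1 = 0 /\ a.2 = x.2 & rtc (inp predT MLeft e) x a.
  case: (x) xr {xW xc} => p v; elim: p => [|p IH] pr; first by exists (0, v) => //; apply: rt_refl.
  have [a aE ra] := IH (ltnW pr); exists a => //; apply: rtc_cons ra.
  by split=> //; congr pair; rewrite /move_in /=; symmetry; apply/minn_idPl; apply: ltnW.
pose b : mem e K := (1, a.2).
have r2 : inp isL MRight e a b.
  by split; rewrite /= ?a0 // /b /move_in /= minnSS min0n.
have N0 : 0 < 2 ^ bits e by rewrite expn_gt0.
pose d : mem e K := (1, [ffun k => if k is inl _ then a.2 k else Ordinal N0]).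
have r3 : A G1 e b d by split=> // i j; case: i => //= i [<-]; rewrite ffunE.
have r4 : Z e d d by split=> //; rewrite ffunE.
have [v r5 [v0 vx]] : exists2 v, rtc (B e) d v &
    v.2 y0 = x.2 x0 :> nat /\ v.2 x0 = x.2 x0.
  have: x.2 x0 <= W e by exact: xW.
  elim: (nat_of_ord (x.2 x0)) => [|n IH] nW.
    by exists d; [apply: rt_refl|split; rewrite ffunE ?a2].
  have [v dv [vn vx]] := IH (ltnW nW).
  have Id : I e x d by apply: startF r1 r2 r3 r4.
  have [v1 vr _] := rtc_inv (P := I e x) (stepB e x) Id dv.
  have nN : n.+1 < 2 ^ bits e by have := word_small e; rewrite -/(W e); lia.
  pose u1 : mem e K := (v.1.+1, v.2).
  pose u2 : mem e K := (v.1.+1, [ffun k => if k == y1 then Ordinal nN else v.2 k]).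
  pose u3 : mem e K := (v.1.+1, [ffun k => if k == x0 then v.2 k else Ordinal nN]).
  have vW : v.1 <= W e by rewrite v1 vn.
  exists u3; last by split; rewrite ffunE.
  apply: rtc_rcons dv _; exists u1; first split.
  - rewrite /= /scan v1 vn; case E1: (onth (word e) n) => //.
    by have := onthTE (word e) n; rewrite E1 nW.
  - by rewrite /u1 /move_in /=; congr pair; symmetry; apply/minn_idPl.
  exists u2; first by split=> // i j; case: i => [[]|[]] //= [<-]; rewrite ffunE.
  exists u2; first by split=> //; rewrite !ffunE /= vn.
  by split=> // i j; case: i => [[]|[]] //= [<-]; rewrite !ffunE.
have Iv := rtc_inv (P := I e x) (stepB e x) (startF e x a b d d r1 r2 r3 r4) r5.
exists v; exists a => //; exists b => //; exists d => //; exists d => //; exists v => //.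
exists v; first by split=> //; apply/val_inj; rewrite /= vx -v0.
case: Iv => v1 vr _; split.
  apply/asboolP; rewrite v1 v0; exact: xc.
by case: (v) v1 vr => p f /= _ pr; rewrite move_in_stay.
Qed.

(** Every [ty] has at least one register; the one of [Reg] supplies the [r0] with which the counting
    phase tells 0 from 1. *)
Lemma NL_of_definable (L : seq symbol -> Prop) (Q : env -> Prop) :
  @definable Reg (fun e _ => Q e) -> (forall e, L (word e) <-> Q e) -> NL L.
Proof.
move=> [J [R [[Qs [s [f [lab RE]]]] _ sR]]] LQ.
apply: (@NL_of_program _ Qs s f lab (inl tt)) => e p v pr.
rewrite LQ; split=> [/(sR e (p, v) pr)[y /RE r]|[y /RE r]]; first by exists y.
by apply/(sR e (p, v) pr); exists y.
Qed.

Lemma term_comp t s r (f : forall e, den e s -> den e r) (h : forall e, den e t -> den e s) :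
  term f -> term h -> term (fun e x => f e (h e x)).
Proof. by move=> [g gE] [k kE]; exists (k \o g) => e x i; rewrite gE kE. Qed.

Ltac solve_term :=
  repeat lazymatch goal with
  | |- term (fun e x => x) => exact: term_id
  | |- term (fun e x => p1 (@?f e x)) => refine (term_p1 (f := f) _)
  | |- term (fun e x => p2 (@?f e x)) => refine (term_p2 (f := f) _)
  | |- term (fun e x => pr (@?f e x) (@?g e x)) =>
      refine (term_pr (f := f) (f' := g) _ _)
  | H : term ?f |- term ?f => exact: H
  | H : term ?f |- term (fun e x => ?f e (@?h e x)) =>
      refine (term_comp H (h := h) _)
  end.

Lemma def_exists t s (Q : forall e, den e t -> den e s -> Prop) :
  @definable (Pair t s) (fun e z => Q e (p1 z) (p2 z)) ->
  definable (fun e x => exists u, Q e x u).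
Proof. by move=> /def_ex. Qed.

Lemma def_rtc t s (Q : forall e, den e t -> den e s -> den e s -> Prop)
    (f g : forall e, den e t -> den e s) :
  @definable (Pair t (Pair s s)) (fun e z => Q e (p1 z) (p1 (p2 z)) (p2 (p2 z))) ->
  term f -> term g -> definable (fun e x => rtc (Q e x) (f e x) (g e x)).
Proof.
move=> /def_tc dQ tf tg.
apply: (def_comp (f := fun e x => pr x (pr (f e x) (g e x))) dQ).
by apply: term_pr (term_id _) (term_pr tf tg).
Qed.

Section Atoms.

Variables (t : ty) (f g : forall e, den e t -> den e Reg).
Hypotheses (tf : term f) (tg : term g).

Lemma def_eqD : definable (fun e x => f x = g x).
Proof. exact: (def_comp (f := fun e x => pr (f x) (g x))) def_eq0 (term_pr tf tg). Qed.

Lemma def_zero : definable (fun e x => nat_of (f x) = 0).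
Proof. exact: def_comp def_zero0 tf. Qed.

Lemma def_last : definable (fun e x => (nat_of (f x)).+1 = 2 ^ bits e).
Proof. exact: def_comp def_last0 tf. Qed.

Lemma def_succ : definable (fun e x => nat_of (g x) = (nat_of (f x)).+1).
Proof. exact: (def_comp (f := fun e x => pr (f x) (g x))) def_succ0 (term_pr tf tg). Qed.

Lemma def_scan c : definable (fun e x =>
  nat_of (f x) <= size (word e) /\ scan (word e) (nat_of (f x)).+1 = c).
Proof. exact: def_comp (def_scan0 c) tf. Qed.

End Atoms.

Lemma nat_of_inj e : injective (@nat_of e).
Proof. exact: val_inj. Qed.

Lemma nat_of_lt e (x : den e Reg) : nat_of x < 2 ^ bits e.
Proof. exact: ltn_ord. Qed.

Lemma nat_of_surj e n : n < 2 ^ bits e -> exists x : den e Reg, nat_of x = n.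
Proof. by move=> nN; exists (Ordinal nN). Qed.

(** The order comes from closing the successor, so comparison needs no further operation on
    columns. *)
Lemma rtc_succ e (a b : den e Reg) :
  rtc (fun x y : den e Reg => nat_of y = (nat_of x).+1) a b <-> nat_of a <= nat_of b.
Proof.
split=> [r|].
  by apply: (rtc_inv (P := fun b => nat_of a <= nat_of b) _ _ r) => // x y ax ->; apply: leqW.
move hn : (nat_of b) => n; elim: n b hn => [|n IH] b hn.
  rewrite leqn0 => /eqP an; have -> : a = b by apply: nat_of_inj; rewrite an.
  exact: rt_refl.
rewrite leq_eqVlt => /orP[/eqP an|].
  have -> : a = b by apply: nat_of_inj; rewrite an.
  exact: rt_refl.
have [|c cn an] := @nat_of_surj e n; first by have := nat_of_lt b; lia.
by apply: rtc_rcons (IH c cn an) _; rewrite cn.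
Qed.

Lemma def_le t (f g : forall e, den e t -> den e Reg) : term f -> term g ->
  definable (fun e x => nat_of (f e x) <= nat_of (g e x)).
Proof.
move=> tf tg; apply: (def_ext (Q := fun e x =>
  rtc (fun x y : den e Reg => nat_of y = (nat_of x).+1) (f e x) (g e x))).
  by apply: def_rtc => //; apply: def_succ; solve_term.
by move=> e x; apply: rtc_succ.
Qed.

Lemma def_lt t (f g : forall e, den e t -> den e Reg) : term f -> term g ->
  definable (fun e x => nat_of (f e x) < nat_of (g e x)).
Proof.
move=> tf tg; apply: (def_ext (Q := fun e x =>
  exists u : den e Reg, nat_of u = (nat_of (f e x)).+1 /\ nat_of u <= nat_of (g e x))).
  by apply: def_exists; apply: def_and; [apply: def_succ|apply: def_le]; solve_term.
move=> e x; split=> [[u [<-]]//|fg].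
have [|u uE] := @nat_of_surj e (nat_of (f e x)).+1.
  exact: leq_ltn_trans fg (nat_of_lt _).
by exists u; rewrite uE.
Qed.

Lemma def_eq t s (f g : forall e, den e t -> den e s) : term f -> term g ->
  definable (fun e x => f e x = g e x).
Proof.
elim: s f g => [|a IHa b IHb] f g tf tg; first exact: def_eqD.
apply: (def_ext (Q := fun e x => p1 (f e x) = p1 (g e x) /\ p2 (f e x) = p2 (g e x))).
  by apply: def_and; [apply: IHa|apply: IHb]; solve_term.
by move=> e x; case: (f e x) (g e x) => [? ?] [? ?]; split=> [[/= -> ->]|[-> ->]].
Qed.

(** Equality cannot be negated. On one register inequality splits into the two strict orders, and on
    pairs it is a disjunction over the components. *)
Lemma def_neq t s (f g : forall e, den e t -> den e s) : term f -> term g ->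
  definable (fun e x => f e x <> g e x).
Proof.
elim: s f g => [|a IHa b IHb] f g tf tg.
  apply: (def_ext (Q := fun e x => nat_of (f e x) < nat_of (g e x) \/
                                   nat_of (g e x) < nat_of (f e x))).
    by apply: def_or; apply: def_lt.
  move=> e x; split=> [lt fg|/eqP]; first by move: lt; rewrite fg ltnn; case.
  by rewrite -(inj_eq (@nat_of_inj e)) neq_ltn => /orP.
apply: (def_ext (Q := fun e x => p1 (f e x) <> p1 (g e x) \/ p2 (f e x) <> p2 (g e x))).
  by apply: def_or; [apply: IHa|apply: IHb]; solve_term.
move=> e x; case: (f e x) (g e x) => [u1 u2] [v1 v2]; rewrite /p1 /p2 /=; split.
  by move=> H [uv1 uv2]; case: H.
move=> H; case: (eqVneq u1 v1) => [uv1|/eqP uv1]; [right|by left].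
by move=> uv2; apply: H; rewrite uv1 uv2.
Qed.

(** * Tuples as numbers, in lexicographic order *)

Fixpoint ty_size e t := match t with
  | Reg => 2 ^ bits e | Pair a b => ty_size e a * ty_size e b end.

(** Identifying a tuple with its lexicographic index lets tuples act as counters, with a range that
    grows polynomially beyond that of one register. *)
Fixpoint rank e t : den e t -> nat := match t with
  | Reg => fun x => nat_of x
  | Pair a b => fun x => rank (p1 x) * ty_size e b + rank (p2 x) end.

Lemma rank_lt e t (x : den e t) : rank x < ty_size e t.
Proof.
elim: t x => [|a IHa b IHb] x /=; first exact: nat_of_lt.
have := IHa (p1 x); have := IHb (p2 x); move: (rank _) (rank _) => m n; nia.
Qed.

Lemma rank_inj e t : injective (@rank e t).
Proof.
elim: t => [|a IHa b IHb]; first exact: nat_of_inj.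
move=> [x1 x2] [y1 y2] /=.
have := rank_lt x2; have := rank_lt y2; rewrite /p1 /p2 /=.
move=> x2l y2l xy; congr pair.
  apply: IHa; have := congr1 (fun n => n %/ ty_size e b) xy.
  by rewrite !divnMDl ?(leq_trans _ x2l) // !divn_small // !addn0.
apply: IHb; have := congr1 (fun n => n %% ty_size e b) xy.
by rewrite !modnMDl !modn_small.
Qed.

Lemma rank_surj e t n : n < ty_size e t -> exists x : den e t, rank x = n.
Proof.
elim: t n => [|a IHa b IHb] n /=; first exact: nat_of_surj.
move=> nab; have b0 : 0 < ty_size e b by case: (ty_size e b) nab => //; rewrite muln0.
have [|x xE] := IHa (n %/ ty_size e b); first by rewrite ltn_divLR.
have [|y yE] := IHb (n %% ty_size e b); first by rewrite ltn_mod.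
by exists (pr x y); rewrite /pr /p1 /p2 /= xE yE -divn_eq.
Qed.

Lemma ty_size_gt0 e t : 0 < ty_size e t.
Proof. by elim: t => [|a IHa b IHb] /=; rewrite ?muln_gt0 ?IHa ?expn_gt0. Qed.

Lemma card_den e t : #|den e t| = ty_size e t.
Proof.
elim: t => [|a IHa b IHb] /=; first by rewrite [LHS]card_ord.
by rewrite card_prod IHa IHb.
Qed.

Lemma def_rank0 t s (f : forall e, den e t -> den e s) :
  term f -> definable (fun e x => rank (f e x) = 0).
Proof.
elim: s f => [|a IHa b IHb] f tf; first exact: def_zero.
apply: (def_ext (Q := fun e x => rank (p1 (f e x)) = 0 /\ rank (p2 (f e x)) = 0)).
  by apply: def_and; [apply: IHa|apply: IHb]; solve_term.
move=> e x /=; have := ty_size_gt0 e b.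
move: (rank _) (rank _) (ty_size e b) => m n k; nia.
Qed.

Lemma def_rank_last t s (f : forall e, den e t -> den e s) :
  term f -> definable (fun e x => (rank (f e x)).+1 = ty_size e s).
Proof.
elim: s f => [|a IHa b IHb] f tf; first exact: def_last.
apply: (def_ext (Q := fun e x => (rank (p1 (f e x))).+1 = ty_size e a /\
                                 (rank (p2 (f e x))).+1 = ty_size e b)).
  by apply: def_and; [apply: IHa|apply: IHb]; solve_term.
move=> e x /=; have := rank_lt (p1 (f e x)); have := rank_lt (p2 (f e x)).
move: (rank _) (rank _) => m n; nia.
Qed.

(** Lexicographic successor: the second component advances, or it wraps from its last value to 0 and
    passes a carry to the first. *)
Lemma def_rankS t s (f g : forall e, den e t -> den e s) : term f -> term g ->
  definable (fun e x => rank (g e x) = (rank (f e x)).+1).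
Proof.
elim: s f g => [|a IHa b IHb] f g tf tg; first exact: def_succ.
apply: (def_ext (Q := fun e x =>
   (p1 (f e x) = p1 (g e x) /\ rank (p2 (g e x)) = (rank (p2 (f e x))).+1) \/
   (rank (p1 (g e x)) = (rank (p1 (f e x))).+1 /\
    ((rank (p2 (f e x))).+1 = ty_size e b /\ rank (p2 (g e x)) = 0)))).
  apply: def_or; apply: def_and; try apply: def_and.
  - by apply: def_eq; solve_term.
  - by apply: IHb; solve_term.
  - by apply: IHa; solve_term.
  - by apply: def_rank_last; solve_term.
  - by apply: def_rank0; solve_term.
move=> e x /=; have := rank_lt (p2 (f e x)); have := rank_lt (p2 (g e x)).
rewrite (_ : p1 (f e x) = p1 (g e x) <-> rank (p1 (f e x)) = rank (p1 (g e x))); last first.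
  by split=> [->//|]; apply: rank_inj.
move: (rank (p1 (f e x))) (rank (p1 (g e x))) => m n.
move: (rank (p2 _)) (rank (p2 _)) (ty_size e b) => k l s ls ks.
split=> [[[<- ->]|[-> [ks' ->]]]|H]; [by rewrite addnS|by rewrite -ks'; lia|].
have [mn|nm|mn] := ltngtP m n; last by left; subst n; lia.
  by have [|nm] := leqP n m.+1; [right; have n1 : n = m.+1 by lia|]; nia.
nia.
Qed.

(** * Inductive counting *)

Section Counting.

Variables (e : env) (V C : ty).

(* [counts A B k] walks through [den e V] in the order of [rank], certifying each
   element by [A], which increments the counter, or by [B], which does not. *)
Definition tally_step (A B : den e V -> Prop) (x : den e V) (k k' : den e C) :=
  A x /\ rank k' = (rank k).+1 \/ B x /\ k = k'.

Definition counts (A B : den e V -> Prop) (k : den e C) : Prop :=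
  exists x0 x1 k0 k1, rank x0 = 0 /\ (rank k0 = 0 /\ ((rank x1).+1 = ty_size e V /\
    (rtc (fun a b : den e (Pair V C) =>
            rank (p1 b) = (rank (p1 a)).+1 /\ tally_step A B (p1 a) (p2 a) (p2 b))
         (pr x0 k0) (pr x1 k1) /\
     tally_step A B x1 k1 k))).

Definition tallied A B n (k : den e C) := exists U : {set den e V},
  [/\ forall x, x \in U -> A x /\ rank x < n,
      forall x, x \notin U -> rank x < n -> B x & #|U| = rank k].

Lemma tallied_step A B (x : den e V) k k' :
  tallied A B (rank x) k -> tally_step A B x k k' -> tallied A B (rank x).+1 k'.
Proof.
move=> [U [UA UB Uk]] [[Ax kk]|[Bx <-]].
  exists (x |: U); split=> [y|y|].
  - by rewrite !inE => /orP[/eqP->//|/UA[Ay yx]]; split=> //; apply: leqW.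
  - rewrite !inE negb_or ltnS leq_eqVlt => /andP[yx yU] /orP[/eqP/rank_inj yE|]; last exact: UB.
    by rewrite yE eqxx in yx.
  - by rewrite cardsU1 kk Uk; case: (boolP (x \in U)) => // /UA[_]; rewrite ltnn.
exists U; split=> // y; first by move=> /UA[Ay yx]; split=> //; apply: leqW.
by rewrite ltnS leq_eqVlt => yU /orP[/eqP/rank_inj->//|]; apply: UB.
Qed.

(** [U] collects the elements certified by [A]. It is pinned down when [A] and [B] are
    complementary, and it is empty when [A] is unsatisfiable, in which case [B] holds throughout. *)
Lemma countsP A B k : counts A B k <-> exists U : {set den e V},
  [/\ forall x, x \in U -> A x, forall x, x \notin U -> B x & #|U| = rank k].
Proof.
split=> [[x0 [x1 [k0 [k1 [x00 [k00 [x1l [r st]]]]]]]]|[U [UA UB Uk]]].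
  have [U [UA UB Uk]] : tallied A B (rank x1).+1 k.
    apply: tallied_step st; pose I (a : den e (Pair V C)) := tallied A B (rank (p1 a)) (p2 a).
    apply: (rtc_inv (P := I) _ _ r).
      by move=> a b aI [bE]; rewrite /I bE; apply: tallied_step.
    rewrite /I /= x00; exists set0; split=> // [x|]; first by rewrite inE.
    by rewrite cards0 k00.
  exists U; split=> // x; first by move/UA=> [].
  by move/UB; apply; rewrite x1l rank_lt.
(* On arrival at [x] the counter is the number of elements of [U] of smaller rank. The last element
   is tallied after the walk, because no tuple has rank [ty_size e V]. *)
pose Un n := [set x in U | rank x < n].
have UnC n : #|Un n| < ty_size e C.
  apply: leq_ltn_trans (rank_lt k); rewrite -Uk.
  by apply/subset_leq_card/subsetP=> x; rewrite inE => /andP[].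
have step x kn kn' : rank kn = #|Un (rank x)| -> rank kn' = #|Un (rank x).+1| ->
    tally_step A B x kn kn'.
  move=> knE kn'E; case: (boolP (x \in U)) => xU; [left|right].
    split; first exact: UA.
    rewrite knE kn'E (_ : Un (rank x).+1 = x |: Un (rank x)).
      by rewrite cardsU1 !inE ltnn andbF.
    apply/setP=> y; rewrite !inE ltnS leq_eqVlt andb_orr (inj_eq (@rank_inj e V)).
    by case: eqP => [->|_]; rewrite ?xU ?andbF.
  split; first exact: UB.
  apply: rank_inj; rewrite knE kn'E; congr #|pred_of_set _|.
  apply/esym/setP=> y; rewrite !inE ltnS leq_eqVlt andb_orr (inj_eq (@rank_inj e V)).
  by case: eqP => [->|_]; rewrite ?(negbTE xU) ?andbF.
have V0 := ty_size_gt0 e V; have C0 := ty_size_gt0 e C.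
have [x0 x00] := rank_surj V0; have [k0 k00] := rank_surj C0.
have [|x1 x1l] := @rank_surj e V (ty_size e V).-1; first by rewrite prednK.
have [k1 k1E] := rank_surj (UnC (rank x1)).
exists x0, x1, k0, k1; do 3?[split=> //]; first by rewrite x1l prednK.
split; last first.
  apply: step k1E _; rewrite -Uk; congr #|pred_of_set _|; apply/setP=> y.
  by rewrite !inE x1l prednK // rank_lt andbT.
have : rank x1 <= (ty_size e V).-1 by rewrite x1l.
move hn : (rank x1) => n; elim: n x1 k1 k1E hn {x1l} => [|n IH] x l lE hn nV.
  have -> : x = x0 by apply: rank_inj; rewrite hn.
  have -> : l = k0.
    apply: rank_inj; rewrite lE k00 hn; apply/eqP; rewrite cards_eq0.
    by apply/eqP/setP=> y; rewrite !inE andbF.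
  exact: rt_refl.
have [|x' x'n] := @rank_surj e V n; first by lia.
have [k' k'E] := rank_surj (UnC n); rewrite -x'n in k'E.
apply: rtc_rcons (IH x' k' k'E x'n (ltnW nV)) _; split; first by rewrite /= x'n.
by apply: step => //=; rewrite x'n -hn.
Qed.

End Counting.

Lemma def_counts t V C (A B : forall e, den e t -> den e V -> Prop)
    (k : forall e, den e t -> den e C) :
  @definable (Pair t V) (fun e z => A e (p1 z) (p2 z)) ->
  @definable (Pair t V) (fun e z => B e (p1 z) (p2 z)) ->
  term k -> definable (fun e x => counts (A e x) (B e x) (k e x)).
Proof.
move=> dA dB tk.
have dS s (f : forall e, den e s -> den e t) (g : forall e, den e s -> den e V)
    (h h' : forall e, den e s -> den e C) : term f -> term g -> term h -> term h' ->
    definable (fun e x => tally_step (A e (f e x)) (B e (f e x)) (g e x) (h e x) (h' e x)).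
  move=> tf tg th th'; apply: def_or; apply: def_and.
  - exact: (def_comp (f := fun e x => pr (f e x) (g e x)) dA (term_pr tf tg)).
  - exact: def_rankS.
  - exact: (def_comp (f := fun e x => pr (f e x) (g e x)) dB (term_pr tf tg)).
  - exact: def_eq.
do 4!apply: def_exists.
apply: def_and; first by apply: def_rank0; solve_term.
apply: def_and; first by apply: def_rank0; solve_term.
apply: def_and; first by apply: def_rank_last; solve_term.
apply: def_and; last by apply: dS; solve_term.
apply: def_rtc; [|solve_term..].
by apply: def_and; [apply: def_rankS|apply: dS]; solve_term.
Qed.

Section InductiveCounting.

Variables (e : env) (V : ty) (E nE : den e V -> den e V -> Prop) (s : den e V).

(** A step may stay in place, so walks of length exactly [rank i] cover all shorter ones. The length
    is kept in a second vertex, read as a number. *)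
Definition within (i y : den e V) : Prop := exists i0 : den e V, rank i0 = 0 /\
  rtc (fun a b : den e (Pair V V) => rank (p2 b) = (rank (p2 a)).+1 /\
         (p1 a = p1 b \/ E (p1 a) (p1 b)))
      (pr s i0) (pr y i).

(* When [c] is the number of vertices within distance [i] of [s], this certifies
   that [y] is farther than [i.+1]: [c] vertices within distance [i] are neither
   equal nor adjacent to [y], hence none is. *)
Definition far (i : den e V) (c : den e (Pair Reg V)) (y : den e V) : Prop :=
  counts (fun x => within i x /\ (x <> y /\ nE x y)) (fun x => x = x) c.

(** The count starts at one, for [s] itself. Counters live in [Pair Reg V] because the number of all
    vertices exceeds the rank of every vertex. *)
Definition census (i : den e V) (c : den e (Pair Reg V)) : Prop :=
  exists (i0 : den e V) (c0 c1 : den e (Pair Reg V)),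
    rank i0 = 0 /\ (rank c0 = 0 /\ (rank c1 = (rank c0).+1 /\
    rtc (fun a b : den e (Pair V (Pair Reg V)) => rank (p1 b) = (rank (p1 a)).+1 /\
           counts (fun y => within (p1 b) y) (fun y => far (p1 a) (p2 a) y) (p2 b))
        (pr i0 c1) (pr i c))).

Definition unreached (y : den e V) : Prop := exists (i : den e V) (c : den e (Pair Reg V)),
  (rank i).+1 = ty_size e V /\ (census i c /\ far i c y).

Fixpoint layer n : {set den e V} :=
  if n is n'.+1 then layer n' :|: [set y | `[< exists2 x, x \in layer n' & E x y >]]
  else [set s].

Lemma layer_next n y : y \in layer n.+1 <->
  exists2 x, x \in layer n & x = y \/ E x y.
Proof.
rewrite /= !inE; split=> [/orP[yn|/asboolP[x xn xy]]|[x xn [<-|xy]]].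
- by exists y => //; left.
- by exists x => //; right.
- by rewrite xn.
- by apply/orP; right; apply/asboolP; exists x.
Qed.

Lemma withinP i y : within i y <-> y \in layer (rank i).
Proof.
split=> [[i0 [i00 r]]|].
  pose I (a : den e (Pair V V)) := p1 a \in layer (rank (p2 a)).
  apply: (rtc_inv (P := I) _ _ r); last by rewrite /I /= i00 inE.
  move=> a b aI [bE ab]; rewrite /I bE; apply/layer_next; exists (p1 a) => //.
move hn : (rank i) => n; elim: n i y hn => [|n IH] i y hn.
  by rewrite inE => /eqP->; exists i; split=> //; apply: rt_refl.
have [|j jn] := @rank_surj e V n; first by apply: leq_trans (rank_lt i); rewrite hn.
move=> /layer_next[x xn xy]; have [i0 [i00 r]] := IH j x jn xn.
by exists i0; split=> //; apply: rtc_rcons r _; rewrite /= jn.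
Qed.

Lemma layer_reach n y : y \in layer n -> rtc E s y.
Proof.
elim: n y => [|n IH] y; first by rewrite inE => /eqP->; apply: rt_refl.
by move=> /layer_next[x /IH sx [<-//|xy]]; apply: rtc_rcons sx xy.
Qed.

(** A path without repeated vertices has fewer edges than there are vertices, so the layer for the
    last rank contains everything reachable. *)
Lemma layer_all n y : #|den e V| <= n.+1 -> rtc E s y -> y \in layer n.
Proof.
move=> Vn sy; pose R : rel (den e V) := fun x y => `[< E x y >].
have : connect R s y.
  apply: (rtc_inv (P := fun y => connect R s y) _ _ sy); last exact: connect0.
  by move=> a b sa ab; apply: connect_trans sa (connect1 _); apply/asboolP.
case/connectP=> p0 /shortenP[p sp up _ {p0}] ->.
have : size p <= n.
  rewrite -ltnS -[(size p).+1]/(size (s :: p)) -(card_uniqP up).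
  exact: leq_trans (max_card _) Vn.
elim/last_ind: p n sp {up Vn} => [|p x IH] n; first by elim: n => [|n IH] _ _; rewrite /= inE ?IH.
rewrite rcons_path size_rcons last_rcons => /andP[/IH sp /asboolP xy].
case: n => // n pn; apply/layer_next; exists (last s p); [exact: sp|by right].
Qed.

(* Only required on reachable vertices, since for a malformed vertex both
   [E x y] and [nE x y] may fail. *)
Hypothesis nEP : forall x, rtc E s x -> forall y, nE x y <-> ~ E x y.

Lemma farP i c y : rank c = #|layer (rank i)| ->
  far i c y <-> y \notin layer (rank i).+1.
Proof.
move=> cE; rewrite /far countsP; split=> [[U [UA _ Uc]]|yn].
  (* The certified vertices lie in the layer and are as many as it has, so no vertex can have been
     omitted. *)
  have UE : U = layer (rank i).
    apply/eqP; rewrite eqEcard Uc cE leqnn andbT; apply/subsetP=> x /UA[].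
    by move=> /withinP.
  apply/negP=> /layer_next[x xi xy]; have [|_ [nxy nE_xy]] := UA x; first by rewrite UE.
  by case: xy => // xy; apply: ((nEP (layer_reach xi) y).1 nE_xy).
exists (layer (rank i)); split=> // x xi; split; first exact/withinP.
split=> [xy|]; first by move/negP: yn; apply; apply/layer_next; exists x => //; left.
apply/(nEP (layer_reach xi)) => xy.
by move/negP: yn; apply; apply/layer_next; exists x => //; right.
Qed.

Lemma layer_count n : exists c : den e (Pair Reg V), rank c = #|layer n|.
Proof.
apply: rank_surj => /=; apply: leq_ltn_trans (max_card _) _; rewrite card_den.
have := ty_size_gt0 e V; have := word_small e; nia.
Qed.

(** A correct count for one distance makes [far] the exact complement of the next layer, and then
    [counts] leaves no freedom for the next count. *)
Lemma censusP i c : census i c <-> rank c = #|layer (rank i)|.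
Proof.
split=> [[i0 [c0 [c1 [i00 [c00 [c1S r]]]]]]|].
  pose I (a : den e (Pair V (Pair Reg V))) := rank (p2 a) = #|layer (rank (p1 a))|.
  apply: (rtc_inv (P := I) _ _ r); last by rewrite /I i00 c1S c00 cards1.
  move=> a b aI [bE]; rewrite countsP => -[U [UA UB Uc]]; rewrite /I -Uc.
  congr #|pred_of_set _|; apply/setP=> y; apply/idP/idP => [/UA/withinP //|].
  by apply: contraTT => /UB /(farP _ aI); rewrite bE.
move hn : (rank i) => n; elim: n i c hn => [|n IH] i c hn cE.
  have [c0 c00] := rank_surj (ty_size_gt0 e (Pair Reg V)).
  exists i, c0, c; rewrite cE c00 cards1; do 3?[split=> //]; exact: rt_refl.
have [|j jn] := @rank_surj e V n; first by apply: leq_trans (rank_lt i); rewrite hn.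
have [d dE] := layer_count n.
have [i0 [c0 [c1 [i00 [c00 [c1S r]]]]]] := IH j d jn dE.
exists i0, c0, c1; do 3?[split=> //]; apply: rtc_rcons r _.
split; first by rewrite /= jn.
apply/countsP; exists (layer (rank i)); split.
- by move=> y yi; apply/withinP.
- by move=> y; rewrite hn => yi; apply/farP; rewrite ?jn.
- by rewrite hn cE.
Qed.

Lemma unreachedP y : unreached y <-> ~ rtc E s y.
Proof.
have V0 := ty_size_gt0 e V.
split=> [[i [c [iV [/censusP cE /(farP _ cE) yn]]]]|ny].
  by move=> sy; move/negP: yn; apply; apply: layer_all sy; rewrite card_den -iV leqW.
have [|i iV] := @rank_surj e V (ty_size e V).-1; first by rewrite prednK.
have [c cE] := layer_count (rank i).
exists i, c; split; first by rewrite iV prednK.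
split; first exact/censusP.
by apply/farP => //; apply/negP=> /layer_reach.
Qed.

End InductiveCounting.

Lemma def_unreached t V (E nE : forall e, den e t -> den e V -> den e V -> Prop)
    (s y : forall e, den e t -> den e V) :
  @definable (Pair t (Pair V V)) (fun e z => E e (p1 z) (p1 (p2 z)) (p2 (p2 z))) ->
  @definable (Pair t (Pair V V)) (fun e z => nE e (p1 z) (p1 (p2 z)) (p2 (p2 z))) ->
  term s -> term y ->
  definable (fun e x => unreached (E e x) (nE e x) (s e x) (y e x)).
Proof.
move=> dE dN ts ty_.
have dE' r (f : forall e, den e r -> den e t) (g h : forall e, den e r -> den e V) :
    term f -> term g -> term h -> definable (fun e x => E e (f e x) (g e x) (h e x)).
  move=> tf tg th.
  exact: (def_comp (f := fun e x => pr (f e x) (pr (g e x) (h e x))) dE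
           (term_pr tf (term_pr tg th))).
have dN' r (f : forall e, den e r -> den e t) (g h : forall e, den e r -> den e V) :
    term f -> term g -> term h -> definable (fun e x => nE e (f e x) (g e x) (h e x)).
  move=> tf tg th.
  exact: (def_comp (f := fun e x => pr (f e x) (pr (g e x) (h e x))) dN
           (term_pr tf (term_pr tg th))).
have dW r (f : forall e, den e r -> den e t) (i z : forall e, den e r -> den e V) :
    term f -> term i -> term z ->
    definable (fun e x => within (E e (f e x)) (s e (f e x)) (i e x) (z e x)).
  move=> tf ti tz; apply: def_exists; apply: def_and; first by apply: def_rank0; solve_term.
  apply: def_rtc; [|solve_term..].
  apply: def_and; first by apply: def_rankS; solve_term.
  by apply: def_or; [apply: def_eq|apply: dE']; solve_term.
have dF r (f : forall e, den e r -> den e t) (i z : forall e, den e r -> den e V)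
    (c : forall e, den e r -> den e (Pair Reg V)) :
    term f -> term i -> term c -> term z ->
    definable (fun e x => far (E e (f e x)) (nE e (f e x)) (s e (f e x)) (i e x) (c e x) (z e x)).
  move=> tf ti tc tz; apply: def_counts; [|by apply: def_eq; solve_term|by []].
  apply: def_and; first by apply: dW; solve_term.
  by apply: def_and; [apply: def_neq|apply: dN']; solve_term.
do 2!apply: def_exists.
apply: def_and; first by apply: def_rank_last; solve_term.
apply: def_and; last by apply: dF; solve_term.
do 3!apply: def_exists.
apply: def_and; first by apply: def_rank0; solve_term.
apply: def_and; first by apply: def_rank0; solve_term.
apply: def_and; first by apply: def_rankS; solve_term.
apply: def_rtc; [|solve_term..].
apply: def_and; first by apply: def_rankS; solve_term.
by apply: def_counts; [apply: dW|apply: dF|]; solve_term.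
Qed.

(** * Reading the input *)

Lemma trunc_log2_double m (b : bool) : 0 < m ->
  trunc_log 2 (b + m.*2) = (trunc_log 2 m).+1.
Proof.
move=> m0; apply: trunc_log_eq => //.
by have /andP[] := trunc_log_bounds (isT : 1 < 2) m0; rewrite !expnS; case: b; lia.
Qed.

Lemma binary1 : binary 1 = [:: true].
Proof. by []. Qed.

(** Horner's rule: reading one more digit doubles the value and adds the digit. *)
Lemma binary_double m (b : bool) : 0 < m ->
  binary (b + m.*2) = rcons (binary m) b.
Proof.
move=> m0; rewrite /binary trunc_log2_double // -rev_cons; congr rev.
move: (trunc_log 2 m).+1 => n.
rewrite -[iota 0 n.+1]/(0 :: iota (1 + 0) n) map_cons expn0 divn1 oddD.
rewrite odd_double addbF oddb; congr cons; rewrite iotaDl -map_comp; apply: eq_map => j /=.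
by rewrite add1n expnS divnMA divn2 half_bit_double.
Qed.

Lemma binary_ind (R : nat -> Prop) : R 1 ->
  (forall m (b : bool), 0 < m -> R m -> R (b + m.*2)) -> forall v, 0 < v -> R v.
Proof.
move=> R1 RS v; elim/ltn_ind: v => v IH v0.
case: (ltngtP v 1) => [|v1|->//]; first by lia.
by rewrite -[v]odd_double_half; apply: RS; [|apply: IH]; lia.
Qed.

Lemma binary_inj u v : 0 < u -> 0 < v -> binary u = binary v -> u = v.
Proof.
move=> + v0; elim/binary_ind: v0 u => [|m b m0 IH] u u0;
  elim/binary_ind: u0 => [//|m' b' m'0 _].
- by rewrite binary1 binary_double // => /(congr1 size);
    rewrite size_rcons size_rev size_map size_iota.
- by rewrite binary1 binary_double // => /(congr1 size);
    rewrite size_rcons size_rev size_map size_iota.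
- by rewrite !binary_double // => /rcons_inj[/IH-> // ->].
Qed.

Definition encode_nat v : seq symbol := rcons (map Bit (binary v)) Comma.

(** The final comma makes the numerals a prefix code: in a letter by letter comparison neither list
    of bits can end before the other. *)
Lemma encode_nat_inj u v x y : 0 < u -> 0 < v ->
  encode_nat u ++ x = encode_nat v ++ y -> u = v.
Proof.
rewrite /encode_nat !cat_rcons => u0 v0 uv; apply: binary_inj => //.
elim: (binary u) (binary v) uv => [|b l IH] [|b' l'] //= [-> /IH->] //.
Qed.

Section Segments.

Variable w : seq symbol.

(** Comparing suffixes makes adjacent segments compose by associativity. The equation for [q] fixes
    it past the end of the word as well, where all suffixes are empty. *)
Definition seg p q (x : seq symbol) := drop p w = x ++ drop q w /\ q = p + size x.

Lemma seg_nil p : seg p p [::].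
Proof. by rewrite /seg addn0. Qed.

Lemma seg_cat p q r x y : seg p q x -> seg q r y -> seg p r (x ++ y).
Proof. by move=> [px qE] [qy rE]; rewrite /seg px qy catA size_cat addnA -qE -rE. Qed.

Lemma seg_split p r x y : seg p r (x ++ y) ->
  seg p (p + size x) x /\ seg (p + size x) r y.
Proof.
move=> [xy rE]; subst r; rewrite /seg; move: xy; rewrite size_cat addnA => xy.
have -> : drop (p + size x) w = y ++ drop (p + size x + size y) w.
  by have := congr1 (drop (size x)) xy; rewrite drop_drop -catA drop_size_cat // addnC.
by rewrite xy -catA.
Qed.

Lemma seg1 p a : onth w p = Some a <-> seg p p.+1 [:: a].
Proof.
rewrite /seg addn1; split=> [pa|[+ _]].
  split=> //; have pw : p < size w by rewrite -onthTE pa.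
  by rewrite (drop_nth a pw); move: pa; rewrite onthE (nth_map a) // => -[->].
move=> H; have pw : p < size w.
  by have := congr1 size H; rewrite size_drop /=; lia.
by have := drop_nth a pw; rewrite H onthE (nth_map a) // => -[<-].
Qed.

Lemma seg_rcons p q x a : seg p q.+1 (rcons x a) <-> seg p q x /\ onth w q = Some a.
Proof.
rewrite seg1 -cats1; split=> [H|[]]; last exact: seg_cat.
have [] := seg_split H; case: H => _; rewrite size_cat addnA addn1 => -[<-].
by [].
Qed.

Lemma seg_le p q x : seg p q x -> p <= q.
Proof. by move=> [_ ->]; apply: leq_addr. Qed.

Lemma seg_fun p q q' x : seg p q x -> seg p q' x -> q = q'.
Proof. by move=> [_ ->] [_ ->]. Qed.

End Segments.

Lemma seg_encode_nat_inj w p q q' u v : 0 < u -> 0 < v ->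
  seg w p q (encode_nat u) -> seg w p q' (encode_nat v) -> q = q' /\ u = v.
Proof.
move=> u0 v0 su sv; have uv : u = v.
  by case: su sv => + _ [+ _] => ->; apply: encode_nat_inj.
by subst v; split=> //; apply: seg_fun su sv.
Qed.

Section Parsing.

Variable e : env.
Local Notation w := (word e).

Definition letter a (p : den e Reg) := onth w (nat_of p) = Some a.

(** Doubling as the closure of (x, y) to (x + 1, y + 2), the successor being the only arithmetic at
    hand. *)
Definition twice (x y : den e Reg) : Prop := exists z : den e Reg, nat_of z = 0 /\
  rtc (fun a b : den e (Pair Reg Reg) => nat_of (p1 b) = (nat_of (p1 a)).+1 /\
         exists u : den e Reg, nat_of u = (nat_of (p2 a)).+1 /\ nat_of (p2 b) = (nat_of u).+1)
      (pr z z) (pr x y).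

Lemma twiceP x y : twice x y <-> nat_of y = (nat_of x).*2.
Proof.
split=> [[z [z0 r]]|].
  pose I (a : den e (Pair Reg Reg)) := nat_of (p2 a) = (nat_of (p1 a)).*2.
  apply: (rtc_inv (P := I) _ _ r); last by rewrite /I z0.
  by move=> a b aI [b1 [u [uE b2]]]; rewrite /I b2 uE aI b1 doubleS.
move hn : (nat_of x) => n; elim: n x y hn => [|n IH] x y hn yE.
  exists x; split=> //; have -> : y = x by apply: nat_of_inj; rewrite yE hn.
  exact: rt_refl.
have [|x' x'n] := @nat_of_surj e n; first by apply: leq_trans (nat_of_lt x); rewrite hn.
have [|y' y'n] := @nat_of_surj e n.*2; first by apply: leq_trans (nat_of_lt y); rewrite yE; lia.
have [|u un] := @nat_of_surj e n.*2.+1; first by apply: leq_trans (nat_of_lt y); rewrite yE; lia.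
have [z [z0 r]] := IH x' y' x'n y'n; exists z; split=> //; apply: rtc_rcons r _.
by split; [rewrite /= x'n|exists u; rewrite /= y'n un yE doubleS].
Qed.

Definition digit (a b : den e (Pair Reg Reg)) : Prop :=
  nat_of (p1 b) = (nat_of (p1 a)).+1 /\
  (letter (Bit false) (p1 a) /\ twice (p2 a) (p2 b) \/
   letter (Bit true) (p1 a) /\ exists u, twice (p2 a) u /\ nat_of (p2 b) = (nat_of u).+1).

Lemma digitP a b : digit a b <-> nat_of (p1 b) = (nat_of (p1 a)).+1 /\
  exists d : bool, letter (Bit d) (p1 a) /\ nat_of (p2 b) = d + (nat_of (p2 a)).*2.
Proof.
split=> -[b1 H]; (split; first by []).
  case: H => [[l /twiceP t]|[l [u [/twiceP t uE]]]]; first by exists false.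
  by exists true; rewrite uE t.
case: H => -[] [l bE]; [right|left]; split=> //; last exact/twiceP.
have [|u uE] := @nat_of_surj e (nat_of (p2 a)).*2.
  by apply: leq_trans (nat_of_lt (p2 b)); rewrite bE.
by exists u; rewrite uE bE; split=> //; apply/twiceP.
Qed.

(* The numeral of [v], without leading zeros, starts at [p]; its comma is at [q - 1]. *)
Definition number (p q v : den e Reg) : Prop := exists p' z one q' : den e Reg,
  letter (Bit true) p /\ (nat_of p' = (nat_of p).+1 /\
  (nat_of z = 0 /\ (nat_of one = (nat_of z).+1 /\
  (rtc digit (pr p' one) (pr q' v) /\ (letter Comma q' /\ nat_of q = (nat_of q').+1))))).

(** During the scan the letters read since [p] are the numeral of the accumulated value. The
    obligatory leading one both excludes leading zeros and starts the accumulator at 1. *)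
Lemma numberP p q v : number p q v <->
  0 < nat_of v /\ seg w (nat_of p) (nat_of q) (encode_nat (nat_of v)).
Proof.
split=> [[p' [z [one [q' [lp [p'E [z0 [oneE [r [lq ->]]]]]]]]]]|[v0 sv]].
  pose I (a : den e (Pair Reg Reg)) := 0 < nat_of (p2 a) /\
    seg w (nat_of p) (nat_of (p1 a)) (map Bit (binary (nat_of (p2 a)))).
  have [] : I (pr q' v); last by move=> v0 sv; split=> //; apply/seg_rcons.
  apply: (rtc_inv (P := I) _ _ r); last first.
    by rewrite /I /= oneE z0 p'E; split=> //; apply/seg1.
  move=> a b [a0 sa] /digitP[b1 [d [la b2]]]; rewrite /I b1 b2.
  split; first by case: (d) => //; lia.
  by rewrite binary_double // map_rcons; apply/seg_rcons.
have [|q' q'E] := @nat_of_surj e (nat_of q).-1; first by apply: leq_ltn_trans (nat_of_lt q); lia.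
have qE : nat_of q = (nat_of q').+1.
  by case: sv => _; rewrite q'E /encode_nat size_rcons addnS => ->.
move: sv; rewrite qE => /seg_rcons[sv lq].
have [z z0] := @nat_of_surj e 0 (ltac:(by rewrite expn_gt0)).
have [one oneE] := @nat_of_surj e 1 (leq_ltn_trans v0 (nat_of_lt v)).
suff [p' [lp [p'E r]]] : exists p', letter (Bit true) p /\
    (nat_of p' = (nat_of p).+1 /\ rtc digit (pr p' one) (pr q' v)).
  by exists p', z, one, q'; rewrite z0 qE; do 6?[split=> //].
move: {lq qE q'E q} q' sv.
move hn : (nat_of v) v0 => n n0; elim/binary_ind: n0 v hn => [|m b m0 IH] v hn q sv.
  exists q; rewrite binary1 in sv.
  have qE : nat_of q = (nat_of p).+1 by case: sv => _ ->; rewrite addn1.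
  split; first by apply/seg1; rewrite -qE.
  split=> //; have -> : v = one by apply: nat_of_inj; rewrite hn.
  exact: rt_refl.
rewrite binary_double // map_rcons in sv.
have qE : nat_of q = (nat_of q).-1.+1.
  by case: sv => _ ->; rewrite size_rcons addnS.
have [|q' q'E] := @nat_of_surj e (nat_of q).-1; first by apply: leq_ltn_trans (nat_of_lt q); lia.
have [|u uE] := @nat_of_surj e m; first by apply: leq_ltn_trans (nat_of_lt v); rewrite hn; lia.
rewrite qE -q'E in sv; have /seg_rcons[sv' l] := sv.
have [p' [lp [p'E r]]] := IH u uE q' sv'; exists p'; split=> //; split=> //.
apply: rtc_rcons r _; apply/digitP; rewrite /= q'E -qE; split=> //.
by exists b; rewrite hn uE.
Qed.

End Parsing.

(** * Rows of the input as tables of transformations *)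

Definition values m (l : seq 'I_m) : seq symbol := flatten (map (@encode_value m) l).

Definition tables m (l : seq (transf m)) : seq symbol :=
  flatten (map (@encode_table m) l).

Lemma encode_tableE m (s : transf m) :
  encode_table s = rcons (values [seq s x | x <- enum 'I_m]) Semicolon.
Proof. by rewrite /values -map_comp. Qed.

Lemma size_flatten_map (T U : Type) (f : T -> seq U) (l : seq T) :
  (forall x, 0 < size (f x)) -> size l <= size (flatten (map f l)).
Proof.
move=> f0; elim: l => //= x l IH; rewrite size_cat.
by have := f0 x; lia.
Qed.

Lemma size_values m (l : seq 'I_m) : size l <= size (values l).
Proof. by apply: size_flatten_map => x; rewrite size_rcons. Qed.

Lemma size_encode n k (a : k.-tuple (transf n)) : 0 < k -> n <= size (encode a).
Proof.
case: k a => // k a _; rewrite (tuple_eta a) /encode /= size_cat encode_tableE.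
rewrite size_rcons; have := size_values [seq thead a x | x <- enum 'I_n].
by rewrite size_map size_enum_ord; lia.
Qed.

Section Rows.

Variables (e : env) (n : den e Reg).
Local Notation w := (word e).
Local Notation m := (nat_of n).

Definition row_step (a b : den e (Pair Reg Reg)) : Prop :=
  nat_of (p2 b) = (nat_of (p2 a)).+1 /\
  exists v : den e Reg, number (p1 a) (p1 b) v /\ nat_of v <= m.

(* In the row starting at [g], the value number [x] starts at [p]. *)
Definition cells (g x p : den e Reg) : Prop := exists z : den e Reg,
  nat_of z = 0 /\ rtc row_step (pr g z) (pr p x).

Definition row (g h : den e Reg) : Prop := exists p : den e Reg,
  cells g n p /\ (letter Semicolon p /\ nat_of h = (nat_of p).+1).

Definition row_maps (g x y : den e Reg) : Prop := exists p q v : den e Reg,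
  cells g x p /\ (nat_of x < m /\ (number p q v /\ nat_of v = (nat_of y).+1)).

Definition well_formed : Prop := exists z h : den e Reg,
  nat_of z = 0 /\ (nat_of z < m /\ (nat_of h = size w /\
  (nat_of z < nat_of h /\ rtc row z h))).

(** Nothing is known about the word yet: the successful scan itself yields the values. [cells_exact]
    is the counterpart inside a row already known to be a table. *)
Lemma cells_sound g x p : cells g x p -> exists2 l : seq 'I_m,
  size l = nat_of x & seg w (nat_of g) (nat_of p) (values l).
Proof.
move=> [z [z0 r]].
pose I (a : den e (Pair Reg Reg)) := exists2 l : seq 'I_m,
  size l = nat_of (p2 a) & seg w (nat_of g) (nat_of (p1 a)) (values l).
apply: (rtc_inv (P := I) _ _ r); last by exists [::] => //; apply: seg_nil.
move=> a b [l lE sl] [b2 [v [/numberP[v0 sv] vm]]].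
have vm' : (nat_of v).-1 < m by rewrite prednK.
exists (rcons l (Ordinal vm')); first by rewrite size_rcons lE b2.
rewrite /values map_rcons flatten_rcons; apply: seg_cat sl _.
by rewrite /encode_value /= prednK.
Qed.

Lemma row_sound g h : row g h -> exists s : transf m,
  seg w (nat_of g) (nat_of h) (encode_table s).
Proof.
move=> [p [/cells_sound[l lm sl] [ls hE]]].
pose t : m.-tuple 'I_m := tcast lm (in_tuple l).
exists [ffun x => tnth t x]; rewrite encode_tableE hE; apply/seg_rcons; split=> //.
rewrite (eq_map (g := tnth t)) => [|x]; last by rewrite ffunE.
by rewrite map_tnth_enum val_tcast.
Qed.

Lemma rows_sound g h : rtc row g h -> exists l : seq (transf m),
  seg w (nat_of g) (nat_of h) (tables l).
Proof.
move=> r; pose I (h : den e Reg) := exists l : seq (transf m), seg w (nat_of g) (nat_of h) (tables l).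
apply: (rtc_inv (P := I) _ _ r); last by exists [::]; apply: seg_nil.
move=> a b [l sl] /row_sound[s ss]; exists (rcons l s).
by rewrite /tables map_rcons flatten_rcons; apply: seg_cat sl ss.
Qed.

Lemma well_formed_sound : well_formed -> exists k (a : k.-tuple (transf m)),
  [/\ 0 < m, 0 < k & w = encode a].
Proof.
move=> [z [h [z0 [zm [hE [zh /rows_sound[l [lE hl]]]]]]]].
exists (size l), (in_tuple l); split; first by rewrite -z0.
  by case: l lE hl => // _ /= hl; move: zh; rewrite hl addn0 ltnn.
by rewrite z0 drop0 hE drop_size cats0 in lE.
Qed.

Section Table.

Variables (g h : den e Reg) (s : transf m).
Hypothesis table : seg w (nat_of g) (nat_of h) (encode_table s).
Local Notation L := [seq s x | x <- enum 'I_m].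

Lemma size_L : size L = m.
Proof. by rewrite size_map size_enum_ord. Qed.

Lemma table_end : exists p : den e Reg, [/\ nat_of h = (nat_of p).+1,
  seg w (nat_of g) (nat_of p) (values L) & letter Semicolon p].
Proof.
have hE : nat_of h = (nat_of h).-1.+1.
  by case: table => _ ->; rewrite size_rcons addnS.
have [|p pE] := @nat_of_surj e (nat_of h).-1; first by apply: leq_ltn_trans (nat_of_lt h); lia.
exists p; move: table; rewrite hE -pE encode_tableE /letter => /seg_rcons[? ?].
by split.
Qed.

Lemma table_value (p : den e Reg) (i : 'I_m) :
  seg w (nat_of g) (nat_of p) (values (take i L)) -> exists2 q : den e Reg,
  seg w (nat_of p) (nat_of q) (encode_value (s i)) &
  seg w (nat_of g) (nat_of q) (values (take i.+1 L)).
Proof.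
move=> sp; have iL : i < size L by rewrite size_L.
have LE : take i.+1 L = rcons (take i L) (s i).
  by rewrite (take_nth (s i)) // (nth_map i) ?size_enum_ord // nth_ord_enum.
have [p' [hE sL _]] := table_end.
move: sL; rewrite -{1}(cat_take_drop i.+1 L) /values map_cat flatten_cat LE.
rewrite map_rcons flatten_rcons => /seg_split[sq sr]; have /seg_split[_ sq'] := sq.
have [|q qE] := @nat_of_surj e (nat_of g + size (values (rcons (take i L) (s i)))).
  apply: leq_ltn_trans (nat_of_lt p'); apply: leq_trans (seg_le sr).
  by rewrite /values map_rcons flatten_rcons.
by exists q; rewrite qE /values map_rcons flatten_rcons //; case: sp => _ ->.
Qed.

Lemma cells_exact x p : cells g x p <->
  nat_of x <= m /\ seg w (nat_of g) (nat_of p) (values (take (nat_of x) L)).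
Proof.
split=> [[z [z0 r]]|].
  pose I (a : den e (Pair Reg Reg)) := nat_of (p2 a) <= m /\
    seg w (nat_of g) (nat_of (p1 a)) (values (take (nat_of (p2 a)) L)).
  apply: (rtc_inv (P := I) _ _ r); last first.
    by rewrite /I /= z0 take0; split=> //; apply: seg_nil.
  move=> a b [am sa] [b2 [v [/numberP[v0 sv] vm]]]; rewrite /I b2.
  move: am; rewrite leq_eqVlt => /orP[/eqP am|am].
    (* After all [m] values the next letter is the semicolon, and no numeral starts with it. *)
    have [p' [_ sL /seg1[lS _]]] := table_end.
    rewrite take_oversize ?size_L ?am // in sa.
    have pp : nat_of (p1 a) = nat_of p' by case: sa sL => _ -> [_ ->].
    move: sv; rewrite pp => -[]; rewrite lS /encode_nat.
    by case: (binary _).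
  split=> //; have [q sq sgq] := @table_value (p1 a) (Ordinal am) sa.
  have [qE _] := seg_encode_nat_inj v0 (ltn0Sn _) sv sq.
  by rewrite qE.
move hx : (nat_of x) => i; elim: i x hx p => [|i IH] x hx p [im sp].
  exists x; split=> //; have -> : p = g.
    by apply: nat_of_inj; case: sp => _ ->; rewrite take0 addn0.
  exact: rt_refl.
have [|y yE] := @nat_of_surj e i; first by apply: leq_trans (nat_of_lt x); rewrite hx.
have [p' [_ sL _]] := table_end.
have spl : seg w (nat_of g) (nat_of g + size (values (take i L))) (values (take i L)).
  move: sL; rewrite -{1}(cat_take_drop i L) /values map_cat flatten_cat.
  by case/seg_split.
have [|u uE] := @nat_of_surj e (nat_of g + size (values (take i L))).
  apply: leq_ltn_trans (nat_of_lt p'); case: sL => _ ->; rewrite leq_add2l.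
  by rewrite -{2}(cat_take_drop i L) /values map_cat flatten_cat size_cat leq_addr.
rewrite -uE in spl; have [z [z0 r]] := IH y yE u (conj (ltnW im) spl).
have [q sq sgq] := @table_value u (Ordinal im) spl.
have qp : q = p by apply: nat_of_inj; apply: seg_fun sgq sp.
subst q; exists z; split=> //; apply: rtc_rcons r _; split; first by rewrite /= hx yE.
have [|v vE] := @nat_of_surj e (s (Ordinal im)).+1.
  by apply: leq_ltn_trans (nat_of_lt n); apply: ltn_ord.
by exists v; rewrite vE; split=> //; apply/numberP; rewrite vE.
Qed.

Lemma row_exact h' : row g h' <-> h' = h.
Proof.
have [p [hE sL lp]] := table_end.
split=> [[q [/cells_exact[_ sq] [lq h'E]]]|->].
  apply: nat_of_inj; rewrite h'E hE; congr _.+1.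
  by rewrite take_oversize ?size_L // in sq; apply: seg_fun sq sL.
exists p; split; last by [].
by apply/cells_exact; rewrite take_oversize ?size_L.
Qed.

Lemma row_maps_exact x y : row_maps g x y <->
  exists i : 'I_m, nat_of x = i /\ nat_of y = s i.
Proof.
split=> [[p [q [v [/cells_exact[_ sp] [xm [/numberP[v0 sv] vE]]]]]]|[i [xi yi]]].
  exists (Ordinal xm); split=> //.
  have [q' sq _] := @table_value p (Ordinal xm) sp.
  have [_ E] := seg_encode_nat_inj v0 (ltn0Sn _) sv sq.
  by move: E; rewrite vE => -[].
have [p' [_ sL _]] := table_end.
have spl : seg w (nat_of g) (nat_of g + size (values (take i L))) (values (take i L)).
  move: sL; rewrite -{1}(cat_take_drop i L) /values map_cat flatten_cat.
  by case/seg_split.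
have [|u uE] := @nat_of_surj e (nat_of g + size (values (take i L))).
  apply: leq_ltn_trans (nat_of_lt p'); case: sL => _ ->; rewrite leq_add2l.
  by rewrite -{2}(cat_take_drop i L) /values map_cat flatten_cat size_cat leq_addr.
rewrite -uE in spl; have [q sq sgq] := @table_value u i spl.
have [|v vE] := @nat_of_surj e (s i).+1.
  by apply: leq_ltn_trans (nat_of_lt n); apply: ltn_ord.
exists u, q, v; split; first by apply/cells_exact; rewrite xi ltnW.
by rewrite xi vE yi; split=> //; split=> //; apply/numberP; rewrite vE.
Qed.

End Table.

(** A quantifier over the generators becomes a walk along the rows that tests [Q] at each start;
    arriving at the end of the word guarantees that no row was left out. *)
Definition each_row (Q : den e Reg -> Prop) : Prop := exists z h : den e Reg,
  nat_of z = 0 /\ (nat_of h = size w /\ rtc (fun g h => row g h /\ Q g) z h).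

Definition some_row (Q : den e Reg -> Prop) : Prop := exists z g h : den e Reg,
  nat_of z = 0 /\ (rtc row z g /\ (row g h /\ Q g)).

Section Encoded.

Variables (k : nat) (a : k.-tuple (transf m)).
Hypothesis wa : w = encode a.

Definition row_at i := size (tables (take i a)).

Lemma row_atS (i : 'I_k) : row_at i.+1 = row_at i + size (encode_table (tnth a i)).
Proof.
rewrite /row_at (take_nth (tnth a i)) ?size_tuple // /tables map_rcons.
by rewrite flatten_rcons size_cat -(tnth_nth (tnth a i)).
Qed.

Lemma row_at_end : row_at k = size w.
Proof. by rewrite /row_at -{1}(size_tuple a) take_size wa. Qed.

Lemma row_at_le i : row_at i <= size w.
Proof.
rewrite wa /row_at /encode -{2}(cat_take_drop i a) map_cat flatten_cat size_cat.
exact: leq_addr.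
Qed.

Lemma row_at_seg (i : 'I_k) : seg w (row_at i) (row_at i.+1) (encode_table (tnth a i)).
Proof.
have : seg w 0 (size w) (tables a).
  by rewrite /seg drop0 drop_size cats0 wa.
rewrite -(cat_take_drop i.+1 a) /tables map_cat flatten_cat.
rewrite (take_nth (tnth a i)) ?size_tuple // map_rcons flatten_rcons.
case/seg_split=> /seg_split[_ + _]; rewrite !add0n row_atS.
by rewrite size_cat -(tnth_nth (tnth a i)).
Qed.

Lemma row_at_den i : exists g : den e Reg, nat_of g = row_at i.
Proof.
by apply: nat_of_surj; have := row_at_le i; have := word_small e; lia.
Qed.

Lemma row_of (i : 'I_k) (g h : den e Reg) : nat_of g = row_at i ->
  row g h <-> nat_of h = row_at i.+1.
Proof.
move=> gE; have [h' h'E] := row_at_den i.+1.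
have := @row_exact g h' (tnth a i); rewrite gE h'E => /(_ (row_at_seg i)) ->.
by rewrite -h'E; split=> [->|/nat_of_inj].
Qed.

Lemma row_at_inv (Q : den e Reg -> Prop) (z g : den e Reg) : nat_of z = 0 ->
  rtc (fun g h => row g h /\ Q g) z g -> exists2 i, i <= k & nat_of g = row_at i /\
    forall (j : 'I_k) (h : den e Reg), j < i -> nat_of h = row_at j -> Q h.
Proof.
move=> z0 r; pose I (g : den e Reg) := exists2 i, i <= k & nat_of g = row_at i /\
    forall (j : 'I_k) (h : den e Reg), j < i -> nat_of h = row_at j -> Q h.
apply: (rtc_inv (P := I) _ _ r); last first.
  by exists 0 => //; rewrite z0 /row_at take0; split.
move=> b c [i + [bE bQ]] [bc Qb]; rewrite leq_eqVlt => /orP[/eqP ik|ik].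
  (* No row begins at the end of the word, since a row contains at least its semicolon. *)
  have [s [/(congr1 size)]] := row_sound bc; rewrite bE ik row_at_end size_cat !size_drop.
  by rewrite subnn size_rcons.
exists i.+1 => //; split; first exact/(@row_of (Ordinal ik) b c bE).
move=> j h; rewrite ltnS leq_eqVlt => /orP[/eqP ji hE|ji]; last exact: bQ.
by have -> : h = b by apply: nat_of_inj; rewrite hE bE ji.
Qed.

Lemma row_at_reach (Q : den e Reg -> Prop) (z : den e Reg) : nat_of z = 0 ->
  (forall (j : 'I_k) (h : den e Reg), nat_of h = row_at j -> Q h) ->
  forall i (g : den e Reg), i <= k -> nat_of g = row_at i ->
  rtc (fun g h => row g h /\ Q g) z g.
Proof.
move=> z0 HQ; elim=> [|i IH] g ik gE.
  have -> : g = z by apply: nat_of_inj; rewrite gE z0 /row_at take0.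
  exact: rt_refl.
have [b bE] := row_at_den i; apply: rtc_rcons (IH b (ltnW ik) bE) _; split.
  exact/(@row_of (Ordinal ik) b g bE).
exact: HQ (Ordinal ik) b bE.
Qed.

Lemma each_rowP Q : each_row Q <->
  forall (i : 'I_k) (g : den e Reg), nat_of g = row_at i -> Q g.
Proof.
split=> [[z [h [z0 [hE r]]]]|HQ].
  have [i ik [hi iQ]] := row_at_inv z0 r => j g; apply: iQ.
  move: ik; rewrite leq_eqVlt => /orP[/eqP->//|ik].
  have := row_atS (Ordinal ik); have := row_at_le i.+1; rewrite -hE hi /=.
  by rewrite size_rcons; lia.
have [z z0] := row_at_den 0; have [h hE] := row_at_den k.
exists z, h; split; first by rewrite z0 /row_at take0.
split; first by rewrite hE row_at_end.
by apply: row_at_reach hE => //; rewrite z0 /row_at take0.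
Qed.

Lemma some_rowP Q : some_row Q <->
  exists (i : 'I_k) (g : den e Reg), nat_of g = row_at i /\ Q g.
Proof.
have ext z g : rtc row z g <-> rtc (fun g h => row g h /\ True) z g.
  by split; apply: (rtc_map (f := id)) => b c; [|case]; move=> *; apply: rt_step.
split=> [[z [g [h [z0 [/ext r [gh Qg]]]]]]|[i [g [gE Qg]]]].
  have [i + [gE _]] := row_at_inv z0 r; rewrite leq_eqVlt => /orP[/eqP ik|ik].
    have [s [/(congr1 size)]] := row_sound gh; rewrite gE ik row_at_end size_cat !size_drop.
    by rewrite subnn size_rcons.
  by exists (Ordinal ik), g.
have [z z0] := row_at_den 0; have [h hE] := row_at_den i.+1.
have {}z0 : nat_of z = 0 by rewrite z0 /row_at take0.
exists z, g, h; split=> //; split; last by split=> //; apply/(row_of _ gE).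
by apply/ext; apply: row_at_reach gE => //; apply: ltnW.
Qed.

Lemma well_formed_complete : 0 < m -> 0 < k -> well_formed.
Proof.
move=> m0 k0; have [z z0] := row_at_den 0; have [h hE] := row_at_den k.
have {}z0 : nat_of z = 0 by rewrite z0 /row_at take0.
exists z, h; rewrite z0 hE row_at_end; do 3?[split=> //].
split; first by rewrite wa; exact: leq_trans m0 (size_encode a k0).
apply: (rtc_map (f := id)) (row_at_reach (Q := fun=> True) z0 _ (leqnn k) hE) => // b c [bc _].
exact: rt_step.
Qed.

Lemma row_maps_at (i : 'I_k) (g x y : den e Reg) : nat_of g = row_at i ->
  row_maps g x y <-> exists j : 'I_m, nat_of x = j /\ nat_of y = tnth a i j.
Proof.
move=> gE; have [h hE] := row_at_den i.+1.
by apply: (@row_maps_exact g h); rewrite gE hE; apply: row_at_seg.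
Qed.

End Encoded.

End Rows.

(** * Definability of the universal quantifier and of the parsing predicates *)

Lemma def_forall t s (Q : forall e, den e t -> den e s -> Prop) :
  @definable (Pair t s) (fun e z => Q e (p1 z) (p2 z)) ->
  definable (fun e x => forall u, Q e x u).
Proof.
(* [counts] visits every [u]; with an unsatisfiable first certificate each of them has to satisfy
   [Q], and the count is 0. *)
move=> dQ; apply: (def_ext (Q := fun e x => exists k : den e Reg,
  nat_of k = 0 /\ counts (fun u : den e s => u <> u) (Q e x) k)).
  apply: def_exists; apply: def_and; first by apply: def_zero; solve_term.
  apply: def_counts; last by solve_term.
    by apply: def_neq; solve_term.
  exact: (def_comp (f := fun e z => pr (p1 (p1 z)) (p2 z)) dQ (ltac:(solve_term))).
move=> e x; split=> [[k [_ /countsP[U [UA UB _]]]] u|HQ].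
  by apply: UB; apply/negP=> /UA.
have [k k0] := @nat_of_surj e 0 (ltac:(by rewrite expn_gt0)).
by exists k; split=> //; apply/countsP; exists set0; split=> [u|u|]; rewrite ?inE ?cards0.
Qed.

Lemma def_letter t a (f : forall e, den e t -> den e Reg) : term f ->
  definable (fun e x => letter a (f e x)).
Proof.
move=> tf; apply: def_ext (def_scan tf (Letter a)) _ => e x.
rewrite /letter /=; split=> [[_]|xa]; first by case: (onth _ _) => // b [->].
by rewrite xa; split=> //; rewrite ltnW // -onthTE xa.
Qed.

Lemma def_at_end t (f : forall e, den e t -> den e Reg) : term f ->
  definable (fun e x => nat_of (f e x) = size (word e)).
Proof.
move=> tf; apply: def_ext (def_scan tf RightEnd) _ => e x.
split=> [[fw /scan_end]|->]; last by split; rewrite //= onth_default.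
by rewrite ltnS => /(_ fw) [].
Qed.

Lemma def_twice t (f g : forall e, den e t -> den e Reg) : term f -> term g ->
  definable (fun e x => twice (f e x) (g e x)).
Proof.
move=> tf tg; apply: def_exists; apply: def_and; first by apply: def_zero; solve_term.
apply: def_rtc; [|solve_term..].
apply: def_and; first by apply: def_succ; solve_term.
by apply: def_exists; apply: def_and; apply: def_succ; solve_term.
Qed.

Lemma def_number t (p q v : forall e, den e t -> den e Reg) :
  term p -> term q -> term v -> definable (fun e x => number (p e x) (q e x) (v e x)).
Proof.
move=> tp tq tv; do 4!apply: def_exists.
apply: def_and; first by apply: def_letter; solve_term.
apply: def_and; first by apply: def_succ; solve_term.
apply: def_and; first by apply: def_zero; solve_term.
apply: def_and; first by apply: def_succ; solve_term.
apply: def_and; last by apply: def_and; [apply: def_letter|apply: def_succ]; solve_term.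
apply: def_rtc; [|solve_term..].
apply: def_and; first by apply: def_succ; solve_term.
apply: def_or; apply: def_and; try by apply: def_letter; solve_term.
  by apply: def_twice; solve_term.
by apply: def_exists; apply: def_and; [apply: def_twice|apply: def_succ]; solve_term.
Qed.

Lemma def_cells t (n g x p : forall e, den e t -> den e Reg) :
  term n -> term g -> term x -> term p ->
  definable (fun e z => cells (n e z) (g e z) (x e z) (p e z)).
Proof.
move=> tn tg tx tp; apply: def_exists; apply: def_and; first by apply: def_zero; solve_term.
apply: def_rtc; [|solve_term..].
apply: def_and; first by apply: def_succ; solve_term.
apply: def_exists; apply: def_and; first by apply: def_number; solve_term.
by apply: def_le; solve_term.
Qed.

Lemma def_row t (n g h : forall e, den e t -> den e Reg) :
  term n -> term g -> term h -> definable (fun e z => row (n e z) (g e z) (h e z)).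
Proof.
move=> tn tg th; apply: def_exists.
apply: def_and; first by apply: def_cells; solve_term.
by apply: def_and; [apply: def_letter|apply: def_succ]; solve_term.
Qed.

Lemma def_row_maps t (n g x y : forall e, den e t -> den e Reg) :
  term n -> term g -> term x -> term y ->
  definable (fun e z => row_maps (n e z) (g e z) (x e z) (y e z)).
Proof.
move=> tn tg tx ty_; do 3!apply: def_exists.
apply: def_and; first by apply: def_cells; solve_term.
apply: def_and; first by apply: def_lt; solve_term.
by apply: def_and; [apply: def_number|apply: def_succ]; solve_term.
Qed.

Lemma def_well_formed t (n : forall e, den e t -> den e Reg) :
  term n -> definable (fun e z => well_formed (n e z)).
Proof.
move=> tn; do 2!apply: def_exists.
apply: def_and; first by apply: def_zero; solve_term.
apply: def_and; first by apply: def_lt; solve_term.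
apply: def_and; first by apply: def_at_end; solve_term.
apply: def_and; first by apply: def_lt; solve_term.
by apply: def_rtc; [apply: def_row|..]; solve_term.
Qed.

Lemma def_each_row t (n : forall e, den e t -> den e Reg)
    (Q : forall e, den e t -> den e Reg -> Prop) : term n ->
  @definable (Pair t Reg) (fun e z => Q e (p1 z) (p2 z)) ->
  definable (fun e x => each_row (n e x) (Q e x)).
Proof.
move=> tn dQ; do 2!apply: def_exists.
apply: def_and; first by apply: def_zero; solve_term.
apply: def_and; first by apply: def_at_end; solve_term.
apply: def_rtc; [|solve_term..].
apply: def_and; first by apply: def_row; solve_term.
exact: (def_comp (f := fun e z => pr (p1 (p1 (p1 z))) (p1 (p2 z))) dQ (ltac:(solve_term))).
Qed.

Lemma def_some_row t (n : forall e, den e t -> den e Reg)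
    (Q : forall e, den e t -> den e Reg -> Prop) : term n ->
  @definable (Pair t Reg) (fun e z => Q e (p1 z) (p2 z)) ->
  definable (fun e x => some_row (n e x) (Q e x)).
Proof.
move=> tn dQ; do 3!apply: def_exists.
apply: def_and; first by apply: def_zero; solve_term.
apply: def_and; first by apply: def_rtc; [apply: def_row|..]; solve_term.
apply: def_and; first by apply: def_row; solve_term.
exact: (def_comp (f := fun e z => pr (p1 (p1 (p1 z))) (p2 (p1 z))) dQ (ltac:(solve_term))).
Qed.

(** * The action on quadruples of points *)

Definition V4 := Pair (Pair Reg Reg) (Pair Reg Reg).

Definition row_maps4 e (n g : den e Reg) (x y : den e V4) : Prop :=
  (row_maps n g (p1 (p1 x)) (p1 (p1 y)) /\ row_maps n g (p2 (p1 x)) (p2 (p1 y))) /\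
  (row_maps n g (p1 (p2 x)) (p1 (p2 y)) /\ row_maps n g (p2 (p2 x)) (p2 (p2 y))).

Definition edge e (n : den e Reg) (x y : den e V4) : Prop :=
  some_row n (fun g => row_maps4 n g x y).

(** A generator sends [x] to only one quadruple, so exhibiting an image other than [y] proves that
    this generator does not lead to [y]. *)
Definition no_edge e (n : den e Reg) (x y : den e V4) : Prop :=
  each_row n (fun g => exists z, row_maps4 n g x z /\ z <> y).

(** S need not contain the identity, while reachability is reflexive; applying a first generator
    explicitly excludes the empty product. *)
Definition avoided e (n : den e Reg) (x y : den e V4) : Prop :=
  each_row n (fun g => exists z,
    row_maps4 n g x z /\ unreached (edge n) (no_edge n) z y).

Lemma def_row_maps4 t (n g : forall e, den e t -> den e Reg)
    (x y : forall e, den e t -> den e V4) : term n -> term g -> term x -> term y ->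
  definable (fun e z => row_maps4 (n e z) (g e z) (x e z) (y e z)).
Proof.
move=> tn tg tx ty_.
by apply: def_and; apply: def_and; apply: def_row_maps; solve_term.
Qed.

Lemma def_avoided t (n : forall e, den e t -> den e Reg)
    (x y : forall e, den e t -> den e V4) : term n -> term x -> term y ->
  definable (fun e z => avoided (n e z) (x e z) (y e z)).
Proof.
move=> tn tx ty_; apply: def_each_row => //; apply: def_exists.
apply: def_and; first by apply: def_row_maps4; solve_term.
apply: def_unreached; [| |solve_term..].
  by apply: def_some_row; [|apply: def_row_maps4]; solve_term.
apply: def_each_row; first by solve_term.
by apply: def_exists; apply: def_and; [apply: def_row_maps4|apply: def_neq]; solve_term.
Qed.

Section Action.

Variables (e : env) (n : den e Reg) (k : nat) (a : k.-tuple (transf (nat_of n))).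
Hypothesis wa : word e = encode a.
Local Notation m := (nat_of n).

Definition moves1 (s : transf m) (x y : den e Reg) : Prop :=
  exists j : 'I_m, nat_of x = j /\ nat_of y = s j.

Definition moves (s : transf m) (x y : den e V4) : Prop :=
  (moves1 s (p1 (p1 x)) (p1 (p1 y)) /\ moves1 s (p2 (p1 x)) (p2 (p1 y))) /\
  (moves1 s (p1 (p2 x)) (p1 (p2 y)) /\ moves1 s (p2 (p2 x)) (p2 (p2 y))).

Definition points (x : den e V4) : Prop :=
  (nat_of (p1 (p1 x)) < m /\ nat_of (p2 (p1 x)) < m) /\
  (nat_of (p1 (p2 x)) < m /\ nat_of (p2 (p2 x)) < m).

Lemma moves1_total s (x : den e Reg) : nat_of x < m ->
  exists2 y, moves1 s x y & nat_of y < m.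
Proof.
move=> xm; have [|y yE] := @nat_of_surj e (s (Ordinal xm)).
  exact: ltn_trans (ltn_ord _) (nat_of_lt n).
by exists y; [exists (Ordinal xm)|rewrite yE].
Qed.

Lemma moves1_fun s x y y' : moves1 s x y -> moves1 s x y' -> y = y'.
Proof.
move=> [j [xj yj]] [j' [xj' yj']]; apply: nat_of_inj.
by rewrite yj yj'; congr (nat_of_ord (s _)); apply: val_inj; rewrite /= -xj -xj'.
Qed.

Lemma moves1_range s x y : moves1 s x y -> nat_of y < m.
Proof. by move=> [j [_ ->]]. Qed.

Lemma moves1_mul s t x y z : moves1 s x y -> moves1 t y z -> moves1 (s * t)%g x z.
Proof.
move=> [j [xj yj]] [j' [yj' zj']]; exists j; split=> //.
have -> : (s * t)%g j = t (s j) by rewrite ffunE.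
by rewrite zj'; congr (nat_of_ord (t _)); apply: val_inj; rewrite /= -yj -yj'.
Qed.

Lemma moves1_split s t x z : moves1 (s * t)%g x z ->
  exists2 y, moves1 s x y & moves1 t y z.
Proof.
move=> [j [xj zj]]; have [|y yE] := @nat_of_surj e (s j).
  exact: ltn_trans (ltn_ord _) (nat_of_lt n).
exists y; [by exists j|exists (s j); split=> //].
by rewrite zj ffunE.
Qed.

Lemma moves_total s x : points x -> exists y, moves s x y.
Proof.
move=> [[/(moves1_total s)[y1 ? _] /(moves1_total s)[y2 ? _]]].
move=> [/(moves1_total s)[y3 ? _] /(moves1_total s)[y4 ? _]].
by exists (pr (pr y1 y2) (pr y3 y4)).
Qed.

Lemma moves_fun s x y y' : moves s x y -> moves s x y' -> y = y'.
Proof.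
case: y y' => [[y1 y2] [y3 y4]] [[z1 z2] [z3 z4]] [[m1 m2] [m3 m4]] [[n1 n2] [n3 n4]].
congr (_, _, (_, _)).
- exact: moves1_fun m1 n1.
- exact: moves1_fun m2 n2.
- exact: moves1_fun m3 n3.
- exact: moves1_fun m4 n4.
Qed.

Lemma moves_points s x y : moves s x y -> points y.
Proof. by move=> [[/moves1_range ? /moves1_range ?] [/moves1_range ? /moves1_range ?]]. Qed.

Lemma moves_mul s t x y z : moves s x y -> moves t y z -> moves (s * t)%g x z.
Proof.
move=> [[m1 m2] [m3 m4]] [[n1 n2] [n3 n4]]; split; split.
- exact: moves1_mul m1 n1.
- exact: moves1_mul m2 n2.
- exact: moves1_mul m3 n3.
- exact: moves1_mul m4 n4.
Qed.

Lemma moves_split s t x z : moves (s * t)%g x z ->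
  exists2 y, moves s x y & moves t y z.
Proof.
move=> [[/moves1_split[y1 ? ?] /moves1_split[y2 ? ?]]].
move=> [/moves1_split[y3 ? ?] /moves1_split[y4 ? ?]].
by exists (pr (pr y1 y2) (pr y3 y4)).
Qed.

Lemma row_maps4_at (i : 'I_k) (g : den e Reg) x y : nat_of g = row_at a i ->
  row_maps4 n g x y <-> moves (tnth a i) x y.
Proof. by move=> gE; rewrite /row_maps4 !(row_maps_at wa _ _ gE). Qed.

Lemma edgeP x y : edge n x y <-> exists i, moves (tnth a i) x y.
Proof.
rewrite /edge (some_rowP wa); split=> [[i [g [gE /(row_maps4_at _ _ gE)]]]|[i mi]].
  by exists i.
have [g gE] := row_at_den wa i; exists i, g; split=> //.
exact/(row_maps4_at _ _ gE).
Qed.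

Lemma no_edgeP x y : points x -> no_edge n x y <-> ~ edge n x y.
Proof.
move=> px; rewrite edgeP /no_edge (each_rowP wa); split=> [H [i mi]|H i g gE].
  have [g gE] := row_at_den wa i; have [z [/(row_maps4_at _ _ gE) mz]] := H i g gE.
  by apply; apply: moves_fun mz mi.
have [z mz] := moves_total (tnth a i) px; exists z; split.
  exact/(row_maps4_at _ _ gE).
by move=> zy; apply: H; exists i; rewrite -zy.
Qed.

Lemma edge_points x y : edge n x y -> points y.
Proof. by move=> /edgeP[i /moves_points]. Qed.

Lemma generated_moves x y : (exists2 s, generated a s & moves s x y) <->
  exists i z, moves (tnth a i) x z /\ rtc (edge n) z y.
Proof.
split=> [[s gs]|[i [z [mz zy]]]].
  elim: gs x y => {s} [s /tnthP[i ->]|s t _ IHs _ IHt] x y.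
    by exists i, y; split=> //; apply: rt_refl.
  move=> /moves_split[z /IHs[i [u [xu uz]]] /IHt[j [v [zv vy]]]].
  exists i, u; split=> //; apply: rtc_trans uz (rtc_cons _ vy).
  by apply/edgeP; exists j.
pose I z := exists2 s, generated a s & moves s x z.
apply: (rtc_inv (P := I) _ _ zy); last first.
  by exists (tnth a i) => //; apply: generated_gen; apply: mem_tnth.
move=> u v [s gs su] /edgeP[j uv]; exists (s * tnth a j)%g; last exact: moves_mul su uv.
by apply: generated_mul gs _; apply: generated_gen; apply: mem_tnth.
Qed.

Lemma avoidedP x y : points x ->
  avoided n x y <-> ~ exists2 s, generated a s & moves s x y.
Proof.
move=> px; rewrite generated_moves /avoided (each_rowP wa).
have uP z : points z -> unreached (edge n) (no_edge n) z y <-> ~ rtc (edge n) z y.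
  move=> pz; apply: unreachedP => u zu v; apply: no_edgeP.
  by apply: (rtc_inv (P := points) _ pz zu) => b c _; apply: edge_points.
split=> [H [i [z [mz zy]]]|H i g gE].
  have [g gE] := row_at_den wa i; have [z' [/(row_maps4_at _ _ gE) mz']] := H i g gE.
  rewrite -(moves_fun mz mz') => /uP; apply=> //; exact: moves_points mz.
have [z mz] := moves_total (tnth a i) px; exists z; split.
  exact/(row_maps4_at _ _ gE).
apply/uP; first exact: moves_points mz.
by move=> zy; apply: H; exists i, z.
Qed.

End Action.

(** * Properties expressed by coincidences among five points *)

Definition V5 := Pair (Pair Reg Reg) (Pair Reg (Pair Reg Reg)).

Definition pick5 (T : Type) (x y z u v : T) (i : nat) : T :=
  match i with 0 => x | 1 => y | 2 => z | 3 => u | _ => v end.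

Definition pt e (i : nat) (x : den e V5) : den e Reg :=
  pick5 (p1 (p1 x)) (p2 (p1 x)) (p1 (p2 x)) (p1 (p2 (p2 x))) (p2 (p2 (p2 x))) i.

(* A quadruple of points named by their indices in [pick5]. *)
Definition quad : Type := nat * nat * (nat * nat).

Definition quad_pts e (q : quad) (x : den e V5) : den e V4 :=
  pr (pr (pt q.1.1 x) (pt q.1.2 x)) (pr (pt q.2.1 x) (pt q.2.2 x)).

Definition carries n (s : transf n) (p : nat -> 'I_n) (q q' : quad) : Prop :=
  (s (p q.1.1) = p q'.1.1 /\ s (p q.1.2) = p q'.1.2) /\
  (s (p q.2.1) = p q'.2.1 /\ s (p q.2.2) = p q'.2.2).

(** The two elements share points but are otherwise independent, so a counterexample splits into two
    separate reachability questions on quadruples. *)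
Definition coincidence n (S : transf n -> Prop) (q1 q1' q2 q2' : quad) l r : Prop :=
  forall (x y z u v : 'I_n) s t, S s -> S t ->
    carries s (pick5 x y z u v) q1 q1' -> carries t (pick5 x y z u v) q2 q2' ->
    pick5 x y z u v l = pick5 x y z u v r.

(** The implication of [coincidence] turned into a positive disjunction; register values outside the
    n points are excused by the first alternatives. *)
Definition safe e (n : den e Reg) (q1 q1' q2 q2' : quad) l r (x : den e V5) : Prop :=
  (nat_of n <= nat_of (pt 0 x) \/ nat_of n <= nat_of (pt 1 x) \/
   nat_of n <= nat_of (pt 2 x) \/ nat_of n <= nat_of (pt 3 x) \/
   nat_of n <= nat_of (pt 4 x)) \/
  (pt l x = pt r x \/ (avoided n (quad_pts q1 x) (quad_pts q1' x) \/
   avoided n (quad_pts q2 x) (quad_pts q2' x))).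

Lemma term_pt t i (f : forall e, den e t -> den e V5) : term f ->
  term (fun e x => pt i (f e x)).
Proof. by move=> tf; case: i => [|[|[|[|i]]]]; rewrite /pt /=; solve_term. Qed.

Lemma term_quad_pts t q (f : forall e, den e t -> den e V5) : term f ->
  term (fun e x => quad_pts q (f e x)).
Proof.
by move=> tf; apply: term_pr; apply: term_pr; apply: term_pt.
Qed.

Lemma def_safe q1 q1' q2 q2' l r :
  @definable (Pair Reg V5) (fun e z => safe (p1 z) q1 q1' q2 q2' l r (p2 z)).
Proof.
have t1 : @term (Pair Reg V5) Reg (fun e z => p1 z) by solve_term.
have t2 : @term (Pair Reg V5) V5 (fun e z => p2 z) by solve_term.
apply: def_or.
  by do 4?[apply: def_or]; apply: def_le => //; apply: (term_pt _ t2).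
apply: def_or; first by apply: def_eq; apply: (term_pt _ t2).
by apply: def_or; apply: def_avoided => //; apply: (term_quad_pts _ t2).
Qed.

Lemma coincidenceP e (n : den e Reg) k (a : k.-tuple (transf (nat_of n))) q1 q1' q2 q2' l r :
  word e = encode a ->
  coincidence (generated a) q1 q1' q2 q2' l r <->
  forall x : den e V5, safe n q1 q1' q2 q2' l r x.
Proof.
move=> wa.
have key (x y z u v : 'I_(nat_of n)) (X : den e V5) :
    (forall i, nat_of (pt i X) = pick5 x y z u v i) ->
    (forall q q' s, moves s (quad_pts q X) (quad_pts q' X) <->
       carries s (pick5 x y z u v) q q') /\ forall q, points n (quad_pts q X).
  move=> XE; split=> [q q' s|q]; last by rewrite /points /= !XE.
  have m1 i j : moves1 s (pt i X) (pt j X) <->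
      s (pick5 x y z u v i) = pick5 x y z u v j.
    split=> [[o [io jo]]|sE]; last by exists (pick5 x y z u v i); rewrite !XE sE.
    apply: val_inj; rewrite /= -XE jo; congr (nat_of_ord (s _)).
    by apply: val_inj; rewrite /= -XE.
  by rewrite /moves /= !m1.
split=> [C X|HS x y z u v s t gs gt cs ct].
  have [?|x0] := leqP (nat_of n) (nat_of (pt 0 X)); first by left; left.
  have [?|x1] := leqP (nat_of n) (nat_of (pt 1 X)); first by left; right; left.
  have [?|x2] := leqP (nat_of n) (nat_of (pt 2 X)); first by left; do 2!right; left.
  have [?|x3] := leqP (nat_of n) (nat_of (pt 3 X)); first by left; do 3!right; left.
  have [?|x4] := leqP (nat_of n) (nat_of (pt 4 X)); first by left; do 4!right.
  right; set x := Ordinal x0; set y := Ordinal x1; set z := Ordinal x2.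
  set u := Ordinal x3; set v := Ordinal x4.
  have XE i : nat_of (pt i X) = pick5 x y z u v i by case: i => [|[|[|[|i]]]].
  have [mX pX] := key x y z u v X XE.
  have [[s gs ms]|ns] := EM (exists2 s, generated a s & moves s (quad_pts q1 X) (quad_pts q1' X));
    last by right; left; apply/(avoidedP wa).
  have [[t gt mt]|nt] := EM (exists2 s, generated a s & moves s (quad_pts q2 X) (quad_pts q2' X));
    last by right; right; apply/(avoidedP wa).
  left; apply: nat_of_inj; rewrite !XE; congr (nat_of_ord _).
  by apply: (C x y z u v s t gs gt); apply/mX.
have pnt (i : 'I_(nat_of n)) : exists p : den e Reg, nat_of p = i.
  by apply: nat_of_surj; apply: ltn_trans (ltn_ord i) (nat_of_lt n).
have [x' xE] := pnt x; have [y' yE] := pnt y; have [z' zE] := pnt z.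
have [u' uE] := pnt u; have [v' vE] := pnt v.
pose X : den e V5 := pr (pr x' y') (pr z' (pr u' v')).
have XE i : nat_of (pt i X) = pick5 x y z u v i by case: i => [|[|[|[|i]]]].
have [mX pX] := key x y z u v X XE.
case: (HS X) => [|[E|[av|av]]].
- rewrite !XE /= => H; exfalso.
  by move: H (ltn_ord x) (ltn_ord y) (ltn_ord z) (ltn_ord u) (ltn_ord v); lia.
- by apply: val_inj; rewrite /= -!XE E.
- by case: ((avoidedP wa _ (pX q1)).1 av); exists s => //; apply/mX.
- by case: ((avoidedP wa _ (pX q2)).1 av); exists t => //; apply/mX.
Qed.

Lemma NL_of_coincidence (R : forall G : semigroupType, (G -> Prop) -> Prop) q1 q1' q2 q2' l r :
  (forall n k (a : k.-tuple (transf n)),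
     R (transf n) (generated a) <-> coincidence (generated a) q1 q1' q2 q2' l r) ->
  NL (generators_problem R).
Proof.
move=> RC; apply: (NL_of_definable (Q := fun e => exists n : den e Reg,
  well_formed n /\ forall x : den e V5, safe n q1 q1' q2 q2' l r x)).
  apply: def_exists; apply: def_and; first by apply: def_well_formed; solve_term.
  apply: def_forall.
  exact: (def_comp (f := fun e z => pr (p2 (p1 z)) (p2 z)) (def_safe q1 q1' q2 q2' l r)
    (ltac:(solve_term))).
move=> e; split=> [[n [k [a [n0 k0 wa /RC C]]]]|[n [/well_formed_sound[k [a [n0 k0 wa]]] HS]]].
  (* The degree fits into a register because a word with at least one table has at least n
     letters. *)
  have [|N nE] := @nat_of_surj e n.
    have := size_encode a k0; rewrite -wa; have := word_small e; lia.
  subst n; exists N; split; first exact: well_formed_complete wa n0 k0.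
  exact/(coincidenceP _ _ _ _ _ _ wa).
by exists (nat_of n), k, a; split=> //; apply/RC/(coincidenceP _ _ _ _ _ _ wa).
Qed.

(** * Idempotent powers and the four properties *)

Section Semigroup.

Variables (n : nat) (S : transf n -> Prop).
Hypothesis S_mul : forall s t, S s -> S t -> S (s * t)%g.

Lemma transf_mulE (s t : transf n) x : (s * t)%g x = t (s x).
Proof. exact: ffunE. Qed.

Lemma idemP (s : transf n) : idem s <-> forall x, s (s x) = s x.
Proof.
split=> [ss x|ss]; first by rewrite -transf_mulE ss.
by apply/ffunP=> x; rewrite transf_mulE.
Qed.

(** By the pigeonhole principle the powers of [s] repeat from exponent [i] on with period [j - i]; a
    positive multiple of the period that is at least [i] is an idempotent exponent. *)
Lemma iter_idem (s : transf n) : exists2 j, 0 < j &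
  forall x, iter j s (iter j s x) = iter j s x.
Proof.
pose f (i : 'I_(#|{: transf n}|).+1) : transf n := [ffun x => iter i s x].
have /injectivePn[i [j ij fij]] : ~~ injectiveb f.
  apply/negP=> /injectiveP/leq_card; rewrite card_ord; by rewrite ltnn.
wlog lt_ij : i j ij fij / i < j.
  move=> W; case: (ltngtP i j) => [|ji|/val_inj E]; first exact: W ij fij.
    by apply: (W j i) => //; rewrite eq_sym.
  by rewrite E eqxx in ij.
have per x : iter j s x = iter i s x.
  by move/ffunP: fij => /(_ x); rewrite !ffunE.
have {fij ij} step d x : i <= d -> iter (d + (j - i)) s x = iter d s x.
  move=> id; have -> : d + (j - i) = (d - i) + j by lia.
  by rewrite iterD per -iterD subnK.
have steps c d x : i <= d -> iter (d + c * (j - i)) s x = iter d s x.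
  move=> id; elim: c => [|c IH]; first by rewrite addn0.
  by rewrite mulSn [_ + c * _]addnC addnA step ?IH // (leq_trans id) ?leq_addr.
(* The factor [i.+1], and not [i], keeps the exponent positive when [i] is 0. *)
exists (i.+1 * (j - i)); first by rewrite muln_gt0 /= subn_gt0.
by move=> x; rewrite -iterD steps //; nia.
Qed.

(** The exponent is positive, so the power is a product of copies of [s] and stays in [S]. After one
    application of [s] has led to the fixed point [y], the remaining ones do nothing. *)
Lemma idem_power (s : transf n) : S s -> exists f : transf n,
  [/\ S f, idem f & forall x y, s x = y -> s y = y -> f x = y].
Proof.
move=> Ss; have [j j0 jE] := iter_idem s.
have pow i : S [ffun x => iter i.+1 s x].
  elim: i => [|i IH].
    by rewrite (_ : finfun _ = s) //; apply/ffunP=> x; rewrite ffunE.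
  rewrite (_ : finfun _ = ([ffun x => iter i.+1 s x] : transf n) * s)%g; first exact: S_mul.
  by apply/ffunP=> x; rewrite transf_mulE !ffunE.
exists [ffun x => iter j s x]; split.
- by case: (j) j0 => // i _; apply: pow.
- by apply/idemP=> x; rewrite !ffunE jE.
- move=> x y xy yy; rewrite ffunE; case: (j) j0 => // i _.
  by rewrite iterSr xy; elim: i => //= i ->.
Qed.

(** The condition is x s = y, y s = z, hence y = z. Repeating entries fills the quadruple, and the
    second element is given the same task. *)
Lemma all_idempotent_coincidence : all_idempotent S <->
  coincidence S (0, 1, (0, 1)) (1, 2, (1, 2)) (0, 1, (0, 1)) (1, 2, (1, 2)) 1 2.
Proof.
split=> [H x y z _ _ s _ Ss _ [/= [<- <-] _] _|H s Ss].
  by have /idemP-> := H s Ss.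
apply/idemP=> x; symmetry.
by apply: (H x (s x) (s (s x)) x x s s Ss Ss).
Qed.

(** With indices 0 to 4 for x, y, u, v, z: an arbitrary t sends x to u and y to v, while s sends x
    to y and u to z and fixes y and z. The coincidence v = z says x s t = x t s. *)
Lemma idempotents_central_coincidence : idempotents_central S <->
  coincidence S (0, 1, (0, 1)) (2, 3, (2, 3)) (0, 1, (2, 4)) (1, 1, (4, 4)) 3 4.
Proof.
split=> [H x y u v z t s St Ss [/= [tx ty] _] [/= [sx sy] [su sz]]|H f Sf fi].
  have [f [Sf fi fE]] := idem_power Ss; have [_ /(_ t St) ft] := H f Sf fi.
  have := congr1 (fun g : transf n => g x) ft.
  by rewrite !transf_mulE (fE x y) // ty tx (fE u z).
split=> // t St; have /idemP ff := fi; apply/ffunP=> x; rewrite !transf_mulE.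
by apply: (H x (f x) (t x) (t (f x)) (f (t x)) t f St Sf); rewrite /carries /= ?ff.
Qed.

(** Two paths from x: s leads to y and then t to z, while t leads to u and then s to v. Each arrow
    ends in a point fixed by its label, and z = v is the commutation at x. *)
Lemma idempotents_commute_coincidence : idempotents_commute S <->
  coincidence S (0, 1, (3, 4)) (1, 1, (4, 4)) (1, 2, (0, 3)) (2, 2, (3, 3)) 2 4.
Proof.
split=> [H x y z u v s t Ss St [/= [sx sy] [su sv]] [/= [ty tz] [tx tu]]|H f g Sf fi Sg gi].
  have [f [Sf fi fE]] := idem_power Ss; have [g [Sg gi gE]] := idem_power St.
  have := congr1 (fun h : transf n => h x) (H f g Sf fi Sg gi).
  by rewrite !transf_mulE (fE x y) // (gE y z) // (gE x u) // (fE u v).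
have /idemP ff := fi; have /idemP gg := gi; apply/ffunP=> x; rewrite !transf_mulE.
by apply: (H x (f x) (g (f x)) (g x) (f (g x)) f g Sf Sg); rewrite /carries /= ?ff ?gg.
Qed.

(** One path x, y, z, u, v with labels s, t, s, t, each arrow ending in a point fixed by its label.
    Here z is x s t and v is x s t s t. *)
Lemma idempotent_products_coincidence : idempotent_products S <->
  coincidence S (0, 1, (2, 3)) (1, 1, (3, 3)) (1, 2, (3, 4)) (2, 2, (4, 4)) 4 2.
Proof.
split=> [H x y z u v s t Ss St [/= [sx sy] [sz su]] [/= [ty tz] [tu tv]]|H f g Sf fi Sg gi].
  have [f [Sf fi fE]] := idem_power Ss; have [g [Sg gi gE]] := idem_power St.
  have := congr1 (fun h : transf n => h x) (H f g Sf fi Sg gi).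
  by rewrite !transf_mulE (fE x y) // (gE y z) // (fE z u) // (gE u v).
have /idemP ff := fi; have /idemP gg := gi; apply/ffunP=> x; rewrite !transf_mulE.
apply: (H x (f x) (g (f x)) (f (g (f x))) (g (f (g (f x)))) f g Sf Sg);
  by rewrite /carries /= ?ff ?gg.
Qed.

End Semigroup.

Theorem corollary5p2 :
  [/\ NL (generators_problem all_idempotent),
      NL (generators_problem idempotents_central),
      NL (generators_problem idempotents_commute)
    & NL (generators_problem idempotent_products)].
Proof.
split; apply: NL_of_coincidence => n k a.
- exact: all_idempotent_coincidence.
- exact/idempotents_central_coincidence/generated_mul.
- exact/idempotents_commute_coincidence/generated_mul.
- exact/idempotent_products_coincidence/generated_mul.
Qed.
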